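(* Let $g(z)=\sum_{n=0}^\infty \eta_n z^n$ be analytic in the unit disc $\mathbb D$, and let $\mathcal H_g$ be the associated generalized Hilbert operator. If $1\le p<\infty$ and $1<q<\infty$, then the following are equivalent: (i) $\mathcal H_g\in\mathcal B(S^p,S^q)$; (ii) $\mathcal H_g\in\mathcal K(S^p,S^q)$; (iii) $g\in S^q$.
   Context: $\mathbb D=\{z\in\mathbb C:|z|<1\}$ and $\mathrm{Hol}(\mathbb D)$ is the space of analytic functions in $\mathbb D$. The Hardy space $H^p$ ($0<p<\infty$) consists of those $f\in\mathrm{Hol}(\mathbb D)$ with $\|f\|_{H^p}=\sup_{0<r<1}\left(\frac1{2\pi}\int_0^{2\pi}|f(re^{it})|^p\,dt\right)^{1/p}<\infty$. For $1\le p<\infty$, $S^p$ is the space of those $f\in\mathrm{Hol}(\mathbb D)$ with $f'\in H^p$, a Banach space with the norm $|f(0)|+\|f'\|_{H^p}$. Generalized Hilbert operator: for $f(z)=\sum_{k=0}^\infty a_kz^k\in H^1$ (in particular for $f\in S^p$, $p\ge1$), $\mathcal H_g(f)(z)=\sum_{n=0}^\infty(n+1)\eta_{n+1}\left(\sum_{k=0}^\infty\frac{a_k}{n+k+1}\right)z^n=\int_0^1 f(t)\,g'(tz)\,dt$, $z\in\mathbb D$ (the integral converges absolutely, the two expressions agree, and they define an analytic function in $\mathbb D$). For Banach spaces $X,Y$ of analytic functions in $\mathbb D$, $\mathcal B(X,Y)$ denotes the continuous linear operators from $X$ into $Y$, and $\mathcal K(X,Y)$ the compact linear operators from $X$ into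 $Y$; $\mathcal H_g\in\mathcal B(X,Y)$ (resp. $\mathcal K(X,Y)$) means that $\mathcal H_g$ maps $X$ into $Y$ and is bounded (resp. compact). *)

(* Defs.v *)
(* The complex field is R[i] for R : realType;
   R[i]^o is the same type seen as a normed module over itself, the form under
   which the library provides its topology and complex derivatives. *)
From HB Require Import structures.
From mathcomp Require Import all_boot all_order all_algebra.
From mathcomp Require Import all_classical all_reals all_analysis.
From mathcomp Require Import measurable_realfun.
From mathcomp Require Import complex.

Set Implicit Arguments.
Unset Strict Implicit.
Unset Printing Implicit Defensive.

Import Order.TTheory GRing.Theory Num.Theory numFieldNormedType.Exports.

Local Open Scope ring_scope.
Local Open Scope classical_set_scope.
Local Open Scope complex_scope.

Section HardySpaces.
Context {R : realType}.
Local Notation C := (R[i]^o).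

Definition disc : set C := [set z | `|z| < 1].

Definition Hol (f : C -> C) : Prop := forall z, disc z -> derivable f z 1.

(* The norm of R[i] takes its (real) values in R[i]. *)
Definition cabs (z : C) : R := complex.Re `|z|.

Definition circ (r t : R) : C := (r * cos t) +i* (r * sin t).

Definition circ_mean (p r : R) (f : C -> C) : \bar R :=
  ((((2 * pi)^-1)%:E *
    \int[lebesgue_measure]_(t in `[0%R, (2 * pi)%R])
      (cabs (f (circ r t)) `^ p)%:E) `^ p^-1)%E.

Definition hardy_norm (p : R) (f : C -> C) : \bar R :=
  ereal_sup [set circ_mean p r f | r in `]0%R, 1%R[].

Definition Hardy (p : R) (f : C -> C) : Prop :=
  Hol f /\ (hardy_norm p f < +oo)%E.

Definition inS (p : R) (f : C -> C) : Prop := Hol f /\ Hardy p (derive1 f).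

Definition S_norm (p : R) (f : C -> C) : R :=
  cabs (f 0) + fine (hardy_norm p (derive1 f)).

(* Only the values of f on the disc matter in [Hol], [Hardy], [inS] and [S_norm].
   The functions vanishing off the disc give one representative for each
   analytic function on the disc. *)
Definition S_pred (p : R) (hp : 1 <= p) : {pred (C -> C)} :=
  mem [set f : C -> C | inS p f /\ forall z, ~ disc z -> f z = 0].

End HardySpaces.

Record Sspace (R : realType) (p : R) (hp : 1 <= p) := MkS {
  S_fun :> R[i]^o -> R[i]^o ;
  _ : S_fun \in S_pred hp }.
HB.instance Definition _ (R : realType) (p : R) (hp : 1 <= p) :=
  [isSub for @S_fun R p hp].
HB.instance Definition _ (R : realType) (p : R) (hp : 1 <= p) :=
  [Choice of Sspace hp by <:].

Section CplxAux.
Context {R : realType}.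
Local Notation C := (R[i]^o).
Implicit Types (z w : C) (f g : C -> C) (r t p : R).

Lemma cabsE z : (cabs z)%:C = `|z|.
Proof. by case: z => a b; rewrite /cabs normc_def. Qed.

Lemma cabs_ge0 z : 0 <= cabs z.
Proof. rewrite -lecR cabsE; exact: normr_ge0. Qed.

Lemma cabsD z w : cabs (z + w) <= cabs z + cabs w.
Proof. by rewrite -lecR rmorphD/= !cabsE ler_normD. Qed.

Lemma cabsM z w : cabs (z * w) = cabs z * cabs w.
Proof. by apply: (@complexI R); rewrite rmorphM/= !cabsE normrM. Qed.

Lemma cabs0 : cabs (0 : C) = 0.
Proof. by apply: (@complexI R); rewrite cabsE normr0. Qed.

Lemma cabs0_eq0 z : cabs z = 0 -> z = 0.
Proof. by move=> h; apply: (@normr0_eq0 R[i] C); rewrite -cabsE h. Qed.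

Lemma cabsB_le z w : `|cabs z - cabs w| <= cabs (z - w).
Proof.
have cabsN x : cabs (- x) = cabs x by rewrite /cabs normrN.
rewrite ler_norml; apply/andP; split.
  rewrite lerNl opprB lerBlDr -[cabs (z - w)]cabsN opprB.
  by rewrite (le_trans _ (cabsD _ _))// subrK.
by rewrite lerBlDr (le_trans _ (cabsD _ _))// subrK.
Qed.

Lemma pos_cplx (e : R[i]) : 0 < e -> (0 < complex.Re e) /\ e = (complex.Re e)%:C.
Proof. by case: e => a b; rewrite ltcE/= => /andP[/eqP -> a0]. Qed.

Lemma continuous_cabs : continuous (cabs : C -> R).
Proof.
move=> z; apply/(@cvgrPdist_lt R R C (nbhs z) (nbhs_filter z)) => e e0.
have e0' : 0 < e%:C :> R[i] by rewrite ltcR.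
have h : \forall w \near z, `|z - w| < e%:C.
  by apply/nbhs_ballP; exists e%:C.
near=> w.
apply: le_lt_trans (cabsB_le _ _) _.
by rewrite -ltcR cabsE; near: w.
Unshelve. all: by end_near. Qed.

Lemma continuous_real_complex : continuous (fun x : R => x%:C : C).
Proof.
move=> x; apply/cvgrPdist_lt => e /pos_cplx[e0 ->].
have h : \forall y \near x, `|x - y| < complex.Re e.
  by apply/nbhs_ballP; exists (complex.Re e).
near=> y.
rewrite -[X in `|X| < _]rmorphB/= normc_def/= expr0n addr0 sqrtr_sqr ltcR.
by near: y.
Unshelve. all: by end_near. Qed.

Lemma circE r t : circ r t = (r * cos t)%:C + 'i * (r * sin t)%:C.
Proof. by rewrite /circ [LHS]complexE. Qed.

Lemma continuous_circ r : continuous (circ r).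
Proof.
move=> t.
rewrite (_ : circ r = fun t => (r * cos t)%:C + 'i * (r * sin t)%:C :> C);
  last by apply/funext => ?; rewrite circE.
apply: cvgD.
  apply: (@continuous_comp R R C (fun t => r * cos t) (fun x => x%:C)).
    by apply: cvgM; [exact: cvg_cst | exact: continuous_cos].
  exact: continuous_real_complex.
apply: (@cvgM _ _ _ _ (cst 'i) (fun t => (r * sin t)%:C : C)).
  exact: cvg_cst.
apply: (@continuous_comp R R C (fun t => r * sin t) (fun x => x%:C)).
  by apply: cvgM; [exact: cvg_cst | exact: continuous_sin].
exact: continuous_real_complex.
Qed.

Lemma cabs_circ r t : 0 <= r -> cabs (circ r t) = r.
Proof.
move=> r0; rewrite /cabs normc_def/= !exprMn -mulrDr cos2Dsin2 mulr1.
by rewrite sqrtr_sqr ger0_norm.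
Qed.

Lemma discE z : disc z <-> cabs z < 1.
Proof. by rewrite /disc/= -cabsE -(ltcR (cabs z) 1). Qed.

Lemma disc_circ r t : r \in `]0, 1[%R -> disc (circ r t).
Proof.
rewrite in_itv/= => /andP[r0 r1]; apply/discE.
by rewrite cabs_circ// ltW.
Qed.

Lemma Hol_continuous f z : Hol f -> disc z -> {for z, continuous f}.
Proof.
by move=> hf dz; apply: differentiable_continuous; apply/derivable1_diffP/hf.
Qed.

Lemma continuous_on_circ f r : Hol f -> r \in `]0, 1[%R ->
  continuous (fun t => cabs (f (circ r t))).
Proof.
move=> hf r01 t.
apply: (@continuous_comp R C R (f \o circ r) cabs); last exact: continuous_cabs.
apply: (@continuous_comp R C C (circ r) f); first exact: continuous_circ.
by apply: Hol_continuous => //; exact: disc_circ.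
Qed.

Lemma measurable_on_circ f r : Hol f -> r \in `]0, 1[%R ->
  measurable_fun setT (fun t => cabs (f (circ r t))).
Proof.
by move=> hf r01; apply: continuous_measurable_fun; exact: continuous_on_circ.
Qed.

End CplxAux.

Section CplxAux2.
Context {R : realType}.
Local Notation C := (R[i]^o).
Local Notation I := (`[0%R, (2 * pi)%R] : set R).
Local Notation mu := (@lebesgue_measure R).
Implicit Types (z w : C) (f g : C -> C) (r t p : R).

Lemma circ_meanE p r f : 1 <= p ->
  circ_mean p r f = ((((2 * pi)^-1) `^ p^-1)%:E *
    'N[mu]_p%:E[EFin \o ((fun t => cabs (f (circ r t))) \_ I)])%E.
Proof.
move=> p1; have p0 : p != 0 by rewrite gt_eqF// (lt_le_trans ltr01).
rewrite /circ_mean poweRM; last 2 first.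
- by rewrite lee_fin invr_ge0 mulr_ge0// pi_ge0.
- by apply: integral_ge0 => t _; rewrite lee_fin powR_ge0.
rewrite poweR_EFin unlock; congr (_ * (_ `^ _))%E.
rewrite [LHS]integral_mkcond; apply: eq_integral => t _ /=.
rewrite /patch; case: ifPn => _.
  by rewrite ger0_norm// cabs_ge0.
by change (0%:E = (`|0 : R| `^ p)%:E); rewrite normr0 powR0.
Qed.

Lemma measurable_patch f r : Hol f -> r \in `]0, 1[%R ->
  measurable_fun setT ((fun t => cabs (f (circ r t))) \_ I).
Proof.
move=> hf r01; apply/(measurable_restrictT _ _).1 => //.
by apply: measurable_funTS; exact: measurable_on_circ.
Qed.

Lemma circ_mean_ge0 p r f : (0 <= circ_mean p r f)%E.
Proof. exact: poweR_ge0. Qed.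

Lemma circ_meanD p r f g : 1 <= p -> Hol f -> Hol g -> r \in `]0, 1[%R ->
  (circ_mean p r (f + g)%R <= circ_mean p r f + circ_mean p r g)%E.
Proof.
move=> p1 hf hg r01.
have hfg : Hol (f + g) by move=> z dz; apply: derivableD; [exact: hf|exact: hg].
rewrite !circ_meanE// -ge0_muleDr ?Lnorm_ge0//.
apply: lee_wpmul2l; first by rewrite lee_fin powR_ge0.
have mf := measurable_patch hf r01; have mg := measurable_patch hg r01.
apply: le_trans (minkowski_EFin mu mf mg p1).
have p0 : 0 < p by rewrite (lt_le_trans ltr01).
have [mF mFp] : measurable_fun setT ((fun t => cabs (f (circ r t))) \_ I \+
    (fun t => cabs (g (circ r t))) \_ I) /\ True.
  by split => //; exact: measurable_funD.
rewrite unlock; apply: gt0_ler_poweR.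
- by rewrite invr_ge0 ltW.
- by rewrite in_itv/= leey andbT integral_ge0// => t _; exact: poweR_ge0.
- by rewrite in_itv/= leey andbT integral_ge0// => t _; exact: poweR_ge0.
have mh := measurable_patch hfg r01.
apply: ge0_le_integral => //.
- by move=> t _; exact: poweR_ge0.
- rewrite /=; apply/measurable_EFinP.
  by apply: (@measurableT_comp _ _ _ _ _ _ (@powR R ^~ p)) => //;
    exact: measurableT_comp.
- rewrite /=; apply/measurable_EFinP.
  by apply: (@measurableT_comp _ _ _ _ _ _ (@powR R ^~ p)) => //;
    exact: measurableT_comp.
move=> t _ /=; rewrite lee_fin ge0_ler_powR ?nnegrE//; first exact: ltW.
rewrite /patch; case: ifPn => _; last by rewrite addr0.
rewrite !ger0_norm ?addr_ge0 ?cabs_ge0//.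
exact: cabsD.
Qed.

Lemma circ_meanZ p r (a : C) f : 1 <= p -> Hol f -> r \in `]0, 1[%R ->
  (circ_mean p r (a *: f)%R = (cabs a)%:E * circ_mean p r f)%E.
Proof.
move=> p1 hf r01; have p0 : 0 < p by rewrite (lt_le_trans ltr01).
rewrite /circ_mean.
under eq_integral => t _.
  rewrite (_ : (a *: f) (circ r t) = a * f (circ r t))// cabsM powRM ?cabs_ge0//.
  rewrite EFinM; over.
rewrite ge0_integralZl//; last 3 first.
- apply/measurable_EFinP.
  apply: (@measurableT_comp _ _ _ _ _ _ (@powR R ^~ p)) => //.
  by apply: measurable_funTS; exact: measurable_on_circ.
- by move=> t _; rewrite lee_fin powR_ge0.
- by rewrite lee_fin powR_ge0.
have J0 : (0 <= \int[mu]_(t in I) (cabs (f (circ r t)) `^ p)%:E)%E.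
  by apply: integral_ge0 => t _; rewrite lee_fin powR_ge0.
rewrite muleCA [LHS]poweRM ?lee_fin ?powR_ge0//; last first.
  by rewrite mule_ge0// lee_fin invr_ge0 mulr_ge0// pi_ge0.
by rewrite poweR_EFin -powRrM divff ?gt_eqF// powRr1// cabs_ge0.
Qed.

Lemma hardy_norm_ge0 p f : (0 <= hardy_norm p f)%E.
Proof.
apply: le_trans (circ_mean_ge0 p 2^-1 f) _; apply: ereal_sup_ubound.
by exists 2^-1 => //=; rewrite in_itv/= invr_gt0 ltr0n invf_lt1// ltr1n.
Qed.

Lemma hardy_normD p f g : 1 <= p -> Hol f -> Hol g ->
  (hardy_norm p (f + g)%R <= hardy_norm p f + hardy_norm p g)%E.
Proof.
move=> p1 hf hg; apply: ub_ereal_sup => _ [r r01 <-].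
apply: (le_trans (circ_meanD p1 hf hg r01)); apply: leeD.
  by apply: ereal_sup_ubound; exists r.
by apply: ereal_sup_ubound; exists r.
Qed.

Lemma hardy_normZ p (a : C) f : 1 <= p -> Hol f ->
  (hardy_norm p (a *: f)%R = (cabs a)%:E * hardy_norm p f)%E.
Proof.
move=> p1 hf; rewrite /hardy_norm -ereal_supZl ?cabs_ge0//; last first.
  apply/set0P; exists (circ_mean p 2^-1 f), 2^-1 => //=.
  by rewrite in_itv/= invr_gt0 ltr0n invf_lt1// ltr1n.
congr ereal_sup; apply/seteqP; split.
  move=> _ [r r01 <-]; exists (circ_mean p r f); first by exists r.
  by rewrite circ_meanZ.
by move=> _ [_ [r r01 <-] <-]; exists r => //; rewrite circ_meanZ.
Qed.

Lemma hardy_norm_eq p f g : (forall z, disc z -> f z = g z) ->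
  hardy_norm p f = hardy_norm p g.
Proof.
move=> fg; congr ereal_sup; apply: eq_imagel => r r01.
rewrite /circ_mean; congr ((_ * _) `^ _)%E; apply: eq_integral => t _.
by rewrite fg//; exact: disc_circ.
Qed.

Lemma near_disc z : disc z -> \forall w \near z, disc w.
Proof.
move=> /discE dz; have := @continuous_cabs R z => /cvgr_lt /(_ _ dz).
by apply: filterS => w ?; apply/discE.
Qed.

Lemma Hol_eq f g : (forall z, disc z -> f z = g z) -> Hol f -> Hol g.
Proof.
move=> fg hf z dz; apply: near_eq_derivable (hf z dz).
by have := near_disc dz; apply: filterS => w /fg.
Qed.

Lemma derive1_lin (a : C) f g z : Hol f -> Hol g -> disc z ->
  derive1 (a *: f + g) z = (a *: derive1 f + derive1 g) z.
Proof.
move=> hf hg dz; rewrite !derive1E deriveD; last 2 first.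
- exact/derivableZ/hf.
- exact/hg.
by rewrite deriveZ; [rewrite -!derive1E|exact: hf].
Qed.

Lemma Hol_lin (a : C) f g : Hol f -> Hol g -> Hol (a *: f + g).
Proof.
by move=> hf hg z dz; apply: derivableD; [exact/derivableZ/hf|exact: hg].
Qed.


Lemma continuous_ray z : continuous (fun s : R => s%:C * z : C).
Proof.
move=> s; apply: (@cvgM _ _ _ _ (fun s => s%:C : C) (cst z)).
  exact: continuous_real_complex.
exact: cvg_cst.
Qed.

Lemma derive1_0_bound f w (e : R) : derivable f w 1 -> derive1 f w = 0 ->
  0 < e -> \forall h \near (0 : C), cabs (f (h + w) - f w) <= e * cabs h.
Proof.
move=> df f0 e0.
have h0 : h^-1 *: (f (h + w) - f w) @[h --> (0 : C)^'] --> (0 : C).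
  have {}df : cvg (h^-1 *: ((f \o shift w) (h *: (1 : C)) - f w) @[h --> (0 : C)^']) := df.
  rewrite -{2}f0 derive1E.
  have -> : (fun h : C => h^-1 *: (f (h + w) - f w)) =
            (fun h : C => h^-1 *: ((f \o shift w) (h *: (1 : C)) - f w)).
    by apply/funext => h /=; rewrite [h *: 1](mulr1 h).
  exact: df.
have e0' : 0 < e%:C :> R[i] by rewrite ltcR.
move: h0 => /cvgrPdist_le /(_ _ e0').
rewrite near_withinE; apply: filterS => h hh.
have [->|hn0] := eqVneq h 0.
  by rewrite add0r subrr cabs0 mulr0.
have {hh} := hh hn0.
rewrite sub0r normrN normrZ normfV ler_pdivrMl ?normr_gt0//.
by rewrite -!cabsE -rmorphM/= lecR mulrC.
Qed.

Lemma is_derive_ray0 (P : C -> R) f z t :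
  (forall a b, `|P a - P b| <= cabs (a - b)) ->
  derivable f (t%:C * z) 1 -> derive1 f (t%:C * z) = 0 ->
  is_derive (t : R) 1 (fun s : R => P (f (s%:C * z))) 0.
Proof.
move=> lP df f0; set phi := (fun s : R => P _).
have h0 : h^-1 *: ((phi \o shift t) (h *: (1 : R)) - phi t) @[h --> (0 : R)^'] --> (0 : R).
  apply/cvgrPdist_le => e e0.
  have M0 : 0 < 1 + cabs z by rewrite ltr_pwDl// cabs_ge0.
  have B := derive1_0_bound df f0 (divr_gt0 e0 M0).
  have B' : \forall s \near (0 : R),
      cabs (f (s%:C * z + t%:C * z) - f (t%:C * z)) <= e / (1 + cabs z) * cabs (s%:C * z).
    have := @continuous_ray z (0 : R).
    by rewrite /continuous_at /= rmorph0 mul0r => /(_ _ B).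
  rewrite near_withinE; apply: filterS B' => s hs s0.
  rewrite sub0r normrN normrZ normfV ler_pdivrMl ?normr_gt0//.
  rewrite /phi/= [s *: 1](mulr1 s); apply: le_trans (lP _ _) _.
  rewrite rmorphD/= mulrDl; apply: le_trans hs _.
  rewrite cabsM mulrCA.
  have -> : cabs (s%:C : C) = `|s|.
    by rewrite /cabs normc_def/= expr0n addr0 sqrtr_sqr.
  apply: ler_wpM2l => //.
  rewrite -mulrA ler_piMr ?(ltW e0)// mulrC ler_pdivrMr// mul1r.
  by rewrite lerDr.
apply: DeriveDef; first exact: (cvgP _ h0).
exact: cvg_lim h0.
Qed.

Lemma derive1_0_cst f z : Hol f -> (forall w, disc w -> derive1 f w = 0) ->
  disc z -> f z = f 0.
Proof.
move=> hf f0 dz.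
have dray t : t \in `[0, 1]%R -> disc (t%:C * z).
  rewrite in_itv/= => /andP[t0 t1]; apply/discE; rewrite cabsM.
  have -> : cabs (t%:C : C) = t.
    by rewrite /cabs normc_def/= expr0n addr0 sqrtr_sqr ger0_norm.
  by move/discE : dz; apply: le_lt_trans; rewrite ler_piMl// cabs_ge0.
have cstP (P : C -> R) : (forall a b, `|P a - P b| <= cabs (a - b)) ->
    P (f z) = P (f 0).
  move=> lP; set phi := fun s : R => P (f (s%:C * z)).
  have dphi s : s \in `[0, 1]%R -> is_derive (s : R) 1 phi 0.
    by move=> /dray ds; exact: (is_derive_ray0 lP (hf _ ds) (f0 _ ds)).
  have D : {in `[0, 1]%R, forall s : R, derivable phi s 1}.
    by move=> s s01; have [] := dphi s s01.
  have D' (s : R) : s \in `]0, 1[%R -> is_derive s 1 phi (cst 0 s).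
    by move=> s01; apply: dphi; exact: subset_itv_oo_cc.
  have C01 : {within `[0, 1], continuous phi}.
    exact: (derivable_within_continuous D).
  have le01 : (0 : R) <= 1 by exact: ler01.
  have [c _] := MVT_segment le01 D' C01.
  rewrite mul0r /phi rmorph1 rmorph0 mul1r mul0r => /eqP.
  by rewrite subr_eq0 => /eqP.
have RE (a b : C) : `|complex.Re a - complex.Re b| <= cabs (a - b).
  by rewrite -lecR cabsE; move: (normc_ge_Re (a - b)); case: a; case: b.
have IM (a b : C) : `|complex.Im a - complex.Im b| <= cabs (a - b).
  case: a b => a1 a2 [b1 b2]/=; rewrite /cabs normc_def/=.
  by rewrite -[leLHS]sqrtr_sqr ler_sqrt ?addr_ge0 ?sqr_ge0// lerDr sqr_ge0.
by rewrite [f z]complexE [f 0]complexE (cstP _ RE) (cstP _ IM).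
Qed.

Lemma integral_circ_gt0 (k : R -> R) (p t : R) : 0 < p ->
  continuous k -> (forall s, 0 <= k s) ->
  0 <= t < 2 * pi -> 0 < k t -> (0 < \int[mu]_(s in I) (k s `^ p)%:E)%E.
Proof.
move=> p0 ck k0 /andP[t0 t2] kt.
have mk : measurable_fun setT (fun s => k s `^ p).
  apply: (@measurableT_comp _ _ _ _ _ _ (@powR R ^~ p)) => //.
  exact: continuous_measurable_fun.
have : \forall s \near t, k t / 2 < k s.
  have := ck t => /cvgr_gt /(_ (k t / 2)); apply.
  by rewrite gtr_pMr// invf_lt1// ltr1n.
move=> /nbhs_ballP[d /= d0 hd].
pose d' := Num.min (d / 2) (2 * pi - t).
have d'0 : 0 < d' by rewrite lt_min divr_gt0// subr_gt0.
have JI : [set` `[t, t + d']%R] `<=` I.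
  move=> s /=; rewrite !in_itv/= => /andP[ts std]; rewrite (le_trans t0 ts)/=.
  by rewrite (le_trans std)// -lerBrDl ge_min lexx orbT.
apply: (@lt_le_trans _ _ (\int[mu]_(s in [set` `[t, t + d']%R]) (cst ((k t / 2) `^ p)%:E s))%E).
  rewrite integral_cst// [X in (_ * X)%E]lebesgue_measure_itv/= lte_fin ltrDl d'0.
  by rewrite -EFinB -EFinM lte_fin addrAC subrr add0r mulr_gt0// powR_gt0// divr_gt0.
apply: (@le_trans _ _ (\int[mu]_(s in [set` `[t, t + d']%R]) (k s `^ p)%:E)%E).
  apply: ge0_le_integral => //.
  - by move=> s _; rewrite lee_fin powR_ge0.
  - by apply/measurable_EFinP; exact: measurable_funTS.
  move=> s /=; rewrite in_itv/= => /andP[ts std]; rewrite lee_fin.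
  rewrite ge0_ler_powR ?nnegrE ?(ltW p0) ?divr_ge0 ?(ltW kt)// ltW// hd//=.
  rewrite /ball/= distrC ger0_norm ?subr_ge0// ltrBlDl (le_lt_trans std)//.
  by rewrite ltrD2l gt_min; apply/orP; left; rewrite gtr_pMr// invf_lt1// ltr1n.
apply: ge0_subset_integral => //.
- by apply/measurable_EFinP; exact: measurable_funTS.
- by move=> s _; rewrite lee_fin powR_ge0.
Qed.

Lemma polar z : z != 0 -> exists2 t, 0 <= t < 2 * pi & z = circ (cabs z) t.
Proof.
move=> z0; have c0 : 0 < cabs z.
  rewrite lt_neqAle cabs_ge0 andbT eq_sym; apply: contra z0 => /eqP /cabs0_eq0 ->//.
case: z z0 c0 => x y z0; set c := cabs _ => c0.
have c2 : x ^+ 2 + y ^+ 2 = c ^+ 2.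
  by rewrite /c /cabs normc_def/= sqr_sqrtr// addr_ge0 ?sqr_ge0.
have xc : -1 <= x / c <= 1.
  rewrite -ler_norml normrM normfV (gtr0_norm c0) ler_pdivrMr// mul1r.
  rewrite -(@ler_pXn2r _ 2)// ?nnegrE ?(ltW c0)// real_normK ?num_real// -c2.
  by rewrite lerDl sqr_ge0.
have xcI : x / c \in `[-1, 1]%R by rewrite in_itv.
have a0 := acos_ge0 xc. have api := acos_lepi xc.
have ca : cos (acos (x / c)) = x / c by rewrite acosK.
have sa : c * sin (acos (x / c)) = `|y|.
  have cE : c = Num.sqrt (c ^+ 2) by rewrite sqrtr_sqr gtr0_norm.
  rewrite sin_acos// {1}cE -sqrtrM ?sqr_ge0//.
  rewrite mulrBr mulr1 exprMn exprVn mulrCA divff ?mulr1; last first.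
    by rewrite sqrf_eq0 gt_eqF.
  by rewrite -c2 addrAC subrr add0r sqrtr_sqr.
have [y0|y0] := leP 0 y.
  exists (acos (x / c)).
    rewrite a0/= (le_lt_trans api)// mulr_natl mulr2n ltrDl pi_gt0//.
  rewrite /circ ca sa ger0_norm//; congr (_ +i* _).
  by rewrite mulrCA divff ?mulr1// gt_eqF.
exists (2 * pi - acos (x / c)).
  apply/andP; split.
    by rewrite subr_ge0 (le_trans api)// mulr_natl mulr2n lerDl pi_ge0.
  rewrite ltrBlDr ltrDl lt_neqAle a0 andbT eq_sym; apply/negP => /eqP A0.
  by move: sa; rewrite A0 sin0 mulr0 => /eqP; rewrite eq_sym normr_eq0 lt_eqF.
have -> : 2 * pi - acos (x / c) = - acos (x / c) + pi *+ 2.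
  by rewrite addrC mulr_natl.
rewrite /circ cosD2pi sinD2pi cosN sinN ca mulrN sa ltr0_norm// opprK.
congr (_ +i* _).
by rewrite mulrCA divff ?mulr1// gt_eqF.
Qed.

Lemma hardy_norm_eq0 p f z : 1 <= p -> Hol f -> hardy_norm p f = 0%E ->
  disc z -> f z = 0.
Proof.
move=> p1 hf H0; have p0 : 0 < p by rewrite (lt_le_trans ltr01).
have nz w : disc w -> w != 0 -> f w = 0.
  move=> dw w0; have [t t02 wE] := polar w0.
  have r01 : cabs w \in `]0, 1[%R.
    rewrite in_itv/=; apply/andP; split; last exact/discE.
    rewrite lt_neqAle cabs_ge0 andbT eq_sym; apply: contra w0 => /eqP /cabs0_eq0 ->//.
  apply/eqP/negPn/negP => fw0.
  have /(integral_circ_gt0 p0) K : continuous (fun s => cabs (f (circ (cabs w) s))).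
    exact: continuous_on_circ.
  have {}K := K t (fun s => cabs_ge0 _) t02.
  have : (0 < circ_mean p (cabs w) f)%E.
    rewrite lt_neqAle circ_mean_ge0 andbT eq_sym poweR_eq0; last first.
      rewrite mule_ge0 ?lee_fin ?invr_ge0 ?mulr_ge0 ?pi_ge0//.
      by apply: integral_ge0 => s _; rewrite lee_fin powR_ge0.
    rewrite mule_eq0 negb_and negb_or; apply/orP; left; apply/andP; split.
      by rewrite eqe invr_eq0 mulf_neq0// gt_eqF// pi_gt0.
    rewrite gt_eqF// K// -wE lt_neqAle cabs_ge0 andbT eq_sym.
    by apply: contra fw0 => /eqP/cabs0_eq0 ->.
  by rewrite ltNge -H0 ereal_sup_ubound//; exists (cabs w).
have [->|z0] := eqVneq z 0; last by move=> dz; exact: nz.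
move=> d0; apply/eqP/negPn/negP => f00.
have cf0 : 0 < cabs (f 0).
  rewrite lt_neqAle cabs_ge0 andbT eq_sym.
  by apply: contra f00 => /eqP/cabs0_eq0 ->.
have B : \forall w \near (0 : C), 0 < cabs (f w).
  have cf : cabs (f w) @[w --> (0 : C)] --> cabs (f 0).
    apply: (@continuous_comp C C R f cabs); last exact: continuous_cabs.
    exact: Hol_continuous.
  exact: (cvgr_gt _ cf).
have {}B : \forall w \near (0 : C), 0 < cabs (f w) /\ disc w.
  by near=> w; split; near: w => //; exact: near_disc.
have := @continuous_real_complex R (0 : R).
rewrite /continuous_at rmorph0 => /(_ _ B).
move=> /nbhs_ballP[e /= e0 he].
have [] := he (e / 2).
  rewrite /ball/= sub0r normrN gtr0_norm ?divr_gt0//.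
  by rewrite gtr_pMr// invf_lt1// ltr1n.
move=> + de; rewrite nz ?cabs0 ?ltxx//.
by rewrite -(rmorph0 (real_complex R)) (inj_eq (@complexI R)) gt_eqF// divr_gt0.
Unshelve. all: by end_near. Qed.

End CplxAux2.

Lemma inS_lin (R : realType) (p : R) (a : R[i]^o) (f g : R[i]^o -> R[i]^o) :
  1 <= p -> inS p f -> inS p g -> inS p (a *: f + g).
Proof.
move=> p1 [hf [hf' nf]] [hg [hg' ng]].
have E z : disc z -> (a *: derive1 f + derive1 g) z = derive1 (a *: f + g) z.
  by move=> dz; rewrite derive1_lin.
split; first exact: Hol_lin.
split; first by apply: (Hol_eq E); exact: Hol_lin.
rewrite -(hardy_norm_eq p E).
have hZ : Hol (a *: derive1 f) by move=> z dz; apply: derivableZ; exact: hf'.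
have D := hardy_normD p1 hZ hg'.
apply: (le_lt_trans D).
rewrite hardy_normZ //.
apply: lte_add_pinfty; last exact: ng.
apply: lte_mul_pinfty; last exact: nf.
  rewrite lee_fin; exact: cabs_ge0.
by [].
Qed.

Lemma Hol_cst0 (R : realType) : Hol (0 : R[i]^o -> R[i]^o).
Proof. by move=> z _; exact: derivable_cst. Qed.

Lemma derive1_cst0 (R : realType) : derive1 (0 : R[i]^o -> R[i]^o) = 0.
Proof. by apply/funext => z; rewrite derive1_cst. Qed.

Lemma inS0 (R : realType) (p : R) : 1 <= p -> inS p (0 : R[i]^o -> R[i]^o).
Proof.
move=> p1; split; first exact: Hol_cst0.
rewrite derive1_cst0; split; first exact: Hol_cst0.
have := hardy_normZ (0 : R[i]^o) p1 (@Hol_cst0 R).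
by rewrite scale0r cabs0 mul0e => ->.
Qed.

Section SspaceInstances.
Context {R : realType} (p : R) (hp : 1 <= p).
Local Notation C := (R[i]^o).
Local Notation S := (Sspace hp).

Lemma S_predP (f : C -> C) : reflect (inS p f /\ forall z, ~ disc z -> f z = 0)
  (f \in S_pred hp).
Proof. by apply: (iffP idP) => [/set_mem|/mem_set]. Qed.

Lemma S_submod_closed : submod_closed (S_pred hp).
Proof.
split; first by apply/S_predP; split => //; exact: inS0.
move=> a f g /S_predP[Sf f0] /S_predP[Sg g0]; apply/S_predP; split.
  exact: inS_lin.
by move=> z dz; rewrite -[LHS]/(a *: f z + g z) f0// g0// scaler0 addr0.
Qed.

HB.instance Definition _ := GRing.isSubmodClosed.Build _ _ (S_pred hp) S_submod_closed.
HB.instance Definition _ := [SubChoice_isSubLmodule of Sspace hp by <:].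

Lemma SspaceP (f : S) : inS p f /\ forall z, ~ disc z -> f z = 0.
Proof. by apply/S_predP; case: f. Qed.

Let nrm (f : S) : R[i] := (S_norm p f)%:C.

Lemma hardy_norm_fin (f : S) : hardy_norm p (derive1 f) \is a fin_num.
Proof.
by rewrite ge0_fin_numE ?hardy_norm_ge0//; have [[_ []]] := SspaceP f.
Qed.

Lemma S_funD (f g : S) : S_fun (f + g) = (S_fun f + S_fun g)%R.
Proof. by []. Qed.

Lemma S_funZ (a : C) (f : S) : S_fun (a *: f) = (a *: S_fun f)%R.
Proof. by []. Qed.

Lemma S_normD (f g : S) : nrm (f + g) <= nrm f + nrm g.
Proof.
rewrite /nrm S_funD -[leRHS]rmorphD/= lecR /S_norm.
have ff := hardy_norm_fin f; have fg := hardy_norm_fin g.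
have ffg := hardy_norm_fin (f + g); rewrite S_funD in ffg.
have [[hf [hf' _]] _] := SspaceP f; have [[hg [hg' _]] _] := SspaceP g.
rewrite addrACA; apply: lerD; first exact: cabsD.
have E : (hardy_norm p (derive1 (S_fun f + S_fun g)%R) <=
    hardy_norm p (derive1 f) + hardy_norm p (derive1 g))%E.
  have fgE z : disc z -> (derive1 f + derive1 g) z = derive1 (S_fun f + S_fun g) z.
    by move=> dz; have := derive1_lin 1 hf hg dz; rewrite !scale1r => ->.
  have h := hardy_norm_eq p fgE.
  exact: (eq_ind _ (fun x => (x <= _)%E) (hardy_normD hp hf' hg') _ h).
move: ff fg ffg E.
generalize (hardy_norm p (derive1 (S_fun f + S_fun g))) => x.
generalize (hardy_norm p (derive1 f)) => y.
generalize (hardy_norm p (derive1 g)) => t.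
by case: x y t => [x| |] [y| |] [t| |].
Qed.

Lemma S_normZ (a : R[i]) (f : S) : nrm (a *: f) = `|a| * nrm f.
Proof.
rewrite /nrm S_funZ -[`|a|](@cabsE R) -[RHS]rmorphM/=; congr (_%:C).
have ff := hardy_norm_fin f.
have [[hf [hf' _]] _] := SspaceP f.
rewrite /S_norm mulrDr -cabsM; congr (_ + _).
have afE z : disc z -> ((a : C) *: derive1 f) z = derive1 ((a : C) *: S_fun f) z.
  move=> dz; have := derive1_lin (a : C) hf (@Hol_cst0 R) dz.
  by rewrite derive1_cst0 !addr0 => ->.
have h := etrans (esym (hardy_norm_eq p afE)) (hardy_normZ (a : C) hp hf').
apply: (etrans (congr1 fine h)).
exact: (fineM (erefl : (cabs (a : C))%:E \is a fin_num) ff).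
Qed.

Lemma S_norm_eq0 (f : S) : nrm f = 0 -> f = 0.
Proof.
move=> /(@complexI R) /eqP; have [[hf [hf' _]] f0] := SspaceP f.
have n0 := hardy_norm_ge0 p (derive1 f).
rewrite /S_norm paddr_eq0 ?cabs_ge0 ?fine_ge0// => /andP[/eqP/cabs0_eq0 f00 /eqP].
move=> fN0; have {}fN0 : hardy_norm p (derive1 f) = 0%E.
  by rewrite -[LHS]fineK ?hardy_norm_fin// fN0.
apply/val_inj/funext => z /=.
have [dz|/f0//] := pselect (disc z).
rewrite (derive1_0_cst hf _ dz) ?f00// => w dw.
exact: hardy_norm_eq0 hp hf' fN0 dw.
Qed.

HB.instance Definition _ :=
  @Lmodule_isNormed.Build R[i] S nrm S_normD S_normZ S_norm_eq0.
End SspaceInstances.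

Section HilbertOperator.
Context {R : realType}.
Local Notation C := (R[i]^o).

Definition taylor (f : C -> C) (k : nat) : C := derive1n k f 0 / k`!%:R.

(* [eta] is the sequence of Taylor coefficients of the symbol g.  For f in H^1
   and z in the disc both series converge, so both limits are genuine. *)
Definition hilbert_op (eta : nat -> C) (f : C -> C) (z : C) : C :=
  limn (series (fun n : nat =>
    n.+1%:R * eta n.+1 *
    limn (series (fun k : nat => taylor f k / (n + k + 1)%:R : C)) * z ^+ n : C)).

Section Operators.
Context {p q : R} (hp : 1 <= p) (hq : 1 <= q).

(* Elements of [Sspace] vanish off the disc, so an operator given by a formula
   is compared with a map between these spaces on the disc only. *)
Definition agree_on_disc (H : (C -> C) -> C -> C) (T : Sspace hp -> Sspace hq) :=
  forall (f : Sspace hp) (z : C), disc z -> T f z = H f z.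

Definition bounded_op (H : (C -> C) -> C -> C) : Prop :=
  exists T : {linear Sspace hp -> Sspace hq}, agree_on_disc H T /\ continuous T.

Definition compact_op (H : (C -> C) -> C -> C) : Prop :=
  exists T : {linear Sspace hp -> Sspace hq},
    agree_on_disc H T /\ compact (closure (T @` ball (0 : Sspace hp) 1)).

End Operators.
End HilbertOperator.

(* Main.v *)
From HB Require Import structures.
Require Import Defs.
From mathcomp Require Import all_boot all_order all_algebra.
From mathcomp Require Import all_classical all_reals all_analysis.
From mathcomp Require Import measurable_realfun.
From mathcomp Require Import complex.
From mathcomp Require Import ring lra.

(** Boundedness and compactness both contain the assertion that the operator
    maps S^p into S^q; the argument shows that this assertion alone forces the
    symbol g to be in S^q, and that g in S^q conversely yields a bounded and
    compact operator.

    The operator acts on the coefficients of g.  If f has Taylor coefficients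
    a_k, the n-th coefficient of its image is l_n eta_(n+1), where
    l_n = (n+1) sum_k a_k / (n+k+1) is the moment sequence of f ([moment]).
    For f = 1 every l_n is 1, so the image of 1 is (g - g(0))/z.  Hence an
    operator into S^q puts (g - g(0))/z, and then g, in S^q
    ([symbol_of_operator], [symbol_S_iff]).

    For the converse, the moment sequence of any f in S^p is an L^q multiplier
    of power series: multiplying coefficients by it enlarges the q-th mean over
    each circle at most by a factor W controlled by the norm of f
    ([moment_multiplier]).  Indeed l_n = a_0 + sum_j b_j (1/(j+1) - 1/(n+j+2))
    with b_j the coefficients of f', and 1/n is the mean of the bounded function
    i (t - pi) against exp(i n t); so l is, up to sign, a shift and an additive
    constant, the Fourier sequence of this function times the boundary values
    of f'.  The L^1 norm of that product is at most pi times the norm of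
    f', and by Jensen's inequality convolution with an integrable function is
    bounded on L^q by its L^1 norm
    ([rmean_conv], [multiplier_fcoef]).  Boundary values are avoided by working
    on smaller circles and passing to the limit ([multiplier_closed]).

    Compactness comes from a factorisation.  The multipliers of norm at most W
    form a compact set for coordinatewise convergence, by Tychonoff's theorem
    ([compact_multipliers]).  On this set the map l |-> sum l_n eta_(n+1) z^n
    into S^q is continuous ([synthesis_continuous]): for
    Y = sum n eta_(n+1) z^n, which has bounded q-th means, the dilations
    Y(s z) tend to Y in H^q as s -> 1 ([dilation_cvg]), so up to a small error
    uniform in l the image depends on l through a power series on a disc of
    radius s < 1, where finitely many coefficients decide.
    The unit ball of S^p is therefore sent into a compact set.  The dilations
    converge because q > 1: the means of Y increase with the radius, the
    averages (Y + Y(s .))/2 have almost the same norm as Y, and L^q is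
    uniformly convex ([uniform_convexity]).

    The analytic functions of the statement are complex differentiable ones, so
    their Taylor expansions are needed too; they are obtained by differentiating
    a mean over circles that contract to a point ([Hol_expansion]). *)

Set Implicit Arguments.
Unset Strict Implicit.
Unset Printing Implicit Defensive.

Import Order.TTheory GRing.Theory Num.Theory numFieldNormedType.Exports.

Local Open Scope ring_scope.
Local Open Scope classical_set_scope.
Local Open Scope complex_scope.

(** * Series of complex numbers *)

Section ComplexSums.
Context {R : realType}.
Local Notation C := (R[i]^o).
Implicit Types (x y : nat -> C) (b : nat -> R) (z w : C).

Lemma cabsN z : cabs (- z) = cabs z.
Proof. by rewrite /cabs normrN. Qed.

Lemma cabsBC z w : cabs (z - w) = cabs (w - z).
Proof. by rewrite -cabsN opprB. Qed.

Lemma cabs_triangle u z w : cabs (z - w) <= cabs (z - u) + cabs (u - w).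
Proof. by rewrite (le_trans _ (cabsD _ _))// addrA subrK. Qed.

Lemma cabs1 : cabs (1 : C) = 1.
Proof. by apply: (@complexI R); rewrite cabsE normr1. Qed.

Lemma cabsR (a : R) : cabs (a%:C : C) = `|a|.
Proof. by rewrite /cabs normc_def/= expr0n addr0 sqrtr_sqr. Qed.

Lemma cabsX z n : cabs (z ^+ n) = cabs z ^+ n.
Proof. by elim: n => [|n IH]; rewrite ?cabs1// !exprS cabsM IH. Qed.

Lemma cabs_nat n : cabs (n%:R : C) = n%:R.
Proof. by rewrite -(rmorph_nat (real_complex R)) cabsR ger0_norm. Qed.

Lemma cabsV z : cabs z^-1 = (cabs z)^-1.
Proof.
apply: (@complexI R); rewrite cabsE normfV -cabsE.
by rewrite [RHS]fmorphV.
Qed.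

Lemma cabs_sum (I : Type) (s : seq I) (P : pred I) (F : I -> C) :
  cabs (\sum_(i <- s | P i) F i) <= \sum_(i <- s | P i) cabs (F i).
Proof.
elim/big_ind2 : _ => // [|u v u' v' h h']; first by rewrite cabs0.
exact: le_trans (cabsD _ _) (lerD h h').
Qed.

Lemma cabs_gt0 z : (0 < cabs z) = (z != 0).
Proof.
apply/idP/idP => [|z0]; first by apply: contraTN => /eqP ->; rewrite cabs0 ltxx.
rewrite lt_neqAle cabs_ge0 andbT eq_sym.
by apply: contra z0 => /eqP /cabs0_eq0 ->.
Qed.

Lemma cabs_Re z : `|complex.Re z| <= cabs z.
Proof. by rewrite -lecR cabsE; move: (normc_ge_Re z); case: z. Qed.

Lemma cabs_Im z : `|complex.Im z| <= cabs z.
Proof.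
case: z => a b /=; rewrite /cabs normc_def/=.
by rewrite -[leLHS]sqrtr_sqr ler_sqrt ?addr_ge0 ?sqr_ge0// lerDr sqr_ge0.
Qed.

(** The norm of a complex number is itself a complex number; this form with a real
    modulus serves all estimates below. *)
Lemma cvgCP {T : Type} {F : set_system T} {FF : Filter F} (f : T -> C) (l : C) :
  f @ F --> l <-> forall e : R, 0 < e -> \forall t \near F, cabs (f t - l) < e.
Proof.
split=> [/cvgrPdist_lt h e e0|h].
  have e0' : 0 < e%:C :> R[i] by rewrite ltcR.
  by apply: filterS (h _ e0') => t; rewrite -cabsE ltcR cabsBC.
apply/cvgrPdist_lt => e /pos_cplx[e0 ->]; apply: filterS (h _ e0) => t.
by rewrite -cabsE ltcR cabsBC.
Qed.

Definition csum x : C := limn (series x).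

Lemma cvg_csum x (l : C) : series x @ \oo --> l -> csum x = l.
Proof. exact: cvg_lim. Qed.

Lemma Re_series x n :
  complex.Re (series x n) = series (fun k => complex.Re (x k)) n.
Proof. by rewrite /series/= (raddf_sum (@complex.Re R : {additive _ -> _})). Qed.

Lemma Im_series x n :
  complex.Im (series x n) = series (fun k => complex.Im (x k)) n.
Proof. by rewrite /series/= (raddf_sum (@complex.Im R : {additive _ -> _})). Qed.

Lemma csum_cvg x b : (forall n, cabs (x n) <= b n) -> cvgn (series b) ->
  series x @ \oo --> csum x.
Proof.
move=> xb cb.
have h (P : C -> R) : (forall z, `|P z| <= cabs z) -> cvgn (series (P \o x)).
  move=> hP; apply: normed_cvg; apply: series_le_cvg cb.
  - by move=> n /=.
  - by move=> n; exact: le_trans (cabs_ge0 _) (xb n).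
  - by move=> n /=; exact: le_trans (hP _) (xb n).
have hr := h _ cabs_Re; have hi := h _ cabs_Im.
apply: (cvgP ((limn (series (@complex.Re R \o x)))%:C +
  'i * (limn (series (@complex.Im R \o x)))%:C : C)).
rewrite (_ : series x = fun n => ((series (@complex.Re R \o x) n)%:C +
     'i * (series (@complex.Im R \o x) n)%:C : C)); last first.
  by apply/funext => n; rewrite [LHS]complexE Re_series Im_series.
apply: cvgD.
  exact: cvg_comp hr (@continuous_real_complex R _).
apply: (@cvgM _ _ _ _ (cst 'i)); first exact: cvg_cst.
exact: cvg_comp hi (@continuous_real_complex R _).
Qed.

Definition tail b N : R := limn (series b) - series b N.

Lemma cvg_tail b : cvgn (series b) -> tail b @ \oo --> 0.
Proof.
move=> cb; rewrite -(subrr (limn (series b))).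
by apply: cvgB; [exact: cvg_cst|exact: cb].
Qed.

(** The tail of a real majorant bounds the error of truncation uniformly over all
    dominated series; every uniform limit below rests on it. *)
Lemma csum_tail x b N : (forall n, cabs (x n) <= b n) -> cvgn (series b) ->
  cabs (csum x - series x N) <= tail b N.
Proof.
move=> xb cb; apply/ler_addgt0Pr => e e0.
have /cvgCP/(_ _ e0) h := csum_cvg xb cb.
have b0 n : 0 <= b n by exact: le_trans (cabs_ge0 _) (xb n).
have : \forall m \near \oo, cabs (series x m - csum x) < e /\ (N <= m)%N.
  by near=> m; split; near: m => //; exists N.
move=> /filter_ex[m [hm Nm]].
rewrite (le_trans (cabs_triangle (series x m) _ _))// addrC lerD//; last first.
  by rewrite cabsBC ltW.
rewrite sub_series_geq// (le_trans (cabs_sum _ _ _))//.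
rewrite (@le_trans _ _ (\sum_(N <= k < m) b k)) ?ler_sum//.
rewrite -(sub_series_geq _ Nm) lerB// nondecreasing_cvgn_le//.
exact: nondecreasing_series.
Unshelve. all: by end_near. Qed.

Lemma csum_le x b : (forall n, cabs (x n) <= b n) -> cvgn (series b) ->
  cabs (csum x) <= limn (series b).
Proof.
move=> xb cb; have := csum_tail 0 xb cb.
by rewrite /tail !seriesEnat/= !big_geq// !subr0.
Qed.

Lemma cvg_csumD x y (l m : C) : series x @ \oo --> l -> series y @ \oo --> m ->
  series (fun n => x n + y n) @ \oo --> l + m.
Proof.
move=> cx cy; rewrite (_ : series _ = fun n => series x n + series y n).
  exact: cvgD cx cy.
by apply/funext => n; rewrite /series/= big_split.
Qed.

Lemma cvg_csumZ (a : C) x (l : C) : series x @ \oo --> l ->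
  series (fun n => a * x n) @ \oo --> a * l.
Proof.
move=> cx; rewrite (_ : series _ = fun n => a * series x n).
  exact: (cvgM (cvg_cst a) cx).
by apply/funext => n; rewrite /series/= mulr_sumr.
Qed.

Lemma csumD x y : cvgn (series x) -> cvgn (series y) ->
  csum (fun n => x n + y n) = csum x + csum y.
Proof. by move=> cx cy; apply: cvg_csum; exact: cvg_csumD cx cy. Qed.

Lemma csumZ (a : C) x : cvgn (series x) -> csum (fun n => a * x n) = a * csum x.
Proof. by move=> cx; apply: cvg_csum; exact: cvg_csumZ cx. Qed.

Lemma cvg_rseriesZ (a : R) b : cvgn (series b) ->
  series (fun n => a * b n) @ \oo --> a * limn (series b).
Proof.
move=> cx; rewrite (_ : series _ = fun n => a * series b n).
  exact: (cvgM (cvg_cst a) cx).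
by apply/funext => n; rewrite /series/= mulr_sumr.
Qed.

Lemma is_cvg_csumD x y : cvgn (series x) -> cvgn (series y) ->
  cvgn (series (fun n => x n + y n)).
Proof. by move=> cx cy; have h := cvg_csumD cx cy; apply: (cvgP _ h). Qed.

Lemma is_cvg_csumZ (a : C) x : cvgn (series x) ->
  cvgn (series (fun n => a * x n)).
Proof. by move=> cx; have h := cvg_csumZ (a := a) cx; apply: (cvgP _ h). Qed.

Lemma is_cvg_rseriesZ (a : R) b : cvgn (series b) ->
  cvgn (series (fun n => a * b n)).
Proof. by move=> cx; have h := cvg_rseriesZ (a := a) cx; apply: (cvgP _ h). Qed.

Lemma cvg_series_recl x (l : C) : series (fun n => x n.+1) @ \oo --> l ->
  series x @ \oo --> x 0%N + l.
Proof.
move=> h; rewrite -(cvg_shiftS _).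
rewrite (_ : (fun n => _) = fun n => x 0%N + series (fun n => x n.+1) n).
  exact: (cvgD (cvg_cst (x 0%N)) h).
by apply/funext => n; rewrite /series/= big_nat_recl.
Qed.

End ComplexSums.

(** * Power series on the unit disc *)

Section PowerSeries.
Context {R : realType}.
Local Notation C := (R[i]^o).
Implicit Types (x y : nat -> C) (z w h : C) (r : R).

(** Each of the terms 1, r, ..., r^n is at least r^n, so n + 1 copies of r^n are
    dominated by the geometric sum. *)
Lemma natr_exp_bounded r : 0 <= r < 1 ->
  exists B : R, forall n : nat, n.+1%:R * r ^+ n <= B.
Proof.
move=> /andP[r0 r1]; exists (1 - r)^-1 => n.
have d0 : 0 < 1 - r by rewrite subr_gt0.
rewrite -(ler_pM2l d0) mulfV ?gt_eqF//.
apply: (@le_trans _ _ ((1 - r) * \sum_(i < n.+1) r ^+ i)).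
  rewrite ler_pM2l// mulr_natl -[X in _ *+ X]card_ord -sumr_const.
  apply: ler_sum => i _; apply: ler_wiXn2l => //; first exact: ltW.
  by rewrite -ltnS.
rewrite -(opprB r) mulNr -subrX1 opprB.
by rewrite gerBl exprn_ge0.
Qed.

(** Radius of convergence at least 1, as a growth condition: it is visibly stable
    under the operations on coefficients and needs no limit. *)
Definition adm x := forall r, 0 < r < 1 ->
  exists M : R, forall n, cabs (x n) * r ^+ n <= M.

(** Compare with a geometric series on an intermediate radius. *)
Lemma adm_summable x r : adm x -> 0 <= r < 1 ->
  cvgn (series (fun n => cabs (x n) * r ^+ n)).
Proof.
move=> ax /andP[r0 r1]; have [s [s0 s1 rs]] : exists s : R, [/\ 0 < s, s < 1 & r < s].
  by exists ((1 + r) / 2); split; lra.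
have [|M hM] := ax s; first by rewrite s0.
have k1 : `|r / s| < 1.
  have rs0 : 0 <= r / s by rewrite divr_ge0// ltW.
  by rewrite (ger0_norm rs0) ltr_pdivrMr// mul1r.
apply: (@series_le_cvg R (fun n => cabs (x n) * r ^+ n)
  (fun n => M * (r / s) ^+ n)).
- by move=> n; rewrite mulr_ge0 ?cabs_ge0 ?exprn_ge0.
- move=> n; rewrite /= mulr_ge0 ?exprn_ge0 ?divr_ge0 ?(ltW s0)//.
  by rewrite (le_trans _ (hM 0%N))// mulr_ge0 ?cabs_ge0//.
- move=> n; rewrite /= expr_div_n mulrA ler_pdivlMr ?exprn_gt0// mulrAC.
  by rewrite ler_wpM2r ?exprn_ge0.
- exact: is_cvg_geometric_series.
Qed.

Lemma adm_le (c : R) x y : 0 <= c -> (forall n, cabs (y n) <= c * cabs (x n)) ->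
  adm x -> adm y.
Proof.
move=> c0 yx ax r /[dup] r01 /andP[r0 r1]; have [M hM] := ax _ r01.
exists (c * M) => n; rewrite (@le_trans _ _ (c * cabs (x n) * r ^+ n))//.
  by rewrite ler_wpM2r ?exprn_ge0// ltW.
by rewrite -mulrA ler_wpM2l.
Qed.

Lemma admD x y : adm x -> adm y -> adm (fun n => x n + y n).
Proof.
move=> ax ay r r01; have [M hM] := ax _ r01; have [N hN] := ay _ r01.
exists (M + N) => n; rewrite (le_trans _ (lerD (hM n) (hN n)))//.
rewrite -mulrDl ler_wpM2r ?cabsD// exprn_ge0// ltW//.
by case/andP: r01.
Qed.

Lemma adm_nat x : adm x -> adm (fun n => n%:R * x n).
Proof.
move=> ax r /andP[r0 r1]; have [s [s0 s1 rs]] : exists s : R, [/\ 0 < s, s < 1 & r < s].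
  by exists ((1 + r) / 2); split; lra.
have [|M hM] := ax s; first by rewrite s0.
have k1 : 0 <= r / s < 1.
  by rewrite divr_ge0 ?(ltW s0) ?(ltW r0)// ltr_pdivrMr// mul1r.
have [B hB] := natr_exp_bounded k1; exists (M * B) => n.
have -> : cabs (n%:R * x n) * r ^+ n =
    (cabs (x n) * s ^+ n) * (n%:R * (r / s) ^+ n).
  rewrite cabsM cabs_nat expr_div_n; field; rewrite ?expf_neq0 ?gt_eqF//.
apply: ler_pM => //.
- by rewrite mulr_ge0 ?cabs_ge0 ?exprn_ge0// ltW.
- by rewrite mulr_ge0 ?exprn_ge0//; case/andP: k1.
- rewrite (le_trans _ (hB n))// ler_wpM2r ?ler_nat// exprn_ge0//.
  by case/andP: k1.
Qed.

Lemma adm_shift x : adm x -> adm (fun n => x n.+1).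
Proof.
move=> ax r /[dup] r01 /andP[r0 r1]; have [M hM] := ax _ r01.
exists (M / r) => n; rewrite ler_pdivlMr// -mulrA -exprSr; exact: hM.
Qed.

Lemma adm_bounded (B : R) x : (forall n, cabs (x n) <= B) -> adm x.
Proof.
move=> hB r /andP[r0 r1]; exists B => n; rewrite (le_trans _ (hB n))//.
by rewrite ler_piMr ?cabs_ge0// exprn_ile1// ltW.
Qed.

(** Coefficients of the derivative. *)
Definition dcoef x n : C := n.+1%:R * x n.+1.

Lemma adm_dcoef x : adm x -> adm (dcoef x).
Proof. by move=> ax; apply: (@adm_shift (fun n => n%:R * x n)); exact: adm_nat. Qed.

Definition ps x z : C := csum (fun n => x n * z ^+ n).

Lemma ps_dom x z r : cabs z <= r -> forall n, cabs (x n * z ^+ n) <= cabs (x n) * r ^+ n.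
Proof.
by move=> zr n; rewrite cabsM cabsX ler_wpM2l ?cabs_ge0// lerXn2r ?nnegrE ?cabs_ge0// (le_trans (cabs_ge0 z)).
Qed.

Lemma disc_itv z : disc z -> 0 <= cabs z < 1.
Proof. by move=> /discE h; rewrite cabs_ge0. Qed.

Lemma ps_cvg x z : adm x -> disc z -> series (fun n => x n * z ^+ n) @ \oo --> ps x z.
Proof.
move=> ax /disc_itv dz.
exact: (csum_cvg (ps_dom x (lexx (cabs z))) (adm_summable ax dz)).
Qed.

Lemma ps_tail x z r N : adm x -> cabs z <= r < 1 ->
  cabs (ps x z - \sum_(0 <= n < N) x n * z ^+ n) <=
  tail (fun n => cabs (x n) * r ^+ n) N.
Proof.
move=> ax /andP[zr r1]; apply: (csum_tail N (ps_dom x zr)).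
by apply: adm_summable => //; rewrite r1 (le_trans (cabs_ge0 z)).
Qed.

Lemma psD x y z : adm x -> adm y -> disc z ->
  ps (fun n => x n + y n) z = ps x z + ps y z.
Proof.
move=> ax ay dz; rewrite -csumD.
- by congr csum; apply/funext => n; rewrite mulrDl.
- exact: (cvgP _ (ps_cvg ax dz)).
- exact: (cvgP _ (ps_cvg ay dz)).
Qed.

Lemma psZ (a : C) x z : adm x -> disc z ->
  ps (fun n => a * x n) z = a * ps x z.
Proof.
move=> ax dz; rewrite -csumZ; last exact: (cvgP _ (ps_cvg ax dz)).
by congr csum; apply/funext => n; rewrite mulrA.
Qed.

Lemma admZ (a : C) x : adm x -> adm (fun n => a * x n).
Proof. by apply: (adm_le (cabs_ge0 a)) => n; rewrite cabsM. Qed.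

Lemma psB x y z : adm x -> adm y -> disc z ->
  ps (fun n => x n - y n) z = ps x z - ps y z.
Proof.
move=> ax ay dz; rewrite -[X in _ - X]mul1r -mulNr -psZ// -psD//.
  by congr csum; apply/funext => n; rewrite mulN1r.
exact: admZ.
Qed.

Lemma ps0 x : ps x 0 = x 0%N.
Proof.
apply: cvg_csum; rewrite -[x 0%N]addr0.
have := @cvg_series_recl _ (fun n => x n * 0 ^+ n) 0.
rewrite expr0 mulr1; apply.
rewrite (_ : series _ = fun=> 0); first exact: cvg_cst.
by apply/funext => n; rewrite /series/= big1// => i _; rewrite expr0n mulr0.
Qed.

Lemma ps_recl x z : adm x -> disc z ->
  ps x z = x 0%N + z * ps (fun n => x n.+1) z.
Proof.
move=> ax dz; apply: cvg_csum.
have := @cvg_series_recl _ (fun n => x n * z ^+ n) (z * ps (fun n => x n.+1) z).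
rewrite expr0 mulr1; apply.
rewrite (_ : series _ = fun n => z * series (fun n => x n.+1 * z ^+ n) n).
  exact: (cvgM (cvg_cst z) (ps_cvg (adm_shift ax) dz)).
apply/funext => n; rewrite /series/= mulr_sumr; apply: eq_bigr => i _.
by rewrite exprS mulrCA.
Qed.

(** Second-order remainder of z^n, uniform on the disc of radius r.  Multiplying by
    r^2 keeps the exponents natural for n < 2. *)
Lemma exp_taylor2 z h r n : 0 < r -> cabs z <= r -> cabs (z + h) <= r ->
  cabs ((z + h) ^+ n - z ^+ n - n%:R * z ^+ n.-1 * h) * r ^+ 2 <=
  n%:R ^+ 2 * r ^+ n * cabs h ^+ 2.
Proof.
move=> r0 zr zhr; elim: n => [|n IH].
  by rewrite !expr0 subrr mul0r mul0r subr0 cabs0 mul0r expr2 !mul0r.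
have -> : (z + h) ^+ n.+1 - z ^+ n.+1 - n.+1%:R * z ^+ n.+1.-1 * h =
   (z + h) * ((z + h) ^+ n - z ^+ n - n%:R * z ^+ n.-1 * h) +
   n%:R * z ^+ n.-1 * h ^+ 2.
  case: n {IH} => [|n] /=; first by rewrite !expr0 !expr1; ring.
  by rewrite !exprS -[n.+2]addn1 -[n.+1]addn1 !natrD; ring.
apply: (@le_trans _ _ ((r * cabs ((z + h) ^+ n - z ^+ n - n%:R * z ^+ n.-1 * h)
   + n%:R * r ^+ n.-1 * cabs h ^+ 2) * r ^+ 2)).
  apply: ler_wpM2r; first by rewrite exprn_ge0// ltW.
  apply: (le_trans (cabsD _ _)); apply: lerD.
    by rewrite cabsM ler_wpM2r// cabs_ge0.
  rewrite 2!cabsM cabs_nat !cabsX.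
  apply: (@ler_wpM2r R (cabs h ^+ 2)); first by rewrite exprn_ge0// cabs_ge0.
  by apply: ler_wpM2l => //; rewrite lerXn2r ?nnegrE ?cabs_ge0// ltW.
rewrite mulrDl -[in X in X + _]mulrA.
apply: (@le_trans _ _ (r * (n%:R ^+ 2 * r ^+ n * cabs h ^+ 2) +
    n%:R * r ^+ n.+1 * cabs h ^+ 2)).
  apply: lerD; first by rewrite ler_pM2l.
  case: n {IH} => [|n] /=; first by rewrite !mul0r.
  rewrite le_eqVlt; apply/orP; left; apply/eqP.
  by rewrite (exprS r n.+1) (exprS r n); ring.
have -> : r * (n%:R ^+ 2 * r ^+ n * cabs h ^+ 2) + n%:R * r ^+ n.+1 * cabs h ^+ 2
  = (n%:R ^+ 2 + n%:R) * (r ^+ n.+1 * cabs h ^+ 2) by rewrite (exprS r n); ring.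
rewrite -mulrA ler_wpM2r//.
  by rewrite mulr_ge0 ?exprn_ge0 ?cabs_ge0 ?(ltW r0)//.
have : (0 : R) <= n%:R by [].
by rewrite -[n.+1]addn1 natrD; set m : R := n%:R => m0; nra.
Qed.

Lemma ps_nat x z : adm x -> disc z ->
  csum (fun n => n%:R * x n * z ^+ n.-1) = ps (dcoef x) z.
Proof.
move=> ax dz; apply: cvg_csum.
have := @cvg_series_recl _ (fun n => n%:R * x n * z ^+ n.-1) (ps (dcoef x) z).
rewrite !mul0r add0r; apply.
exact: ps_cvg (adm_dcoef ax) dz.
Qed.

(** Summing the remainders of the monomials: a quadratic remainder bound gives
    differentiability without exchanging limits. *)
Lemma ps_taylor2 x z h r : adm x -> 0 < r < 1 -> cabs z <= r -> cabs (z + h) <= r ->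
  cabs (ps x (z + h) - ps x z - h * ps (dcoef x) z) <=
  limn (series (fun n => cabs (n%:R * (n%:R * x n)) * r ^+ n)) / r ^+ 2 * cabs h ^+ 2.
Proof.
move=> ax /andP[r0 r1] zr zhr.
have dz : disc z by apply/discE; exact: le_lt_trans r1.
have dzh : disc (z + h) by apply/discE; exact: le_lt_trans r1.
have s2 : cvgn (series (fun n => cabs (n%:R * (n%:R * x n)) * r ^+ n)).
  by apply: adm_summable; [do 2 apply: adm_nat|rewrite ltW].
set b := fun n => cabs (n%:R * (n%:R * x n)) * r ^+ n in s2 *.
have c1 : cvgn (series (fun n => x n * (z + h) ^+ n)).
  exact: (cvgP _ (ps_cvg ax dzh)).
have c2 : cvgn (series (fun n => x n * z ^+ n)).
  exact: (cvgP _ (ps_cvg ax dz)).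
have c3 : cvgn (series (fun n => n%:R * x n * z ^+ n.-1)).
  have := @cvg_series_recl _ (fun n => n%:R * x n * z ^+ n.-1) (ps (dcoef x) z).
  by move=> /(_ (ps_cvg (adm_dcoef ax) dz)) hh; exact: (cvgP _ hh).
have c2' : cvgn (series (fun n => -1 * (x n * z ^+ n))).
  exact: (is_cvg_csumZ c2).
have c3' : cvgn (series (fun n => - h * (n%:R * x n * z ^+ n.-1))).
  exact: (is_cvg_csumZ c3).
have -> : ps x (z + h) - ps x z - h * ps (dcoef x) z =
  csum (fun n => x n * (z + h) ^+ n + -1 * (x n * z ^+ n) +
    - h * (n%:R * x n * z ^+ n.-1)).
  have c12 := is_cvg_csumD c1 c2'.
  rewrite (csumD c12 c3') (csumD c1 c2') (csumZ _ c2) (csumZ _ c3) (ps_nat ax dz).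
  by rewrite mulN1r mulNr.
have hb n : cabs (x n * (z + h) ^+ n + -1 * (x n * z ^+ n) +
    - h * (n%:R * x n * z ^+ n.-1)) <= (r ^- 2 * cabs h ^+ 2) * b n.
  have -> : x n * (z + h) ^+ n + -1 * (x n * z ^+ n) +
    - h * (n%:R * x n * z ^+ n.-1) =
    x n * ((z + h) ^+ n - z ^+ n - n%:R * z ^+ n.-1 * h) by ring.
  rewrite cabsM /b !cabsM cabs_nat.
  have r2 : 0 < r ^+ 2 by rewrite exprn_gt0.
  rewrite -(ler_pM2r r2) -(mulrA (cabs (x n))).
  apply: (@le_trans _ _ (cabs (x n) * (n%:R ^+ 2 * r ^+ n * cabs h ^+ 2))).
    by apply: ler_wpM2l; [exact: cabs_ge0|exact: exp_taylor2].
  rewrite le_eqVlt; apply/orP; left; apply/eqP; field.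
  by rewrite gt_eqF.
have -> : limn (series b) / r ^+ 2 * cabs h ^+ 2 =
  limn (series (fun n => (r ^- 2 * cabs h ^+ 2) * b n)).
  rewrite (cvg_lim _ (cvg_rseriesZ (a := r ^- 2 * cabs h ^+ 2) s2))//.
  by ring.
apply: csum_le hb _.
exact: (is_cvg_rseriesZ s2).
Qed.
End PowerSeries.

(** * Differentiation of power series *)

Section TaylorCoefficients.
Context {R : realType}.
Local Notation C := (R[i]^o).
Implicit Types (x y : nat -> C) (z w h : C) (r : R) (f : C -> C).

Lemma near_cabs z (d : R) : 0 < d -> \forall w \near z, cabs (w - z) < d.
Proof.
move=> d0; have h : id @ z --> z by exact: cvg_id.
by move/cvgCP : h => /(_ _ d0).
Qed.

(** The form in which [ps_taylor2] yields a derivative. *)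
Lemma derive1_quadratic f z (L : C) (K d : R) : 0 < d ->
  (forall h, cabs h < d -> cabs (f (z + h) - f z - h * L) <= K * cabs h ^+ 2) ->
  derivable f z 1 /\ derive1 f z = L.
Proof.
move=> d0 hf.
have h0 : h^-1 *: ((f \o shift z) (h *: (1 : C)) - f z) @[h --> (0 : C)^'] --> (L : C).
  apply/(@cvgCP R C) => e e0.
  have K0 : 0 < 1 + `|K| by rewrite ltr_pwDl.
  have ed : 0 < Num.min d (e / (1 + `|K|)) by rewrite lt_min d0 divr_gt0.
  have := near_cabs (0 : C) ed.
  rewrite near_withinE; apply: filterS => h; rewrite subr0 lt_min => /andP[hd he] hn0.
  have {}hn0 : h != 0 := hn0.
  have ch : 0 < cabs h by rewrite cabs_gt0.
  rewrite /= [h *: 1](mulr1 h) [h + z]addrC.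
  have -> : h^-1 *: (f (z + h) - f z) - L = h^-1 * (f (z + h) - f z - h * L).
    by rewrite [RHS]mulrBr mulrA mulVf// mul1r.
  rewrite cabsM cabsV ltr_pdivrMl// (le_lt_trans (hf _ hd))//.
  rewrite expr2 mulrCA ltr_pM2l//.
  rewrite (@le_lt_trans _ _ ((1 + `|K|) * cabs h))//.
    rewrite ler_wpM2r ?(ltW ch)//.
    by rewrite (le_trans (ler_norm K))// lerDr.
  by rewrite mulrC -ltr_pdivlMr.
split; first exact: (cvgP _ h0).
rewrite derive1E; exact: cvg_lim h0.
Qed.

Lemma ps_derive x z : adm x -> disc z ->
  derivable (ps x) z 1 /\ derive1 (ps x) z = ps (dcoef x) z.
Proof.
move=> ax /discE dz.
have [r [zr r1]] : exists r : R, cabs z < r /\ r < 1.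
  by exists ((1 + cabs z) / 2); split; lra.
have r0 : 0 < r := le_lt_trans (cabs_ge0 z) zr.
have rz : 0 < r - cabs z by rewrite subr_gt0.
apply: (derive1_quadratic rz) => h hr.
have rr : 0 < r < 1 by apply/andP.
apply: (ps_taylor2 ax rr (ltW zr)).
by rewrite (le_trans (cabsD _ _))// -lerBrDl ltW.
Qed.

Lemma Hol_ps x : adm x -> Hol (ps x).
Proof. by move=> ax z dz; have [] := ps_derive ax dz. Qed.

Lemma derive1_eq f g z : (forall w, disc w -> f w = g w) -> disc z ->
  derive1 f z = derive1 g z.
Proof.
move=> fg dz; rewrite !derive1E; apply: near_eq_derive.
by have := near_disc dz; apply: filterS => w /fg.
Qed.

Lemma derive1n_ps f x : adm x -> (forall z, disc z -> f z = ps x z) ->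
  forall k z, disc z -> derive1n k f z = ps (iter k dcoef x) z.
Proof.
move=> ax fx; elim=> [|k IH] z dz; first exact: fx.
rewrite derive1nS (derive1_eq IH dz) iterS.
have ak : adm (iter k dcoef x) by elim: k {IH} => // k IH; exact: adm_dcoef.
by have [] := ps_derive ak dz.
Qed.

Lemma iter_dcoef x k n : n`!%:R * iter k dcoef x n = (n + k)`!%:R * x (n + k)%N.
Proof.
elim: k n => [|k IH] n; first by rewrite addn0.
rewrite iterS /dcoef mulrA -natrM mulnC -factS IH.
by rewrite addSnnS.
Qed.

Lemma disc0 : disc (0 : C).
Proof. by apply/discE; rewrite cabs0. Qed.

(** Taylor coefficients are defined by iterated derivatives at 0, hence only depend on
    the values on the disc; any admissible expansion is the Taylor expansion. *)
Lemma taylor_ps f x : adm x -> (forall z, disc z -> f z = ps x z) ->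
  taylor f = x.
Proof.
move=> ax fx; apply/funext => k.
rewrite /taylor (derive1n_ps ax fx k disc0) ps0.
have := iter_dcoef x k 0; rewrite fact0 mul1r add0n => ->.
by rewrite mulrAC divff ?mul1r// pnatr_eq0 -lt0n fact_gt0.
Qed.

Lemma ps_inj x y : adm x -> adm y -> (forall z, disc z -> ps x z = ps y z) -> x = y.
Proof.
move=> ax ay xy; rewrite -(taylor_ps (f := ps x) ax)//.
by apply: taylor_ps.
Qed.

End TaylorCoefficients.

(** * Means over a period *)

Section RealMeans.
Context {R : realType}.
Local Notation I := (`[0%R, (2 * pi)%R] : set R).
Local Notation mu := (@lebesgue_measure R).
Implicit Types (u v w k : R -> R) (a t s : R).

Lemma twopi_gt0 : (0 : R) < 2 * pi.
Proof. by rewrite mulr_gt0// pi_gt0. Qed.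

Lemma integrable_I u : continuous u -> mu.-integrable I (EFin \o u).
Proof.
move=> cu; apply: continuous_compact_integrable; first exact: segment_compact.
exact: continuous_subspaceT.
Qed.

Definition rmean u : R := (2 * pi)^-1 * \int[mu]_(t in I) u t.

Lemma eq_rmean u v : (forall t, 0 <= t <= 2 * pi -> u t = v t) -> rmean u = rmean v.
Proof.
move=> uv; congr (_ * _); apply: eq_Rintegral => t.
by rewrite inE/= in_itv/=; exact: uv.
Qed.

Lemma rmeanD u v : continuous u -> continuous v ->
  rmean (fun t => u t + v t) = rmean u + rmean v.
Proof.
move=> cu cv; have iu := integrable_I cu; have iv := integrable_I cv.
by rewrite /rmean RintegralD// mulrDr.
Qed.

Lemma rmeanZ a u : continuous u -> rmean (fun t => a * u t) = a * rmean u.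
Proof.
move=> cu; have iu := integrable_I cu.
by rewrite /rmean RintegralZl// mulrCA.
Qed.

Lemma rmean_cst a : rmean (fun=> a) = a.
Proof.
rewrite /rmean Rintegral_cst// [X in fine X]lebesgue_measure_itv/= lte_fin twopi_gt0.
by rewrite /= subr0 mulrCA mulVf ?mulr1// gt_eqF// twopi_gt0.
Qed.

Lemma le_rmean u v : continuous u -> continuous v ->
  (forall t, u t <= v t) -> rmean u <= rmean v.
Proof.
move=> cu cv uv; rewrite ler_wpM2l ?invr_ge0 ?(ltW twopi_gt0)//.
by apply: le_Rintegral => //; exact: integrable_I.
Qed.

Lemma rmean_ge0 u : (forall t, 0 <= u t) -> 0 <= rmean u.
Proof.
by move=> u0; rewrite mulr_ge0 ?invr_ge0 ?(ltW twopi_gt0)// Rintegral_ge0.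
Qed.

(** The fundamental theorem of calculus; every integral that is computed explicitly
    below comes from this. *)
Lemma rmean_derive (U u : R -> R) : (forall t, is_derive t 1 U (u t)) ->
  continuous u -> rmean u = (2 * pi)^-1 * (U (2 * pi) - U 0).
Proof.
move=> dU cu; congr (_ * _).
have cU t : {for t, continuous U}.
  apply: differentiable_continuous; apply/derivable1_diffP.
  by have [] := dU t.
rewrite /Rintegral (continuous_FTC2 (F := U) twopi_gt0)//.
- exact: continuous_subspaceT.
- split.
  + by move=> t _; have [] := dU t.
  + by apply: cvg_at_right_filter; exact: cU.
  + by apply: cvg_at_left_filter; exact: cU.
- by move=> t _; rewrite derive1E; apply: derive_val.
Qed.

(** With K a primitive of k, the difference K(r + 2 pi) - K(r) has derivative
    k(r + 2 pi) - k(r) = 0 in r. *)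
Lemma rmean_shift k s : continuous k -> (forall t, k (t + 2 * pi) = k t) ->
  0 <= s -> rmean (fun t => k (s + t)) = rmean k.
Proof.
(* [-1, u] contains all the translates [r, r + 2 pi] in its interior *)
move=> ck pk s0; pose u : R := s + 2 * pi + 1.
pose K (x : R) : R := \int[mu]_(t in [set` `[-1, x]%R]) k t.
have dK x : -1 < x -> x < u -> is_derive x 1 K (k x).
  move=> x1 xu.
  have ik : mu.-integrable [set` `[-1, u]%R] (EFin \o k).
    apply: continuous_compact_integrable; first exact: segment_compact.
    exact: continuous_subspaceT.
  have [dK KE] := continuous_FTC1_closed xu ik x1 (ck x).
  by apply: DeriveDef; [exact: dK|rewrite -derive1E; exact: KE].
have tp := twopi_gt0.
have dKs r t : 0 <= r <= s -> 0 <= t <= 2 * pi ->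
    is_derive (t : R) 1 (fun t => K (r + t)) (k (r + t)).
  move=> /andP[r0 rs] /andP[t0 t2].
  have h : is_derive (r + t) 1 K (k (r + t)).
    by apply: dK; rewrite /u; lra.
  have g : is_derive t 1 (fun t : R => r + t) (0 + 1).
    by apply: is_deriveD.
  have := is_derive1_comp h g.
  by rewrite add0r mulr1.
have mE r : 0 <= r <= s -> rmean (fun t => k (r + t)) =
    (2 * pi)^-1 * (K (r + 2 * pi) - K r).
  move=> rs; congr (_ * _).
  have ckr : continuous (fun t => k (r + t)).
    move=> t; apply: continuous_comp; last exact: ck.
    by apply: cvgD; [exact: cvg_cst|exact: cvg_id].
  have dr t : 0 <= t <= 2 * pi -> {for t, continuous (fun t => K (r + t))}.
    move=> tI; apply: differentiable_continuous; apply/derivable1_diffP.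
    by have [] := dKs r t rs tI.
  rewrite /Rintegral (continuous_FTC2 (F := fun t => K (r + t)) twopi_gt0)//.
  - by rewrite /= addr0.
  - exact: continuous_subspaceT.
  - split.
    + move=> t; rewrite in_itv/= => /andP[t0 t2].
      by have [] := dKs r t rs; rewrite ?(ltW t0) ?(ltW t2).
    + by apply: cvg_at_right_filter; apply: dr; rewrite lexx ltW.
    + by apply: cvg_at_left_filter; apply: dr; rewrite lexx ltW.
  - move=> t; rewrite in_itv/= => /andP[t0 t2]; rewrite derive1E.
    have tI : 0 <= t <= 2 * pi by rewrite !ltW.
    have d := dKs r t rs tI.
    by apply: derive_val.
rewrite (mE s) ?s0 ?lexx//.
have := mE 0; rewrite lexx s0 => /(_ isT).
rewrite (_ : (fun t => k (0 + t)) = k); last by apply/funext => t; rewrite add0r.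
move=> ->; congr (_ * _).
have [->//|sn0] := eqVneq s 0.
have sp : 0 < s by rewrite lt_neqAle eq_sym sn0.
pose D r := K (r + 2 * pi) - K r.
have dD r : 0 <= r <= s -> is_derive r 1 D 0.
  move=> /andP[r0 rs].
  have h1 : is_derive (r + 2 * pi) 1 K (k (r + 2 * pi)).
    by apply: dK; rewrite /u; lra.
  have h2 : is_derive r 1 K (k r) by apply: dK; rewrite /u; lra.
  have g : is_derive r 1 (fun t : R => t + 2 * pi) (1 + 0).
    by apply: is_deriveD.
  have h3 := is_derive1_comp (g := fun t : R => t + 2 * pi) h1 g.
  rewrite addr0 mulr1 pk in h3.
  have := is_deriveB h3 h2.
  by rewrite subrr.
have [||c _] := @MVT R D (fun=> 0) 0 s sp.
- by move=> r; rewrite in_itv/= => /andP[r0 rs]; apply: dD; rewrite !ltW.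
- apply: derivable_within_continuous => r; rewrite in_itv/= => rs.
  by have [] := dD r rs.
by rewrite mul0r => /eqP; rewrite subr_eq0 => /eqP; rewrite /D.
Qed.

(** Extending the integrand by 0 outside the square reduces the exchange of
    integrals over the period to the exchange over the plane. *)
Lemma conv_tonelli w k : continuous w -> continuous k ->
  (forall t, 0 <= w t) -> (forall t, 0 <= k t) ->
  measurable_fun I (fun s => \int[mu]_(t in I) (w t * k (s + t))%:E)%E /\
  (\int[mu]_(s in I) \int[mu]_(t in I) (w t * k (s + t))%:E =
   \int[mu]_(t in I) \int[mu]_(s in I) (w t * k (s + t))%:E)%E.
Proof.
move=> cw ck w0 k0.
pose f (z : R * R) : \bar R := (w z.2 * k (z.1 + z.2))%:E.
pose F := f \_ (I `*` I).
have mw : measurable_fun setT w by exact: continuous_measurable_fun.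
have mk : measurable_fun setT k by exact: continuous_measurable_fun.
have mf : measurable_fun setT f.
  apply/measurable_EFinP; apply: measurable_funM.
    by apply: measurableT_comp => //; exact: measurable_snd.
  apply: measurableT_comp => //; apply: measurable_funD.
    exact: measurable_fst.
  exact: measurable_snd.
have mF : measurable_fun setT F.
  apply/(measurable_restrictT _ _).1; first exact: measurableX.
  exact: measurable_funTS.
have F0 z : (0 <= F z)%E.
  by rewrite /F /patch; case: ifP => // _; rewrite lee_fin mulr_ge0.
have E1 s : (\int[mu]_t F (s, t))%E =
   ((fun s => \int[mu]_(t in I) (w t * k (s + t))%:E)%E \_ I) s.
  rewrite /patch; case: ifPn => sI.
    rewrite [RHS]integral_mkcond; apply: eq_integral => t _.
    rewrite /F /patch /=; have [tI|tI] := boolP (t \in I).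
      by rewrite mem_set//; split => /=; exact/set_mem.
    by rewrite memNset// => -[_ tI']; move/negP: tI; apply; exact/mem_set.
  apply: integral0_eq => t _; rewrite /F /patch memNset// => -[sI' _].
  by move/negP: sI; apply; exact/mem_set.
have E2 t : (\int[mu]_s F (s, t))%E =
   ((fun t => \int[mu]_(s in I) (w t * k (s + t))%:E)%E \_ I) t.
  rewrite /patch; case: ifPn => tI.
    rewrite [RHS]integral_mkcond; apply: eq_integral => s _.
    rewrite /F /patch /=; have [sI|sI] := boolP (s \in I).
      by rewrite mem_set//; split => /=; exact/set_mem.
    by rewrite memNset// => -[sI' _]; move/negP: sI; apply; exact/mem_set.
  apply: integral0_eq => s _; rewrite /F /patch memNset// => -[_ tI'].
  by move/negP: tI; apply; exact/mem_set.
split.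
  apply/(measurable_restrictT _ _).2 => //.
  have := @measurable_fun_fubini_tonelli_F _ _ _ _ _ mu F mF F0.
  by rewrite /fubini_F; apply: eq_measurable_fun => s _; rewrite E1.
rewrite [LHS]integral_mkcond [RHS]integral_mkcond.
under eq_integral do rewrite -E1.
under [RHS]eq_integral do rewrite -E2.
exact: (@fubini_tonelli _ _ _ _ R mu mu F mF F0).
Qed.

End RealMeans.

(** * Complex means and Fourier coefficients *)

Section ComplexMeans.
Context {R : realType}.
Local Notation C := (R[i]^o).
Implicit Types (u v w : R -> C) (a b k : R -> R) (c t s : R).

Lemma ccont_Re u : continuous u -> continuous (fun t => complex.Re (u t)).
Proof.
move=> cu t; apply/cvgrPdist_lt => e e0.
have /cvgCP/(_ _ e0) := cu t; apply: filterS => s.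
by apply: le_lt_trans; rewrite distrC -raddfB cabs_Re.
Qed.

Lemma ccont_Im u : continuous u -> continuous (fun t => complex.Im (u t)).
Proof.
move=> cu t; apply/cvgrPdist_lt => e e0.
have /cvgCP/(_ _ e0) := cu t; apply: filterS => s.
by apply: le_lt_trans; rewrite distrC -raddfB cabs_Im.
Qed.

Lemma ccont_cabs u : continuous u -> continuous (fun t => cabs (u t)).
Proof.
by move=> cu t; apply: (continuous_comp (cu t)); exact: continuous_cabs.
Qed.

Lemma ccontM u v : continuous u -> continuous v -> continuous (fun t => u t * v t).
Proof. by move=> cu cv t; exact: (cvgM (cu t) (cv t)). Qed.

Lemma ccontD u v : continuous u -> continuous v -> continuous (fun t => u t + v t).
Proof. by move=> cu cv t; exact: (cvgD (cu t) (cv t)). Qed.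

Lemma ccont_cst (z : C) : continuous ((fun=> z) : R -> C).
Proof. by move=> t; exact: cvg_cst. Qed.

Lemma ccont_mk a b : continuous a -> continuous b ->
  continuous ((fun t => a t +i* b t) : R -> C).
Proof.
move=> ca cb.
rewrite (_ : (fun t => _) = fun t => (a t)%:C + 'i * (b t)%:C :> C); last first.
  by apply/funext => t; rewrite [LHS]complexE.
apply: ccontD.
  by move=> t; apply: (continuous_comp (ca t)); exact: continuous_real_complex.
apply: ccontM; first exact: ccont_cst.
by move=> t; apply: (continuous_comp (cb t)); exact: continuous_real_complex.
Qed.

Definition cmean u : C :=
  rmean (fun t => complex.Re (u t)) +i* rmean (fun t => complex.Im (u t)).

Lemma eq_cmean u v : (forall t, 0 <= t <= 2 * pi -> u t = v t) -> cmean u = cmean v.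
Proof. by move=> uv; congr (_ +i* _); apply: eq_rmean => t /uv ->. Qed.

Lemma cmeanD u v : continuous u -> continuous v ->
  cmean (fun t => u t + v t) = cmean u + cmean v.
Proof.
move=> cu cv; have cru := ccont_Re cu; have crv := ccont_Re cv.
have ciu := ccont_Im cu; have civ := ccont_Im cv.
have addE (x y x' y' : R) : (x +i* y : C) + (x' +i* y') = (x + x') +i* (y + y').
  by [].
rewrite /cmean addE -!rmeanD//.
by congr (_ +i* _); apply: eq_rmean => t _; rewrite raddfD.
Qed.

Lemma cmeanZ (z : C) u : continuous u ->
  cmean (fun t => z * u t) = z * cmean u.
Proof.
move=> cu; have cr := ccont_Re cu; have ci := ccont_Im cu.
have cZ d a : continuous a -> continuous (fun t => d * a t).
  by move=> ca t; apply: cvgM; [exact: cvg_cst|exact: ca].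
have mulE (x y x' y' : R) :
    (x +i* y : C) * (x' +i* y') = (x * x' - y * y') +i* (x * y' + y * x').
  by [].
case: z => x y; rewrite /cmean mulE; congr (_ +i* _).
  rewrite -rmeanZ// -mulNr -rmeanZ// -rmeanD; [|exact: cZ|exact: cZ].
  by apply: eq_rmean => t _; case: (u t) => p q; rewrite /= mulNr.
rewrite -rmeanZ// -rmeanZ// -rmeanD; [|exact: cZ|exact: cZ].
by apply: eq_rmean => t _; case: (u t) => p q.
Qed.

Lemma cmean_cst (z : C) : cmean (fun=> z) = z.
Proof. by rewrite /cmean !rmean_cst; case: z. Qed.

Lemma cmeanB u v : continuous u -> continuous v ->
  cmean (fun t => u t - v t) = cmean u - cmean v.
Proof.
move=> cu cv; have cNv : continuous (fun t => -1 * v t).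
  by apply: ccontM; [exact: ccont_cst|exact: cv].
rewrite -(mulN1r (cmean v)) -(cmeanZ _ cv) -(cmeanD cu cNv).
by apply: eq_cmean => t _; rewrite mulN1r.
Qed.

Lemma cmean_sum (F : nat -> R -> C) n : (forall i, continuous (F i)) ->
  cmean (fun t => \sum_(0 <= i < n) F i t) = \sum_(0 <= i < n) cmean (F i)
  /\ continuous (fun t => \sum_(0 <= i < n) F i t).
Proof.
move=> cF; elim: n => [|n [IH cIH]].
  split; first by rewrite big_nil -[RHS](cmean_cst 0); apply: eq_cmean => t _; rewrite big_nil.
  rewrite (_ : (fun t => _) = fun=> 0); first exact: ccont_cst.
  by apply/funext => t; rewrite big_nil.
rewrite (_ : (fun t => \sum_(0 <= i < n.+1) F i t) =
  fun t => \sum_(0 <= i < n) F i t + F n t); last first.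
  by apply/funext => t; rewrite big_nat_recr.
split; last by apply: ccontD; [exact: cIH|exact: cF].
by rewrite (cmeanD cIH (cF n)) IH big_nat_recr.
Qed.

(** Testing against the direction of the mean m: |m|^2 is the mean of
    Re (conj m * u), which is at most |m| |u|. *)
Lemma cabs_cmean u : continuous u -> cabs (cmean u) <= rmean (fun t => cabs (u t)).
Proof.
move=> cu; set m := cmean u; have cr := ccont_Re cu; have ci := ccont_Im cu.
have cc := ccont_cabs cu.
have cZ d a : continuous a -> continuous (fun t => d * a t).
  by move=> ca t; apply: cvgM; [exact: cvg_cst|exact: ca].
have [m0|m0] := eqVneq m 0.
  by rewrite m0 cabs0; apply: rmean_ge0 => t; exact: cabs_ge0.
have mp : 0 < cabs m by rewrite cabs_gt0.
rewrite -(ler_pM2l mp) -rmeanZ//.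
have -> : cabs m * cabs m =
    rmean (fun t => complex.Re m * complex.Re (u t) + complex.Im m * complex.Im (u t)).
  rewrite rmeanD ?rmeanZ//; [|exact: cZ|exact: cZ].
  by rewrite -expr2 /cabs normc_def/= sqr_sqrtr ?addr_ge0 ?sqr_ge0// !expr2.
apply: le_rmean; [|exact: cZ|].
  by move=> t; apply: cvgD; apply: cZ.
move=> t; rewrite -cabsM.
have -> : cabs (m * u t) = cabs ((complex.Re m +i* - complex.Im m : C) * u t).
  rewrite !cabsM; congr (_ * _).
  by rewrite /cabs !normc_def/= sqrrN.
apply: le_trans (le_trans (ler_norm _) (cabs_Re _)).
by case: (u t) => x y /=; rewrite mulNr opprK.
Qed.

Lemma cmean_derive (U V : R -> R) u : continuous u ->
  (forall t, is_derive t 1 U (complex.Re (u t))) ->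
  (forall t, is_derive t 1 V (complex.Im (u t))) ->
  cmean u = ((2 * pi)^-1 * (U (2 * pi) - U 0)) +i* ((2 * pi)^-1 * (V (2 * pi) - V 0)).
Proof.
move=> cu dU dV; congr (_ +i* _).
- exact: (rmean_derive dU (ccont_Re cu)).
- exact: (rmean_derive dV (ccont_Im cu)).
Qed.

(** The character exp(i t). *)
Definition E t : C := circ 1 t.

Lemma E_def t : E t = cos t +i* sin t.
Proof. by rewrite /E /circ !mul1r. Qed.

Lemma continuous_E : continuous E.
Proof. exact: continuous_circ. Qed.

Lemma E0 : E 0 = 1.
Proof. by rewrite E_def cos0 sin0. Qed.

Lemma ED s t : E (s + t) = E s * E t.
Proof. by rewrite !E_def cosD sinD; congr (_ +i* _); rewrite addrC. Qed.

Lemma E_exp t n : E t ^+ n = E (n%:R * t).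
Proof.
elim: n => [|n IH]; first by rewrite expr0 mul0r E0.
by rewrite exprS IH -ED -natr1 mulrDl mul1r addrC.
Qed.

Lemma EN t : E (- t) * E t = 1.
Proof. by rewrite -ED addNr E0. Qed.

Lemma cabs_E t : cabs (E t) = 1.
Proof. by rewrite cabs_circ// ler01. Qed.

Lemma E_2pi : E (2 * pi) = 1.
Proof. by rewrite E_def mulr_natl cos2pi sin2pi. Qed.

Lemma E_n2pi n : E (n%:R * (2 * pi)) = 1.
Proof. by rewrite -E_exp E_2pi expr1n. Qed.

Lemma E_Nn2pi n : E (- n%:R * (2 * pi)) = 1.
Proof. by have := EN (n%:R * (2 * pi)); rewrite E_n2pi mulr1 mulNr. Qed.

Lemma circ_E (r : R) t : circ r t = r%:C * E t.
Proof. by rewrite E_def /circ; congr (_ +i* _); rewrite /= ?mul0r ?subr0 ?addr0. Qed.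

Lemma continuous_Ec c : continuous (fun t => E (c * t)).
Proof.
move=> t; apply: continuous_comp; last exact: continuous_E.
by apply: cvgM; [exact: cvg_cst|exact: cvg_id].
Qed.

Lemma cmean_E c : c != 0 -> E (c * (2 * pi)) = 1 -> cmean (fun t => E (c * t)) = 0.
Proof.
move=> c0; rewrite E_def => -[hc hs].
have dU t : is_derive t 1 (fun t => c^-1 * sin (c * t)) (complex.Re (E (c * t))).
  by apply: is_derive_eq; rewrite E_def/= /GRing.scale/=; field.
have dV t : is_derive t 1 (fun t => - (c^-1 * cos (c * t))) (complex.Im (E (c * t))).
  by apply: is_derive_eq; rewrite E_def/= /GRing.scale/=; field.
rewrite (cmean_derive (@continuous_Ec c) dU dV).
by rewrite hc hs !mulr0 sin0 cos0 !mulr0 !subrr !mulr0.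
Qed.

(** The sawtooth i (t - pi) on one period.  Its mean against exp(i n t) is 1/n for
    n <> 0, so the harmonic sequence comes from a bounded function. *)
Definition saw t : C := 0 +i* (t - pi).

Lemma continuous_saw : continuous saw.
Proof.
apply: ccont_mk; first by move=> t; exact: cvg_cst.
by move=> t; apply: cvgB; [exact: cvg_id|exact: cvg_cst].
Qed.

(** Integration by parts, carried out by exhibiting the primitive. *)
Lemma cmean_saw c : c != 0 -> E (c * (2 * pi)) = 1 ->
  cmean (fun t => saw t * E (c * t)) = (c^-1)%:C.
Proof.
move=> c0; rewrite E_def => -[hc hs].
have pin : (pi : R) != 0 by rewrite gt_eqF// pi_gt0.
have dU t : is_derive t 1
    (fun t => (t - pi) * (c^-1 * cos (c * t)) - c ^- 2 * sin (c * t))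
    (complex.Re (saw t * E (c * t))).
  by apply: is_derive_eq; rewrite E_def/= /GRing.scale/=; field.
have dV t : is_derive t 1
    (fun t => (t - pi) * (c^-1 * sin (c * t)) + c ^- 2 * cos (c * t))
    (complex.Im (saw t * E (c * t))).
  by apply: is_derive_eq; rewrite E_def/= /GRing.scale/=; field.
have cs : continuous (fun t => saw t * E (c * t)).
  by apply: ccontM; [exact: continuous_saw|exact: continuous_Ec].
rewrite (cmean_derive cs dU dV).
rewrite hc hs !mulr0 sin0 cos0 !mulr0 !mulr1 ?add0r ?addr0 !subr0.
congr (_ +i* _); last by rewrite subrr mulr0.
have H (P : R) : P != 0 -> (2 * P)^-1 * ((2 * P - P) / c - - P / c) = c^-1.
  by move=> P0; field; rewrite c0.
exact: H.
Qed.

(** The sawtooth is an odd function of t - pi. *)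
Lemma cmean_saw0 : cmean saw = 0.
Proof.
have dU (t : R) : is_derive t 1 (fun=> 0) (complex.Re (saw t)).
  exact: is_derive_cst.
have dV (t : R) : is_derive t 1 (fun t => (t - pi) ^+ 2 / 2) (complex.Im (saw t)).
  by apply: is_derive_eq; rewrite /= /GRing.scale/=; field.
rewrite (cmean_derive continuous_saw dU dV); congr (_ +i* _).
  by rewrite subrr mulr0.
by rewrite sub0r sqrrN mulr_natl mulr2n addrK subrr mulr0.
Qed.

Lemma cabs_saw t : 0 <= t <= 2 * pi -> cabs (saw t) <= pi.
Proof.
move=> tI; rewrite /cabs normc_def/= expr0n add0r sqrtr_sqr ler_norml.
by apply/andP; split; lra.
Qed.

End ComplexMeans.

(** * Convolution and means of powers *)

Section Convolution.
Context {R : realType}.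
Local Notation C := (R[i]^o).
Local Notation I := (`[0%R, (2 * pi)%R] : set R).
Local Notation mu := (@lebesgue_measure R).
Implicit Types (u v w : R -> C) (a b k : R -> R) (c t s : R).

(** Young's inequality for the pair (x, 1). *)
Lemma powR_bernoulli (q x : R) : 1 <= q -> 0 <= x -> 1 + q * (x - 1) <= x `^ q.
Proof.
move=> q1 x0; have [<-|qn1] := eqVneq 1 q; first by rewrite powRr1//; lra.
have {}q1 : 1 < q by rewrite lt_neqAle qn1.
have q0 : 0 < q by apply: lt_trans q1.
have p0 : 0 < (1 - q^-1)^-1 by rewrite invr_gt0 subr_gt0 invf_lt1.
have := @conjugate_powR R x 1 q (1 - q^-1)^-1 x0 ler01 q0 p0.
rewrite invrK addrC subrK powR1 mulr1 mul1r => /(_ erefl) h.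
have := ler_wpM2l (ltW q0) h.
rewrite mulrDr mulrCA divff ?gt_eqF// mulr1 mulrBr mulr1 divff ?gt_eqF//.
by lra.
Qed.

(** The graph of the convex function x^q lies above its tangent at m; this is
    Bernoulli's inequality for x / m. *)
Lemma powR_tangent (q m x : R) : 1 <= q -> 0 <= m -> 0 <= x ->
  m `^ q + q * m `^ (q - 1) * (x - m) <= x `^ q.
Proof.
move=> q1; rewrite le_eqVlt => /predU1P[<-|m0] x0.
  have [<-|qn1] := eqVneq 1 q; first by rewrite !powRr1// subrr powRr0; lra.
  have {}q1 : 1 < q by rewrite lt_neqAle qn1.
  by rewrite !powR0 ?mulr0 ?mul0r ?addr0 ?powR_ge0// ?gt_eqF ?subr_gt0// (lt_trans ltr01).
have xm : 0 <= x / m by rewrite divr_ge0// ltW.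
have h := powR_bernoulli q1 xm.
have mq : 0 <= m `^ q by exact: powR_ge0.
have := ler_wpM2l mq h.
rewrite -(powRM q (ltW m0) xm) (mulrC m) divfK ?gt_eqF//; apply: le_trans.
have E : m `^ q = m * m `^ (q - 1).
  by rewrite mulr_powRB1 ?ltW//; exact: lt_le_trans q1.
rewrite le_eqVlt; apply/orP; left; apply/eqP; rewrite E; field.
by rewrite gt_eqF.
Qed.

Lemma rcontM a b : continuous a -> continuous b -> continuous (fun t => a t * b t).
Proof. by move=> ca cb t; apply: cvgM; [exact: ca|exact: cb]. Qed.

Lemma rcontD a b : continuous a -> continuous b -> continuous (fun t => a t + b t).
Proof. by move=> ca cb t; apply: cvgD; [exact: ca|exact: cb]. Qed.

Lemma rcont_cst c : continuous ((fun=> c) : R -> R).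
Proof. by move=> t; exact: cvg_cst. Qed.

Lemma rcont_powR (q : R) a : 0 < q -> continuous a -> (forall t, 0 <= a t) ->
  continuous (fun t => a t `^ q).
Proof.
move=> q0 ca a0 t; have := a0 t; rewrite le_eqVlt => /predU1P[at0|at0]; last first.
  have cp : {for a t, continuous (fun x : R => x `^ q)}.
    apply: differentiable_continuous; apply/derivable1_diffP.
    by apply: derivable_powR; rewrite in_itv/= at0.
  exact: (continuous_comp (ca t) cp).
rewrite /continuous_at -at0 powR0 ?gt_eqF//; apply/cvgrPdist_lt => e e0.
have d0 : 0 < e `^ q^-1 by rewrite powR_gt0.
have := ca t; rewrite /continuous_at -at0 => /cvgrPdist_lt/(_ _ d0).
apply: filterS => s; rewrite !sub0r !normrN !ger0_norm ?powR_ge0// => h.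
have -> : e = (e `^ q^-1) `^ q.
  by rewrite -powRrM mulVf ?powRr1 ?(ltW e0)// gt_eqF.
by apply: gt0_ltr_powR; rewrite ?nnegrE ?a0 ?powR_ge0.
Qed.

(** Jensen's inequality for the measure with density a, of mass at most W: integrate
    the tangent inequality of [powR_tangent] at m = J / W against a. *)
Lemma rmean_jensen (q W : R) a b : 1 <= q -> 0 < W -> continuous a -> continuous b ->
  (forall t, 0 <= a t) -> (forall t, 0 <= b t) -> rmean a <= W ->
  rmean (fun t => a t * b t) `^ q <= W `^ (q - 1) * rmean (fun t => a t * b t `^ q).
Proof.
move=> q1 W0 ca cb a0 b0 aW.
have q0 : 0 < q by apply: lt_le_trans q1.
have cab := rcontM ca cb.
have cbq := rcont_powR q0 cb b0.
set J := rmean (fun t => a t * b t); pose m := J / W.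
have J0 : 0 <= J by apply: rmean_ge0 => t; rewrite mulr_ge0.
have m0 : 0 <= m by rewrite divr_ge0// ltW.
have JE : J = m * W by rewrite /m divfK// gt_eqF.
have h : rmean a * (m `^ q - q * m `^ (q - 1) * m) + q * m `^ (q - 1) * J <=
    rmean (fun t => a t * b t `^ q).
  rewrite [rmean a * _]mulrC -rmeanZ// -[X in _ + X]rmeanZ// -rmeanD; last 2 first.
  - by apply: rcontM => //; exact: rcont_cst.
  - by apply: rcontM => //; exact: rcont_cst.
  apply: le_rmean.
  - by apply: rcontD; apply: rcontM => //; exact: rcont_cst.
  - exact: rcontM.
  move=> t; have := ler_wpM2l (a0 t) (powR_tangent q1 m0 (b0 t)).
  by apply: le_trans; rewrite le_eqVlt; apply/orP; left; apply/eqP; ring.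
have mE : m `^ (q - 1) * m = m `^ q by rewrite mulrC mulr_powRB1.
have WE : W `^ (q - 1) * W = W `^ q by rewrite mulrC mulr_powRB1// ltW.
rewrite JE powRM ?(ltW W0)// -WE mulrC -mulrA [W * _]mulrC.
apply: ler_wpM2l; first exact: powR_ge0.
apply: le_trans h; rewrite JE.
have -> : rmean a * (m `^ q - q * m `^ (q - 1) * m) + q * m `^ (q - 1) * (m * W)
  = m `^ q * (rmean a * (1 - q) + q * W) by rewrite -mE; ring.
apply: ler_wpM2l; first exact: powR_ge0.
have : 0 <= (W - rmean a) * (q - 1) by rewrite mulr_ge0 ?subr_ge0.
by rewrite mulrBl; lra.
Qed.

Lemma int_rmean k : continuous k ->
  (\int[mu]_(t in I) (k t)%:E = (2 * pi * rmean k)%:E)%E.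
Proof.
move=> ck; rewrite /rmean mulrA divff ?mul1r ?gt_eqF ?twopi_gt0//.
rewrite /Rintegral fineK//; apply: integrable_fin_num => //.
exact: integrable_I.
Qed.

(** Convolution with w is bounded on L^q by the L^1 norm of w: apply [rmean_jensen] at
    each point s, exchange the two integrals, and use the translation invariance of
    the mean of the periodic function |u|^q. *)
Lemma rmean_conv (q W : R) u v w : 1 <= q -> 0 < W ->
  continuous u -> continuous v -> continuous w ->
  (forall t, u (t + 2 * pi) = u t) ->
  (forall s, v s = cmean (fun t => w t * u (s + t))) ->
  rmean (fun t => cabs (w t)) <= W ->
  rmean (fun t => cabs (v t) `^ q) <= W `^ q * rmean (fun t => cabs (u t) `^ q).
Proof.
move=> q1 W0 cu cv cw pu vE wW.
have q0 : 0 < q by apply: lt_le_trans q1.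
pose k t := cabs (u t) `^ q.
have ck : continuous k.
  by apply: rcont_powR => //; [exact: ccont_cabs|move=> t; exact: cabs_ge0].
have ckv : continuous (fun t => cabs (v t) `^ q).
  by apply: rcont_powR => //; [exact: ccont_cabs|move=> t; exact: cabs_ge0].
have caw := ccont_cabs cw.
have k0 t : 0 <= k t by exact: powR_ge0.
have w0 t : 0 <= cabs (w t) by exact: cabs_ge0.
have cus s : continuous (fun t => u (s + t)).
  move=> t; apply: continuous_comp; last exact: cu.
  by apply: cvgD; [exact: cvg_cst|exact: cvg_id].
have cks s : continuous (fun t => k (s + t)).
  move=> t; apply: continuous_comp; last exact: ck.
  by apply: cvgD; [exact: cvg_cst|exact: cvg_id].
have tp := @twopi_gt0 R; have tpn : 2 * pi != 0 :> R by exact: lt0r_neq0.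
have Wq : 0 <= W `^ (q - 1) * (2 * pi)^-1.
  by rewrite mulr_ge0 ?powR_ge0// invr_ge0 ltW.
(* Jensen at the point s *)
have pt s : cabs (v s) `^ q <= W `^ (q - 1) * rmean (fun t => cabs (w t) * k (s + t)).
  have := rmean_jensen q1 W0 caw (ccont_cabs (cus s)) w0 (fun t => cabs_ge0 _) wW.
  apply: le_trans; apply: ge0_ler_powR.
  - exact: ltW.
  - by rewrite nnegrE cabs_ge0.
  - by rewrite nnegrE rmean_ge0// => t; rewrite mulr_ge0 ?cabs_ge0.
  rewrite vE (_ : (fun t => cabs (w t) * _) = fun t => cabs (w t * u (s + t))).
    by apply: cabs_cmean; apply: ccontM; [exact: cw|exact: cus].
  by apply/funext => t; rewrite cabsM.
have [mF tF] := conv_tonelli caw ck w0 k0.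
pose F s := (\int[mu]_(t in I) (cabs (w t) * k (s + t))%:E)%E.
have F0 s : (0 <= F s)%E.
  by apply: integral_ge0 => t _; rewrite lee_fin mulr_ge0.
have FE s : F s = (2 * pi * rmean (fun t => cabs (w t) * k (s + t)))%:E.
  by rewrite /F (int_rmean (rcontM caw (cks s))).
have ZF : (\int[mu]_(s in I) ((W `^ (q - 1) * (2 * pi)^-1)%:E * F s) =
    (W `^ (q - 1) * (2 * pi)^-1)%:E * \int[mu]_(s in I) F s)%E.
  by apply: ge0_integralZl.
have h : (\int[mu]_(s in I) (cabs (v s) `^ q)%:E <=
    (W `^ (q - 1) * (2 * pi)^-1)%:E * \int[mu]_(s in I) F s)%E.
  rewrite -ZF; apply: ge0_le_integral.
  - by [].
  - by move=> s _; rewrite lee_fin powR_ge0.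
  - apply/measurable_EFinP/measurable_funTS; exact: continuous_measurable_fun.
  - by apply: measurable_funeM.
  move=> s _.
  rewrite (FE s).
  rewrite -EFinM.
  rewrite lee_fin.
  apply: (le_trans (pt s)).
  by rewrite -(mulrA (W `^ (q - 1))) (mulKf tpn) lexx.
move: h; rewrite /F tF.
have Ein t : 0 <= t -> (\int[mu]_(s in I) (cabs (w t) * k (s + t))%:E =
    (2 * pi * rmean k * cabs (w t))%:E)%E.
  move=> t0; have kE : (fun s => k (s + t)) = fun s => k (t + s).
    by apply/funext => s; rewrite addrC.
  have cks' : continuous (fun s => k (s + t)) by rewrite kE; exact: cks.
  rewrite (int_rmean (rcontM (@rcont_cst (cabs (w t))) cks')) (rmeanZ _ cks') kE.
  rewrite (rmean_shift ck _ t0); last by move=> s; rewrite /k pu.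
  by rewrite [cabs _ * _]mulrC mulrA.
have Eout : (\int[mu]_(t in I) \int[mu]_(s in I) (cabs (w t) * k (s + t))%:E =
    (2 * pi * (2 * pi * rmean k * rmean (fun t => cabs (w t))))%:E)%E.
  rewrite -(rmeanZ _ caw) -(int_rmean (rcontM (@rcont_cst (2 * pi * rmean k)) caw)).
  by apply: eq_integral => t; rewrite inE/= in_itv/= => /andP[t0 _]; exact: Ein.
rewrite Eout (int_rmean ckv) -EFinM lee_fin => {}h.
have {}h : rmean (fun t => cabs (v t) `^ q) <=
  W `^ (q - 1) * (rmean k * rmean (fun t => cabs (w t))).
  rewrite -(ler_pM2l tp); apply: (le_trans h).
  rewrite -(mulrA (W `^ (q - 1))) (mulKf tpn) mulrCA.
  by rewrite -(mulrA (2 * pi)) (mulrCA (rmean k)).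
apply: (le_trans h); rewrite [rmean k * _]mulrC mulrA.
apply: ler_wpM2r; first exact: rmean_ge0.
rewrite -(mulr_powRB1 (ltW W0) q0) [W * _]mulrC.
by apply: ler_wpM2l; first exact: powR_ge0.
Qed.

End Convolution.

(** * Integral means over circles *)

Section CircleMeans.
Context {R : realType}.
Local Notation C := (R[i]^o).
Implicit Types (x y : nat -> C) (f g : C -> C) (q r s t : R).

(** The real counterpart of the means in the Hardy norm; for holomorphic f the two agree,
    as [circ_mean_Mq] shows. *)
Definition Mq q r f : R := rmean (fun t => cabs (f (circ r t)) `^ q) `^ q^-1.

Lemma itv01 r : r \in `]0, 1[%R = (0 < r < 1).
Proof. by rewrite in_itv. Qed.

Lemma rcont_circ q r f : 0 < q -> Hol f -> 0 < r < 1 ->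
  continuous (fun t => cabs (f (circ r t)) `^ q).
Proof.
move=> q0 hf r01; apply: (rcont_powR q0); last by move=> t; exact: cabs_ge0.
by apply: continuous_on_circ => //; rewrite itv01.
Qed.

Lemma circ_mean_Mq q r f : 0 < q -> Hol f -> 0 < r < 1 ->
  circ_mean q r f = (Mq q r f)%:E.
Proof.
move=> q0 hf r01; rewrite /circ_mean (int_rmean (rcont_circ q0 hf r01)) -EFinM.
by rewrite poweR_EFin mulKf// lt0r_neq0// twopi_gt0.
Qed.

Lemma Mq_ge0 q r f : 0 <= Mq q r f.
Proof. exact: powR_ge0. Qed.

Lemma Mq_eq q r f g : 0 < r < 1 -> (forall z, disc z -> f z = g z) ->
  Mq q r f = Mq q r g.
Proof.
rewrite -itv01 => r01 fg.
have E t : f (circ r t) = g (circ r t) by exact: fg _ (disc_circ t r01).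
by rewrite /Mq; under eq_fun do rewrite E.
Qed.

Lemma MqD q r f g : 1 <= q -> Hol f -> Hol g -> 0 < r < 1 ->
  Mq q r (fun z => f z + g z) <= Mq q r f + Mq q r g.
Proof.
move=> q1 hf hg r01; have q0 : 0 < q by apply: lt_le_trans q1.
have hfg : Hol (f + g) by move=> z dz; apply: derivableD; [exact: hf|exact: hg].
have r01' : r \in `]0, 1[%R by rewrite itv01.
have := circ_meanD q1 hf hg r01'.
rewrite (circ_mean_Mq q0 hf r01) (circ_mean_Mq q0 hg r01) (circ_mean_Mq q0 hfg r01).
by rewrite -EFinD lee_fin.
Qed.

Lemma MqZ q r (a : C) f : 1 <= q -> Hol f -> 0 < r < 1 ->
  Mq q r (fun z => a * f z) = cabs a * Mq q r f.
Proof.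
move=> q1 hf r01; have q0 : 0 < q by apply: lt_le_trans q1.
have haf : Hol (a *: f) by move=> z dz; apply: derivableZ; exact: hf.
have r01' : r \in `]0, 1[%R by rewrite itv01.
have := circ_meanZ a q1 hf r01'.
rewrite (circ_mean_Mq q0 hf r01) (circ_mean_Mq q0 haf r01).
by rewrite -EFinM => -[].
Qed.

Lemma Mq_le q r f g : 0 < q -> Hol f -> Hol g -> 0 < r < 1 ->
  (forall t, cabs (f (circ r t)) <= cabs (g (circ r t))) ->
  Mq q r f <= Mq q r g.
Proof.
move=> q0 hf hg r01 fg.
apply: (@ge0_ler_powR R q^-1); first by rewrite invr_ge0 ltW.
- by rewrite nnegrE rmean_ge0// => t; exact: powR_ge0.
- by rewrite nnegrE rmean_ge0// => t; exact: powR_ge0.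
apply: le_rmean; [exact: rcont_circ|exact: rcont_circ|].
move=> t; apply: (@ge0_ler_powR R q); [exact: ltW| | |exact: fg].
- by rewrite nnegrE cabs_ge0.
- by rewrite nnegrE cabs_ge0.
Qed.

Lemma Mq_cst q r (a : C) : 0 < q -> Mq q r (fun=> a) = cabs a.
Proof.
by move=> q0; rewrite /Mq rmean_cst -powRrM divff ?gt_eqF// powRr1// cabs_ge0.
Qed.

Lemma Hol_cst (a : C) : Hol (fun=> a).
Proof. by move=> z _; exact: derivable_cst. Qed.

Lemma Mq_sup q r f (B : R) : 0 < q -> Hol f -> 0 < r < 1 -> 0 <= B ->
  (forall t, cabs (f (circ r t)) <= B) -> Mq q r f <= B.
Proof.
move=> q0 hf r01 B0 fB.
have -> : B = Mq q r (fun=> B%:C) by rewrite Mq_cst// cabsR ger0_norm.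
apply: (Mq_le q0 hf (@Hol_cst _) r01).
by move=> t; rewrite cabsR ger0_norm.
Qed.

Lemma Mq_powR q r f : 0 < q -> Mq q r f `^ q = rmean (fun t => cabs (f (circ r t)) `^ q).
Proof.
move=> q0; rewrite /Mq -powRrM mulVf ?gt_eqF// powRr1//.
by apply: rmean_ge0 => t; exact: powR_ge0.
Qed.

(** Multiplying the coefficients of a fixed series by a bounded sequence that is small
    on a long initial segment gives a uniformly small function on a smaller disc.
    This is how coordinatewise convergence of multipliers enters. *)
Lemma coef_small x r (D e : R) : adm x -> 0 <= r < 1 -> 0 <= D -> 0 < e ->
  exists (N : nat) (d : R), 0 < d /\ forall y, (forall n, cabs (y n) <= D) ->
    (forall n, (n < N)%N -> cabs (y n) <= d) ->
    forall z, cabs z <= r -> cabs (ps (fun n => y n * x n) z) <= e.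
Proof.
move=> ax r01 D0 e0; set b := fun n => cabs (x n) * r ^+ n.
have cb : cvgn (series b) := adm_summable ax r01.
have b0 n : 0 <= b n.
  by case/andP: r01 => r0 _; rewrite /b mulr_ge0 ?cabs_ge0 ?exprn_ge0.
set S := limn (series b).
have bS N : series b N <= S.
  by apply: nondecreasing_cvgn_le => //; exact: nondecreasing_series.
have S0 : 0 <= S by apply: le_trans (bS 0%N); rewrite seriesEnat/= big_geq.
have e2 : 0 < e / 2 by rewrite divr_gt0.
have D1 : 0 < D + 1 by rewrite ltr_wpDl.
have S1 : 0 < S + 1 by rewrite ltr_wpDl.
have [N hN] : exists N, tail b N < e / 2 / (D + 1).
  have /cvgrPdist_lt/(_ (e / 2 / (D + 1))) h := cvg_tail cb.
  have /filter_ex[N hN] := h (divr_gt0 e2 D1); exists N.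
  by rewrite (le_lt_trans (ler_norm _))// -normrN -sub0r.
exists N, (e / 2 / (S + 1)); split; first by rewrite divr_gt0.
move=> y yD yd z zr.
have dz : cabs z <= r < 1 by rewrite zr; case/andP: r01.
have ay : adm (fun n => y n * x n).
  apply: (adm_le D0) ax => n; by rewrite cabsM ler_wpM2r// cabs_ge0.
have yb n : cabs (y n * x n * z ^+ n) <= D * b n.
  rewrite -mulrA cabsM ler_pM ?cabs_ge0//; exact: ps_dom.
have cDb : cvgn (series (fun n => D * b n)) := is_cvg_rseriesZ cb.
have t1 := csum_tail N yb cDb.
have tD : tail (fun n => D * b n) N = D * tail b N.
  rewrite /tail (cvg_lim _ (cvg_rseriesZ (a := D) cb))// mulrBr; congr (_ - _).
  by rewrite /series/= mulr_sumr.
have t2 : cabs (series (fun n => y n * x n * z ^+ n) N) <= e / 2 / (S + 1) * S.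
  apply: (le_trans (cabs_sum _ _ _)).
  apply: (@le_trans _ _ (\sum_(0 <= n < N) e / 2 / (S + 1) * b n)).
    rewrite !big_nat; apply: ler_sum => n /= nN.
    rewrite -mulrA cabsM ler_pM ?cabs_ge0//; last exact: ps_dom.
    exact: yd.
  rewrite -mulr_sumr ler_wpM2l//; first by rewrite divr_ge0// ltW.
  exact: bS.
have -> : e = e / 2 + e / 2 by lra.
set P := series (fun n => y n * x n * z ^+ n) N in t1 t2.
rewrite -(subrK P (ps _ z)).
apply: (le_trans (cabsD _ _)); apply: lerD.
  apply: (le_trans t1); rewrite tD.
  apply: (@le_trans _ _ ((D + 1) * tail b N)).
    rewrite ler_wpM2r// ?lerDl// /tail subr_ge0; exact: bS.
  by rewrite mulrC -ler_pdivlMr// ltW.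
apply: (le_trans t2); rewrite mulrAC ler_pdivrMr// ler_wpM2l ?(ltW e2)//.
by rewrite lerDl.
Qed.

End CircleMeans.

(** * Multipliers of power series *)

Section Multipliers.
Context {R : realType}.
Local Notation C := (R[i]^o).
Implicit Types (x y l m : nat -> C) (f g : C -> C) (q r s t : R) (w : R -> C).

(** The mean of w against a power series may be taken termwise, the convergence being
    uniform on the circle |z|.  G is a character of the circle or its inverse in the
    applications. *)
Lemma cmean_ps w (G : R -> C) x z : continuous w -> continuous G ->
  (forall t, cabs (G t) = 1) -> adm x -> disc z ->
  cmean (fun t => w t * ps x (z * G t)) =
  ps (fun n => cmean (fun t => w t * G t ^+ n) * x n) z /\
  (forall n, cabs (cmean (fun t => w t * G t ^+ n)) <= rmean (fun t => cabs (w t))).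
Proof.
move=> cw cG G1 ax dz.
have cGn n : continuous (fun t => G t ^+ n).
  elim: n => [|n IH].
    rewrite (_ : (fun t => _) = fun=> 1); first exact: ccont_cst.
    by apply/funext => t; rewrite expr0.
  rewrite (_ : (fun t => _) = fun t => G t * G t ^+ n).
    exact: ccontM cG IH.
  by apply/funext => t; rewrite exprS.
have cwG n : continuous (fun t => w t * G t ^+ n) := ccontM cw (cGn n).
have bd n : cabs (cmean (fun t => w t * G t ^+ n)) <= rmean (fun t => cabs (w t)).
  apply: (le_trans (cabs_cmean (cwG n))).
  rewrite (_ : (fun t => cabs _) = fun t => cabs (w t)) ?lexx//.
  by apply/funext => t; rewrite cabsM cabsX G1 expr1n mulr1.
split; last exact: bd.
have dzG t : disc (z * G t).
  by apply/discE; rewrite cabsM G1 mulr1; apply/discE.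
have cps : continuous (fun t => ps x (z * G t)).
  move=> t; have c1 : {for t, continuous (fun t => z * G t)}.
    exact: (ccontM (@ccont_cst R z) cG).
  exact: (continuous_comp c1 (Hol_continuous (Hol_ps ax) (dzG t))).
set b := fun n => cabs (x n) * cabs z ^+ n.
have cb : cvgn (series b) := adm_summable ax (disc_itv dz).
have caw := ccont_cabs cw.
set T := cmean _; apply/esym; apply: cvg_csum; apply/cvgCP => e e0.
have W0 : 0 <= rmean (fun t => cabs (w t)) by apply: rmean_ge0 => t; exact: cabs_ge0.
have W1 : 0 < 1 + rmean (fun t => cabs (w t)) by rewrite ltr_pwDl.
have /cvgrPdist_lt/(_ (e / (1 + rmean (fun t => cabs (w t))))) h := cvg_tail cb.
apply: filterS (h (divr_gt0 e0 W1)) => N hN {h}.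
have {}hN : tail b N < e / (1 + rmean (fun t => cabs (w t))).
  by rewrite (le_lt_trans (ler_norm _))// -normrN -sub0r.
pose F n t := (x n * z ^+ n) * (w t * G t ^+ n).
have cF n : continuous (F n) := ccontM (@ccont_cst R _) (cwG n).
have [sF csF] := cmean_sum N cF.
have cwp := ccontM cw cps.
have -> : series (fun n => cmean (fun t => w t * G t ^+ n) * x n * z ^+ n) N - T =
    - cmean (fun t => w t * ps x (z * G t) - \sum_(0 <= i < N) F i t).
  rewrite (cmeanB cwp csF) opprB sF; congr (_ - _).
  by apply: eq_bigr => n _; rewrite [RHS](cmeanZ _ (cwG n)) -mulrA mulrC.
rewrite cabsN.
have cD : continuous (fun t => w t * ps x (z * G t) - \sum_(0 <= i < N) F i t).
  by move=> t; exact: (cvgB (cwp t) (csF t)).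
apply: (le_lt_trans (cabs_cmean cD)).
apply: (@le_lt_trans _ _ (rmean (fun t => tail b N * cabs (w t)))).
  apply: le_rmean; [exact: ccont_cabs|exact: rcontM (@rcont_cst R _) caw|].
  move=> t; have -> : w t * ps x (z * G t) - \sum_(0 <= i < N) F i t =
     w t * (ps x (z * G t) - \sum_(0 <= i < N) x i * (z * G t) ^+ i).
    rewrite mulrBr mulr_sumr; congr (_ - _); apply: eq_bigr => i _.
    by rewrite /F exprMn; ring.
  rewrite cabsM mulrC; apply: ler_wpM2r; first exact: cabs_ge0.
  apply: ps_tail => //; rewrite cabsM G1 mulr1 lexx.
  by case/andP: (disc_itv dz).
rewrite (rmeanZ _ caw).
apply: (@le_lt_trans _ _ (tail b N * (1 + rmean (fun t => cabs (w t))))).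
  have b0 n : 0 <= b n by rewrite /b mulr_ge0 ?cabs_ge0 ?exprn_ge0 ?cabs_ge0.
  apply: ler_wpM2l; last by rewrite lerDr.
  rewrite /tail subr_ge0; apply: nondecreasing_cvgn_le => //.
  exact: nondecreasing_series.
by rewrite -ltr_pdivlMr.
Qed.

(** The bound on the entries makes multiplication preserve admissible sequences, so that
    the means on the left are those of a holomorphic function. *)
Definition multiplier q (W : R) l := (forall n, cabs (l n) <= W) /\
  forall x r, adm x -> 0 < r < 1 ->
    Mq q r (ps (fun n => l n * x n)) <= W * Mq q r (ps x).

(** The Fourier coefficient of w at -n. *)
Definition fcoef w n : C := cmean (fun t => w t * E t ^+ n).

Lemma disc_circ01 r t : 0 < r < 1 -> disc (circ r t).
Proof. by move=> r01; apply: disc_circ; rewrite itv01. Qed.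

Lemma adm_mult (W : R) l x : (forall n, cabs (l n) <= W) -> adm x ->
  adm (fun n => l n * x n).
Proof.
move=> lW; have W0 : 0 <= W by apply: le_trans (lW 0%N); exact: cabs_ge0.
by apply: (adm_le W0) => n; rewrite cabsM ler_wpM2r// cabs_ge0.
Qed.

(** Multiplying coefficients by a Fourier sequence convolves each circle with w, so
    [rmean_conv] applies. *)
Lemma multiplier_fcoef q (W : R) w : 1 <= q -> 0 < W -> continuous w ->
  rmean (fun t => cabs (w t)) <= W -> multiplier q W (fcoef w).
Proof.
move=> q1 W0 cw wW; have q0 : 0 < q by apply: lt_le_trans q1.
have bd n : cabs (fcoef w n) <= W.
  have a1 : adm (fun=> 1 : C) by apply: (@adm_bounded _ 1) => k; rewrite cabs1.
  have [_ h] := cmean_ps cw (@continuous_E R) (@cabs_E R) a1 (@disc0 R).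
  exact: le_trans (h n) wW.
split => // x r ax r01.
have al : adm (fun n => fcoef w n * x n) by exact: adm_mult bd ax.
have cc y : adm y -> continuous (fun t => ps y (circ r t)).
  move=> ay t; apply: (continuous_comp (@continuous_circ R r t)).
  by apply: Hol_continuous; [exact: Hol_ps|exact: disc_circ01].
have pE t : ps x (circ r (t + 2 * pi)) = ps x (circ r t).
  by rewrite !circ_E ED E_2pi mulr1.
have vE s : ps (fun n => fcoef w n * x n) (circ r s) =
    cmean (fun t => w t * ps x (circ r (s + t))).
  have ds : disc (circ r s) by exact: disc_circ01.
  have [<- _] := cmean_ps cw (@continuous_E R) (@cabs_E R) ax ds.
  by apply: eq_cmean => t _; rewrite !circ_E ED mulrA.
have h := rmean_conv q1 W0 (cc _ ax) (cc _ al) cw pE vE wW.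
rewrite /Mq; apply: (@le_trans _ _ ((W `^ q *
   rmean (fun t => cabs (ps x (circ r t)) `^ q)) `^ q^-1)).
  apply: (@ge0_ler_powR R q^-1); [by rewrite invr_ge0 ltW| | |exact: h].
  - by rewrite nnegrE rmean_ge0// => t; exact: powR_ge0.
  - by rewrite nnegrE mulr_ge0 ?powR_ge0// rmean_ge0// => t; exact: powR_ge0.
have r0 : 0 <= rmean (fun t => cabs (ps x (circ r t)) `^ q).
  by apply: rmean_ge0 => t; exact: powR_ge0.
rewrite (powRM _ (powR_ge0 _ _) r0) -powRrM divff ?gt_eqF//.
by rewrite (powRr1 (ltW W0)).
Qed.

Lemma multiplierD q (V W : R) l m : 1 <= q -> multiplier q V l -> multiplier q W m ->
  multiplier q (V + W) (fun n => l n + m n).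
Proof.
move=> q1 [lV hl] [mW hm]; split=> [n|x r ax r01].
  by apply: (le_trans (cabsD _ _)); exact: lerD.
have al := adm_mult lV ax; have am := adm_mult mW ax.
have hD := MqD q1 (Hol_ps al) (Hol_ps am) r01.
rewrite mulrDl; apply: (le_trans _ (lerD (hl x r ax r01) (hm x r ax r01))).
apply: le_trans hD; rewrite le_eqVlt; apply/orP; left; apply/eqP.
apply: (Mq_eq _ r01) => z dz; rewrite -(psD al am dz).
by congr (ps _ z); apply/funext => n; rewrite mulrDl.
Qed.

Lemma multiplierZ q (W : R) (a : C) l : 1 <= q -> multiplier q W l ->
  multiplier q (cabs a * W) (fun n => a * l n).
Proof.
move=> q1 [lW hl]; split=> [n|x r ax r01].
  by rewrite cabsM ler_wpM2l// cabs_ge0.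
have al := adm_mult lW ax.
rewrite -mulrA; apply: (le_trans _ (ler_wpM2l (cabs_ge0 a) (hl x r ax r01))).
rewrite -(MqZ a q1 (Hol_ps al) r01) le_eqVlt; apply/orP; left; apply/eqP.
apply: (Mq_eq _ r01) => z dz; rewrite -(psZ a al dz).
by congr (ps _ z); apply/funext => n; rewrite mulrA.
Qed.

Lemma multiplier_cst q (a : C) : 1 <= q -> multiplier q (cabs a) (fun=> a).
Proof.
move=> q1; split=> // x r ax r01.
rewrite -(MqZ a q1 (Hol_ps ax) r01) le_eqVlt; apply/orP; left; apply/eqP.
by apply: (Mq_eq _ r01) => z dz; rewrite -(psZ a ax dz).
Qed.

Lemma multiplier_le q (V W : R) l : V <= W -> multiplier q V l -> multiplier q W l.
Proof.
move=> VW [lV hl]; split=> [n|x r ax r01]; first exact: le_trans (lV n) VW.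
by apply: (le_trans (hl x r ax r01)); apply: ler_wpM2r => //; exact: Mq_ge0.
Qed.

(** For a fixed series and a fixed r < 1 the q-th mean depends continuously on the
    multiplier, coordinatewise, among bounded sequences; the bound W therefore passes
    to coordinatewise limits. *)
Lemma multiplier_closed q (W : R) l : 1 <= q ->
  (forall (N : nat) (d : R), 0 < d -> exists2 m, multiplier q W m &
     forall n, (n < N)%N -> cabs (l n - m n) <= d) ->
  multiplier q W l.
Proof.
move=> q1 hl; have q0 : 0 < q by apply: lt_le_trans q1.
have lW n : cabs (l n) <= W.
  apply/ler_addgt0Pr => d d0; have [m [mW _] hm] := hl n.+1 d d0.
  rewrite -(subrK (m n) (l n)) (le_trans (cabsD _ _))// addrC lerD//.
  exact: hm.
have W0 : 0 <= W by apply: le_trans (lW 0%N); exact: cabs_ge0.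
split=> // x r ax r01; apply/ler_addgt0Pr => e e0.
have r01' : 0 <= r < 1 by case/andP: r01 => r0 ->; rewrite ltW.
have W2 : 0 <= W + W by rewrite addr_ge0.
have [N [d [d0 hd]]] := coef_small ax r01' W2 e0.
have [m [mW hm] lm] := hl N d d0.
have lmW n : cabs (l n - m n) <= W + W.
  by rewrite (le_trans (cabsD _ _))// cabsN lerD.
have am := adm_mult mW ax; have ad := adm_mult lmW ax.
have hD := MqD q1 (Hol_ps am) (Hol_ps ad) r01.
have E : Mq q r (ps (fun n => l n * x n)) =
  Mq q r (fun z => ps (fun n => m n * x n) z + ps (fun n => (l n - m n) * x n) z).
  apply: (Mq_eq _ r01) => z dz; rewrite -(psD am ad dz).
  by congr (ps _ z); apply/funext => n; rewrite -mulrDl addrC subrK.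
rewrite E; apply: (le_trans hD); apply: lerD; first exact: hm.
apply: (Mq_sup q0 (Hol_ps ad) r01 (ltW e0)) => t.
have r0 : 0 <= r by case/andP: r01'.
have cr : cabs (circ r t) <= r by rewrite (cabs_circ t r0).
exact: (hd (fun n => l n - m n) lmW lm (circ r t) cr).
Qed.

Lemma ps_dilate x (k : R) z : ps (fun n => k%:C ^+ n * x n) z = ps x (k%:C * z).
Proof.
by congr csum; apply/funext => n; rewrite exprMn [_ * x n]mulrC mulrA.
Qed.

Lemma ps_zero z : ps (fun=> 0 : C) z = 0.
Proof.
apply: cvg_csum; rewrite (_ : series _ = fun=> 0); first exact: cvg_cst.
by apply/funext => n; rewrite /series/= big1// => i _; rewrite mul0r.
Qed.

Lemma ps_delta n z : disc z -> ps (fun k => (k == n)%:R : C) z = z ^+ n.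
Proof.
move=> dz; have ad j : adm (fun k => (k == j)%:R : C).
  by apply: (@adm_bounded _ 1) => k; case: eqP; rewrite ?cabs1 ?cabs0.
elim: n => [|n IH]; rewrite (ps_recl (ad _) dz) /=.
  by rewrite ps_zero mulr0 addr0 expr0.
rewrite add0r exprS -IH; congr (_ * _).
Qed.

(** The geometric series, in the form that avoids division. *)
Lemma ps_one z : disc z -> (1 - z) * ps (fun=> 1 : C) z = 1.
Proof.
move=> dz; have a1 : adm (fun=> 1 : C) by apply: (@adm_bounded _ 1) => k; rewrite cabs1.
have h := ps_recl a1 dz.
by rewrite mulrBl mul1r {1}h addrK.
Qed.

Lemma cmean_EE (n m : nat) : cmean (fun t => E t ^+ n * E (- t) ^+ m : C) = (n == m)%:R.
Proof.
have [->|nm] := eqVneq n m.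
  rewrite -[RHS](cmean_cst 1); apply: eq_cmean => t _.
  by rewrite -exprMn mulrC EN expr1n.
have -> : (fun t => E t ^+ n * E (- t) ^+ m : C) = fun t => E ((n%:R - m%:R) * t).
  by apply/funext => t; rewrite !E_exp -ED mulrN mulrBl.
apply: cmean_E; first by rewrite subr_eq0 eqr_nat.
by rewrite mulrBl -mulNr ED E_n2pi E_Nn2pi mulr1.
Qed.

Lemma cmean_En n : cmean (fun t => E t ^+ n : C) = (n == 0)%:R.
Proof.
by rewrite -(cmean_EE n 0); apply: eq_cmean => t _; rewrite expr0 mulr1.
Qed.

(** The sequence k^n is the Fourier sequence of the Poisson kernel, which is positive
    and has mean 1.  Its L^1 norm is thus 1. *)
Lemma multiplier_poisson q (k : R) : 1 <= q -> 0 <= k < 1 ->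
  multiplier q 1 (fun n => k%:C ^+ n).
Proof.
move=> q1 /andP[k0 k1].
have dk : disc (k%:C : C) by apply/discE; rewrite cabsR ger0_norm.
have a1 : adm (fun=> 1 : C) by apply: (@adm_bounded _ 1) => j; rewrite cabs1.
have [N NE] : exists N : R -> C, forall t, N t = E (- t) by exists (fun t => E (- t)).
have cN : continuous N.
  rewrite (_ : N = fun t => E (-1 * t)); first exact: continuous_Ec.
  by apply/funext => t; rewrite NE mulN1r.
have N1 t : cabs (N t) = 1 by rewrite NE cabs_E.
have dG (G : R -> C) t : cabs (G t) = 1 -> disc (k%:C * G t).
  by move=> G1; apply/discE; rewrite cabsM G1 mulr1; apply/discE.
have cps (G : R -> C) : continuous G -> (forall t, cabs (G t) = 1) ->
    continuous (fun t => ps (fun=> 1 : C) (k%:C * G t)).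
  move=> cG G1 t; have c1 : {for t, continuous (fun t => k%:C * G t : C)}.
    exact: (ccontM (@ccont_cst R _) cG).
  exact: (continuous_comp c1 (Hol_continuous (Hol_ps a1) (dG G t (G1 t)))).
(* the Poisson kernel, a sum of two geometric series; the term for n = 0 is counted twice *)
pose P t : C := ps (fun=> 1) (k%:C * E t) + ps (fun=> 1) (k%:C * N t) + -1.
have cE1 := cps _ (@continuous_E R) (@cabs_E R).
have cN1 := cps _ cN N1.
have cP : continuous P := ccontD (ccontD cE1 cN1) (@ccont_cst R _).
have PE n : fcoef P n = k%:C ^+ n.
  have cEn : continuous (fun t => E t ^+ n : C).
    rewrite (_ : (fun t => _) = fun t => E (n%:R * t)); first exact: continuous_Ec.
    by apply/funext => t; rewrite E_exp.
  have cA := ccontM cEn cE1; have cB := ccontM cEn cN1.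
  have h1 := cmeanD cA cB; have h3 := cmeanZ (-1) cEn.
  have h2 := cmeanD (ccontD cA cB) (ccontM (@ccont_cst R (-1)) cEn).
  have -> : fcoef P n = cmean (fun t => E t ^+ n * ps (fun=> 1) (k%:C * E t)) +
      cmean (fun t => E t ^+ n * ps (fun=> 1) (k%:C * N t)) +
      -1 * cmean (fun t => E t ^+ n).
    rewrite -h1 -h3 -h2; apply: eq_cmean => t _.
    have G (a b c : C) : (a + b + -1) * c = c * a + c * b + -1 * c by ring.
    exact: G.
  have [hA _] := cmean_ps cEn (@continuous_E R) (@cabs_E R) a1 dk.
  have [hB _] := cmean_ps cEn cN N1 a1 dk.
  have EA j : cmean (fun t => E t ^+ n * E t ^+ j) * 1 =
      (n == 0)%:R * (j == 0)%:R :> C.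
    rewrite mulr1 -natrM mulnb -addn_eq0 -cmean_En.
    by apply: eq_cmean => t _; rewrite exprD.
  have EB j : cmean (fun t => E t ^+ n * N t ^+ j) * 1 = (j == n)%:R :> C.
    rewrite mulr1 eq_sym -cmean_EE; apply: eq_cmean => t _.
    by rewrite NE.
  have ad j : adm (fun i => (i == j)%:R : C).
    by apply: (@adm_bounded _ 1) => i; case: eqP; rewrite ?cabs1 ?cabs0.
  have sA : (fun j => cmean (fun t => E t ^+ n * E t ^+ j) * 1) =
      fun j => (n == 0)%:R * (j == 0)%:R :> C.
    by apply/funext => j; exact: EA.
  have sB : (fun j => cmean (fun t => E t ^+ n * N t ^+ j) * 1) =
      fun j => (j == n)%:R :> C.
    by apply/funext => j; exact: EB.
  have {}hA : cmean (fun t => E t ^+ n * ps (fun=> 1) (k%:C * E t)) = (n == 0)%:R.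
    apply: (etrans hA); apply: (etrans (congr1 (fun F => ps F k%:C) sA)).
    by rewrite (psZ _ (ad 0) dk) (ps_delta 0 dk) expr0 mulr1.
  have {}hB : cmean (fun t => E t ^+ n * ps (fun=> 1) (k%:C * N t)) = k%:C ^+ n.
    apply: (etrans hB); apply: (etrans (congr1 (fun F => ps F k%:C) sB)).
    exact: (ps_delta n dk).
  rewrite [X in X + _ + _]hA [X in _ + X + _]hB [X in _ + _ * X]cmean_En.
  by rewrite mulN1r addrAC subrr add0r.
have -> : (fun n => k%:C ^+ n) = fcoef P by apply/funext => n; rewrite PE.
apply: multiplier_fcoef => //.
have den t : 0 < 1 - 2 * k * cos t + k ^+ 2.
  have := cos_le1 t; have : 0 < (1 - k) ^+ 2 by rewrite exprn_gt0// subr_gt0.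
  by nra.
(* the closed form shows that P is real and nonnegative *)
have PR t : P t = ((1 - k ^+ 2) / (1 - 2 * k * cos t + k ^+ 2))%:C.
  have hE := ps_one (dG _ t (@cabs_E R t)); have hN := ps_one (dG _ t (N1 t)).
  set A := ps _ _ in hE; set B := ps _ _ in hN.
  have hEN : E t * N t = 1 by rewrite mulrC NE EN.
  have EpN : E t + N t = (2 * cos t)%:C.
    by rewrite NE !E_def cosN sinN /=; apply/eqP; rewrite eq_complex/=; apply/andP; split; apply/eqP; lra.
  have dd : (1 - k%:C * E t) * (1 - k%:C * N t) = (1 - 2 * k * cos t + k ^+ 2)%:C.
    transitivity (1 - k%:C * (E t + N t) + k%:C ^+ 2 * (E t * N t)); first by ring.
    rewrite hEN EpN mulr1 expr2 -!rmorphM -(rmorph1 (real_complex R)) -rmorphB -rmorphD.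
    by congr (_%:C); ring.
  have dn0 : ((1 - 2 * k * cos t + k ^+ 2)%:C : C) != 0.
    by rewrite (inj_eq (@complexI R) _ 0) gt_eqF.
  apply: (mulfI dn0); rewrite -rmorphM/= mulrCA divff ?gt_eqF// mulr1.
  rewrite -dd /P -/A -/B.
  transitivity ((1 - k%:C * N t) * ((1 - k%:C * E t) * A) +
     (1 - k%:C * E t) * ((1 - k%:C * N t) * B) - (1 - k%:C * E t) * (1 - k%:C * N t)).
    by ring.
  rewrite hE hN !mulr1.
  transitivity (1 - k%:C ^+ 2 * (E t * N t)); first by ring.
  by rewrite hEN mulr1 rmorphB/= rmorph1 rmorphXn.
have aP t : cabs (P t) = complex.Re (P t).
  rewrite PR cabsR ger0_norm// divr_ge0// ?(ltW (den t))//.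
  by rewrite subr_ge0 expr_le1// ltW.
have -> : rmean (fun t => cabs (P t)) = complex.Re (cmean P).
  by apply: eq_rmean => t _; rewrite aP.
have -> : cmean P = fcoef P 0.
  by apply: eq_cmean => t _; rewrite expr0 mulr1.
by rewrite PE expr0.
Qed.

(** The smaller circle carries the function dilated by s / r, a Poisson average of the
    values on the larger circle. *)
Lemma Mq_monotone q x r s : 1 <= q -> adm x -> 0 < s <= r -> r < 1 ->
  Mq q s (ps x) <= Mq q r (ps x).
Proof.
move=> q1 ax /andP[s0 sr] r1; have r0 : 0 < r by exact: lt_le_trans sr.
have r01 : 0 < r < 1 by rewrite r0.
have [<-//|sn] := eqVneq s r.
have k01 : 0 <= s / r < 1.
  by rewrite divr_ge0 ?(ltW s0) ?(ltW r0)// ltr_pdivrMr// mul1r lt_neqAle sn.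
have [_ h] := multiplier_poisson q1 k01.
have Es t : ps x (circ s t) = ps (fun n => (s / r)%:C ^+ n * x n) (circ r t).
  by rewrite ps_dilate !circ_E mulrA -rmorphM/= divfK// gt_eqF.
have ME : Mq q s (ps x) = Mq q r (ps (fun n => (s / r)%:C ^+ n * x n)).
  exact: (congr1 (fun u : R -> C => rmean (fun t => cabs (u t) `^ q) `^ q^-1)
    (funext Es)).
by have := h x r ax r01; rewrite mul1r -ME.
Qed.

End Multipliers.

(** * Curves in the plane and parameter integrals *)

Section PathDerivatives.
Context {R : realType}.
Local Notation C := (R[i]^o).
Local Notation I := (`[0%R, (2 * pi)%R] : set R).
Local Notation mu := (@lebesgue_measure R).
Implicit Types (x : nat -> C) (f : C -> C) (r s t : R) (u w : R -> C).

(** Differentiability of a plane curve in its real parameter, phrased with a remainder so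
    that it passes to real and imaginary parts and through holomorphic functions. *)
Definition cderiv u t (d : C) := forall e : R, 0 < e ->
  \forall h \near (0 : R), cabs (u (h + t) - u t - h%:C * d) <= e * `|h|.

Lemma cderiv_part (P : C -> R) u t d :
  (forall a b, P (a - b) = P a - P b) -> (forall a, `|P a| <= cabs a) ->
  (forall (h : R) a, P (h%:C * a) = h * P a) ->
  cderiv u t d -> is_derive t 1 (fun t => P (u t)) (P d).
Proof.
move=> PB Pc PZ du.
have h0 : h^-1 *: (((fun t => P (u t)) \o shift t) (h *: (1 : R)) - P (u t))
    @[h --> (0 : R)^'] --> P d.
  apply/cvgrPdist_le => e e0; rewrite near_withinE.
  apply: filterS (du e e0) => h hh hn0.
  have {}hn0 : h != 0 := hn0.
  have hp : 0 < `|h| by rewrite normr_gt0.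
  rewrite /= [h *: 1](mulr1 h) -(ler_pM2r hp).
  apply: le_trans hh; apply: le_trans (Pc _).
  rewrite -normrM mulrBl [_ *: _]mulrC -mulrA mulVf// mulr1.
  by rewrite !PB PZ -normrN opprB [P d * h]mulrC.
apply: DeriveDef; first exact: (cvgP _ h0).
exact: cvg_lim h0.
Qed.

Lemma cderiv_Re u t d : cderiv u t d ->
  is_derive t 1 (fun t => complex.Re (u t)) (complex.Re d).
Proof.
apply: cderiv_part.
- by move=> a b; rewrite raddfB.
- exact: cabs_Re.
- by move=> h [a b] /=; rewrite mul0r subr0.
Qed.

Lemma cderiv_Im u t d : cderiv u t d ->
  is_derive t 1 (fun t => complex.Im (u t)) (complex.Im d).
Proof.
apply: cderiv_part.
- by move=> a b; rewrite raddfB.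
- exact: cabs_Im.
- by move=> h [a b] /=; rewrite mul0r addr0.
Qed.

Lemma cderivZ (c : C) u t d : cderiv u t d -> cderiv (fun t => c * u t) t (c * d).
Proof.
move=> du e e0; have c1 : 0 < 1 + cabs c by rewrite ltr_pwDl// cabs_ge0.
apply: filterS (du _ (divr_gt0 e0 c1)) => h hh.
have -> : c * u (h + t) - c * u t - h%:C * (c * d) = c * (u (h + t) - u t - h%:C * d).
  by rewrite !mulrBr [in RHS]mulrCA.
rewrite cabsM; apply: (le_trans (ler_wpM2l (cabs_ge0 c) hh)).
rewrite mulrA; apply: ler_wpM2r => //.
rewrite mulrCA ler_piMr ?(ltW e0)// ler_pdivrMr// mul1r lerDr//.
Qed.

Lemma cderivD_cst (a : C) u t d : cderiv u t d -> cderiv (fun t => a + u t) t d.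
Proof.
move=> du e e0; apply: filterS (du e e0) => h.
by rewrite [a + u (h + t)]addrC addrKA.
Qed.

Lemma cderiv_lin (b : C) t : cderiv (fun s => s%:C * b) t b.
Proof.
move=> e e0; near=> h.
by rewrite rmorphD mulrDl addrK subrr cabs0 mulr_ge0// ltW.
Unshelve. all: by end_near. Qed.

Lemma derive1_bound f (w : C) (e : R) : derivable f w 1 -> 0 < e ->
  \forall h \near (0 : C), cabs (f (w + h) - f w - h * derive1 f w) <= e * cabs h.
Proof.
move=> df e0; set L := derive1 f w.
have h0 : h^-1 *: ((f \o shift w) (h *: (1 : C)) - f w) @[h --> (0 : C)^'] --> (L : C).
  by rewrite /L derive1E; exact: df.
move/cvgCP : h0 => /(_ _ e0); rewrite near_withinE; apply: filterS => h hh.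
have [->|hn0] := eqVneq h 0.
  by rewrite addr0 subrr mul0r subrr cabs0 mulr0.
have {}hh := hh hn0; rewrite /= [h *: 1](mulr1 h) [h + w]addrC in hh.
have ch : 0 < cabs h by rewrite cabs_gt0.
have -> : f (w + h) - f w - h * L = h * (h^-1 *: (f (w + h) - f w) - L).
  by rewrite mulrBr; congr (_ - _); rewrite [_ *: _]/(_ * _) mulVKf.
by rewrite cabsM mulrC; apply: ler_wpM2r; [exact: ltW|exact: ltW].
Qed.

Lemma cderiv_comp f u t d : cderiv u t d -> derivable f (u t) 1 ->
  cderiv (fun t => f (u t)) t (derive1 f (u t) * d).
Proof.
move=> du df e e0; set L := derive1 f (u t).
have A0 : 0 < 1 + cabs d by rewrite ltr_pwDl// cabs_ge0.
have L0 : 0 < 1 + cabs L by rewrite ltr_pwDl// cabs_ge0.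
have e1 : 0 < e / 2 / (1 + cabs d) by rewrite !divr_gt0.
have e2 : 0 < e / 2 / (1 + cabs L) by rewrite !divr_gt0.
have B := derive1_bound df e1.
have cu : (fun h : R => u (h + t) - u t) @ (0 : R) --> (0 : C).
  apply/cvgCP => k k0.
  have k1 : 0 < k / (1 + cabs d) by rewrite divr_gt0.
  have : \forall h \near (0 : R), `|h| < k / (1 + cabs d).
    by have /cvgr0_norm_lt := @cvg_id R (nbhs (0 : R)); apply.
  apply: filterS2 (du 1 ltr01) => h hh hk.
  rewrite subr0 -(subrK (h%:C * d) (u (h + t) - u t)).
  apply: (le_lt_trans (cabsD _ _)); rewrite cabsM cabsR.
  apply: (le_lt_trans (lerD hh (lexx _))).
  by rewrite mul1r -[X in X + _]mulr1 -mulrDr -ltr_pdivlMr.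
have {}B := cu _ B.
apply: filterS3 (du 1 ltr01) (du _ e2) B => h h1 h2 /= h3.
rewrite addrCA subrr addr0 in h3.
set D := u (h + t) - u t in h1 h2 h3 *.
have -> : f (u (h + t)) - f (u t) - h%:C * (L * d) =
  (f (u (h + t)) - f (u t) - D * L) + L * (D - h%:C * d) by ring.
have cD : cabs D <= (1 + cabs d) * `|h|.
  rewrite -(subrK (h%:C * d) D) (le_trans (cabsD _ _))// cabsM cabsR mulrDl.
  by rewrite lerD// mulrC.
apply: (le_trans (cabsD _ _)).
have -> : e * `|h| = e / 2 * `|h| + e / 2 * `|h| by field.
apply: lerD.
  apply: (le_trans h3); apply: (le_trans (ler_wpM2l (ltW e1) cD)).
  by rewrite mulrA divfK// gt_eqF.
rewrite cabsM; apply: (le_trans (ler_wpM2l (cabs_ge0 L) h2)).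
rewrite mulrA; apply: ler_wpM2r => //.
rewrite mulrCA ler_piMr ?divr_ge0 ?(ltW e0)// ler_pdivrMr// mul1r lerDr//.
Qed.

Lemma cderiv_E t : cderiv E t ('i * E t).
Proof.
have dr (a : R -> R) (da : R) : is_derive t 1 a da -> forall e : R, 0 < e ->
    \forall h \near (0 : R), `|a (h + t) - a t - h * da| <= e * `|h|.
  move=> [da1 da2] e e0.
  have h0 : h^-1 *: ((a \o shift t) (h *: (1 : R)) - a t) @[h --> (0 : R)^'] --> da.
    by rewrite -da2; exact: da1.
  move/cvgrPdist_le : h0 => /(_ _ e0); rewrite near_withinE; apply: filterS => h hh.
  have [->|hn0] := eqVneq h 0.
    by rewrite add0r subrr mul0r subrr normr0 mulr0.
  have {}hh := hh hn0; rewrite /= [h *: 1](mulr1 h) in hh.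
  have -> : a (h + t) - a t - h * da = - ((da - h^-1 *: (a (h + t) - a t)) * h).
    by rewrite mulrBl opprB [_ *: _]mulrC -mulrA mulVf// mulr1 [da * h]mulrC.
  by rewrite normrN normrM ler_wpM2r.
move=> e e0; have e2 : 0 < e / 2 by rewrite divr_gt0.
have B1 := dr _ _ (is_derive_cos t) _ e2; have B2 := dr _ _ (is_derive_sin t) _ e2.
apply: filterS2 B1 B2 => h h1 h2.
have cab (a b : R) : cabs (a +i* b : C) <= `|a| + `|b|.
  rewrite [_ +i* _]complexE (le_trans (cabsD _ _))// cabsM !cabsR.
  suff -> : cabs ('i : C) = 1 by rewrite mul1r.
  by rewrite /cabs normc_def/= expr0n expr1n add0r sqrtr1.
have -> : E (h + t) - E t - h%:C * ('i * E t) =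
   (cos (h + t) - cos t - h * (- sin t)) +i* (sin (h + t) - sin t - h * cos t).
  rewrite !E_def; apply/eqP; rewrite eq_complex/=; apply/andP; split; apply/eqP; ring.
apply: (le_trans (cab _ _)).
have -> : e * `|h| = e / 2 * `|h| + e / 2 * `|h| by field.
exact: lerD.
Qed.

(** Differentiation under the integral sign: the mean has derivative 0 in s.  The
    hypotheses hold on a neighbourhood of [0, 1] so that the derivatives at the end
    points are two-sided. *)
Lemma rmean_const_deriv (phi phi' : R -> R -> R) (a b B : R) :
  a < 0 -> 1 < b ->
  (forall s t, a < s < b -> is_derive s 1 (phi^~ t) (phi' s t)) ->
  (forall s, a < s < b -> continuous (phi s)) ->
  (forall s t, a < s < b -> `|phi' s t| <= B) ->
  (forall s, a < s < b -> rmean (phi' s) = 0) ->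
  rmean (phi 0) = rmean (phi 1).
Proof.
move=> a0 b1 dphi cphi bd m0.
have B0 : 0 <= B by apply: le_trans (bd 0 0 _) => //; rewrite a0 (lt_trans ltr01).
have D s : a < s < b -> is_derive s 1 (fun s => rmean (phi s)) 0.
  move=> sab; have sI : `]a, b[%classic s by rewrite /= in_itv.
  have iphi s' : `]a, b[%classic s' -> mu.-integrable I (EFin \o phi s').
    by rewrite /= in_itv/= => /cphi; exact: integrable_I.
  have dphi' s' t : `]a, b[%classic s' -> I t -> derivable (phi^~ t) s' 1.
    by rewrite /= in_itv/= => s'I _; have [] := dphi s' t s'I.
  have iB : mu.-integrable I (EFin \o (fun=> B)).
    by apply: integrable_I; exact: rcont_cst.
  have pE s' t : a < s' < b -> partial1of2 phi s' t = phi' s' t.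
    by move=> s'I; rewrite partial1of2E; have [_ <-] := dphi s' t s'I.
  have bdp s' t : `]a, b[%classic s' -> I t -> `|partial1of2 phi s' t| <= B.
    by rewrite /= in_itv/= => s'I _; rewrite pE// bd.
  have mI : measurable I by [].
  have d1 := derivable_under_integral (mu := mu) (f := phi) mI sI iphi dphi' (fun=> B0) iB bdp.
  have d2 := differentiation_under_integral (mu := mu) (f := phi) mI sI iphi dphi' (fun=> B0) iB bdp.
  have d3 : is_derive s 1 (fun s => \int[mu]_(t in I) phi s t) 0.
    apply: DeriveDef; first exact: d1.
    rewrite -derive1E d2.
    have /eqP := m0 s sab; rewrite mulf_eq0 invr_eq0 gt_eqF ?twopi_gt0//= => /eqP E0.
    transitivity (\int[mu]_(t in I) phi' s t); last exact: E0.
    by apply: eq_Rintegral => t _; rewrite pE.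
  by rewrite -(mulr0 (2 * pi)^-1); apply: is_deriveZ.
have [||c _] := @MVT R (fun s => rmean (phi s)) (fun=> 0) 0 1 ltr01.
- move=> s; rewrite in_itv/= => /andP[s0 s1]; apply: D.
  by rewrite (lt_trans a0 s0) (lt_trans s1 b1).
- apply: derivable_within_continuous => s; rewrite in_itv/= => /andP[s0 s1].
  have sab : a < s < b by rewrite (lt_le_trans a0 s0) (le_lt_trans s1 b1).
  by have [] := D s sab.
by rewrite mul0r => /eqP; rewrite subr_eq0 => /eqP ->.
Qed.

(** Polar coordinates exhibit the closed disc as the image of a compact rectangle. *)
Lemma Hol_bounded f r : Hol f -> 0 <= r < 1 ->
  exists B : R, forall z, cabs z <= r -> cabs (f z) <= B.
Proof.
move=> hf /andP[r0 r1].
pose K : set (R * R) := [set` `[0, r]%R] `*` I.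
have cK : compact K by apply: compact_setX; exact: segment_compact.
have K0 : K !=set0.
  exists (0, 0); split => /=; rewrite in_itv/= lexx//=.
  by rewrite ltW// twopi_gt0.
have cc : continuous (fun z : R * R => circ z.1 z.2 : C).
  rewrite (_ : (fun z => _) = fun z : R * R => (z.1)%:C * E z.2); last first.
    by apply/funext => z; rewrite circ_E.
  move=> z.
  have c1 : {for z, continuous (fun z : R * R => (z.1)%:C : C)}.
    have f1 : {for z, continuous (@fst R R)} by exact: cvg_fst.
    exact: (@continuous_comp _ _ C _ (fun x : R => x%:C) z f1
      (@continuous_real_complex R _)).
  have c2 : {for z, continuous (fun z : R * R => E z.2 : C)}.
    have f2 : {for z, continuous (@snd R R)} by exact: cvg_snd.
    exact: (@continuous_comp _ _ C _ (@E R) z f2 (@continuous_E R _)).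
  exact: (cvgM c1 c2).
have cf : {within K, continuous (fun z : R * R => cabs (f (circ z.1 z.2)))}.
  apply/subspace_continuousP => z [/= + _]; rewrite in_itv/= => /andP[z0 zr].
  apply: cvg_within_filter.
  have dz : disc (circ z.1 z.2).
    by apply/discE; rewrite cabs_circ// (le_lt_trans zr).
  have h1 := continuous_comp (cc z) (Hol_continuous hf dz).
  exact: (continuous_comp h1 (@continuous_cabs R _)).
have [c _ cmax] := compact_EVT_max K0 cK cf.
exists (cabs (f (circ c.1 c.2))) => z zr.
have [z0|z0] := eqVneq z 0.
  have := cmax (0, 0); rewrite /= circ_E z0 mul0r; apply.
  rewrite inE; split => /=; rewrite in_itv/= lexx//=.
  by rewrite ltW// twopi_gt0.
have [t /andP[t0 t2] zE] := polar z0.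
rewrite zE; apply: (cmax (cabs z, t)).
by rewrite inE; split => /=; rewrite in_itv/= ?cabs_ge0 ?zr// t0 ltW.
Qed.

End PathDerivatives.

(** * Taylor expansion of holomorphic functions *)

Section CauchyExpansion.
Context {R : realType}.
Local Notation C := (R[i]^o).
Implicit Types (x : nat -> C) (f : C -> C) (r s t : R) (u w : R -> C) (z : C).

Lemma cmean_const_deriv (u u' : R -> R -> C) (a b B : R) : a < 0 -> 1 < b ->
  (forall s t, a < s < b -> cderiv (u^~ t) s (u' s t)) ->
  (forall s, a < s < b -> continuous (u s)) ->
  (forall s t, a < s < b -> cabs (u' s t) <= B) ->
  (forall s, a < s < b -> cmean (u' s) = 0) ->
  cmean (u 0) = cmean (u 1).
Proof.
move=> a0 b1 du cu bd m0; congr (_ +i* _).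
- apply: (@rmean_const_deriv _ (fun s t => complex.Re (u s t))
    (fun s t => complex.Re (u' s t)) a b B a0 b1).
  + by move=> s t sab; apply: cderiv_Re; exact: du.
  + by move=> s sab; apply: ccont_Re; exact: cu.
  + by move=> s t sab; apply: le_trans (cabs_Re _) (bd s t sab).
  + by move=> s sab; have := congr1 (@complex.Re R) (m0 s sab).
- apply: (@rmean_const_deriv _ (fun s t => complex.Im (u s t))
    (fun s t => complex.Im (u' s t)) a b B a0 b1).
  + by move=> s t sab; apply: cderiv_Im; exact: du.
  + by move=> s sab; apply: ccont_Im; exact: cu.
  + by move=> s t sab; apply: le_trans (cabs_Im _) (bd s t sab).
  + by move=> s sab; have := congr1 (@complex.Im R) (m0 s sab).
Qed.

(** The integral of a derivative along a closed curve. *)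
Lemma cmean_closed (u u' : R -> C) : continuous u' ->
  (forall t, cderiv u t (u' t)) -> u (2 * pi) = u 0 -> cmean u' = 0.
Proof.
move=> cu' du per.
rewrite (cmean_derive cu' (fun t => cderiv_Re (du t)) (fun t => cderiv_Im (du t))).
by rewrite per !subrr !mulr0.
Qed.

Lemma eq_cderiv (u v : R -> C) t d e : (forall s, u s = v s) -> d = e ->
  cderiv u t d -> cderiv v t e.
Proof. by move=> uv <-; rewrite (_ : u = v)//; apply/funext. Qed.

Definition EV t : C := E (- t).

Lemma EV_props : [/\ continuous (EV : R -> C), forall t, cabs (EV t) = 1 &
  forall t, E t * EV t = 1].
Proof.
split; last by move=> t; rewrite mulrC; exact: EN.
  rewrite (_ : EV = fun t => E (-1 * t)); first exact: continuous_Ec.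
  by apply/funext => t; rewrite mulN1r.
by move=> t; exact: cabs_E.
Qed.

Lemma EE_delta (n m : nat) : cmean (fun t => E t ^+ n * EV t ^+ m : C) = (n == m)%:R.
Proof. exact: cmean_EE. Qed.

Lemma EV_delta (m : nat) : cmean (fun t => EV t ^+ m : C) = (m == 0)%:R.
Proof.
by rewrite eq_sym -(EE_delta 0 m); apply: eq_cmean => t _; rewrite expr0 mul1r.
Qed.
Opaque EV.

(** A homotopy proof of Cauchy's formula on the circle of radius r.  For s in [0, 1] put
    p_s(t) = r (z + s (E t - z)), a circle contracting to the point r z at s = 0, and let
    u_s = f(p_s) E / (E - z).  The s-derivative of u_s is r E f'(p_s), which for s <> 0
    is, up to a constant, the t-derivative of f(p_s) and so has mean 0.  The mean of u_s
    hence is the same at s = 0, where it is f(r z), and at s = 1, where expanding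
    E / (E - z) into a geometric series gives the power series. *)
Lemma Hol_scaled_expansion f r z : Hol f -> Hol (derive1 f) -> 0 < r < 1 -> disc z ->
  f (r%:C * z) = ps (fun n => cmean (fun t => f (circ r t) * EV t ^+ n)) z.
Proof.
move=> hf hF /andP[r0 r1] /[dup] dz /discE z1.
have [cV V1 EVE] := EV_props.
have a1 : adm (fun=> 1 : C) by apply: (@adm_bounded _ 1) => j; rewrite cabs1.
have dzV t : disc (z * EV t) by apply/discE; rewrite cabsM V1 mulr1.
pose k t : C := ps (fun=> 1) (z * EV t).
have ck : continuous k.
  move=> t; have c1 : {for t, continuous (fun t => z * EV t)}.
    exact: (ccontM (@ccont_cst R z) cV).
  exact: (continuous_comp c1 (Hol_continuous (Hol_ps a1) (dzV t))).
have kE t : (E t - z) * k t = E t.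
  have h := ps_one (dzV t).
  have -> : E t - z = E t * (1 - z * EV t).
    by rewrite mulrBr mulr1 mulrCA EVE mulr1.
  by rewrite -mulrA h mulr1.
(* room for the parameter s to move beyond [0, 1] while p_s stays inside the disc *)
have [d d0 rd] : exists2 d : R, 0 < d & r * (1 + 2 * d) < 1.
  exists ((1 - r) / (4 * r)); first by rewrite divr_gt0 ?subr_gt0// mulr_gt0.
  by rewrite mulrDr mulr1 (_ : r * (2 * _) = (1 - r) / 2); [lra|field; rewrite gt_eqF].
pose rho := r * (1 + 2 * d).
have rho0 : 0 <= rho < 1 by rewrite /rho rd mulr_ge0// ?(ltW r0)// addr_ge0// mulr_ge0// ltW.
pose p s t : C := r%:C * (z + s%:C * (E t - z)).
have pb s t : - d < s < 1 + d -> cabs (p s t) <= rho.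
  move=> /andP[s0 s1]; rewrite /p cabsM cabsR ger0_norm ?(ltW r0)//.
  apply: ler_wpM2l; first exact: ltW.
  have -> : z + s%:C * (E t - z) = (1 - s)%:C * z + s%:C * E t.
    by rewrite rmorphB rmorph1; ring.
  apply: (le_trans (cabsD _ _)); rewrite !cabsM !cabsR cabs_E mulr1.
  apply: (@le_trans _ _ (`|1 - s| + `|s|)).
    by rewrite lerD2r ler_piMr// ltW.
  have [s00|s00] := leP 0 s; have [s11|s11] := leP s 1.
  - by rewrite !ger0_norm ?subr_ge0//; lra.
  - by rewrite (ger0_norm s00) ltr0_norm ?subr_lt0//; lra.
  - by rewrite (ltr0_norm s00) ger0_norm ?subr_ge0//; lra.
  - by exfalso; lra.
have dp s t : - d < s < 1 + d -> disc (p s t).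
  by move=> sd; apply/discE; apply: (le_lt_trans (pb s t sd)); case/andP: rho0.
have [B hB] := Hol_bounded hF rho0.
have cp s : continuous (p s).
  apply: ccontM; first exact: ccont_cst.
  apply: ccontD; first exact: ccont_cst.
  apply: ccontM; first exact: ccont_cst.
  apply: ccontD; [exact: continuous_E|exact: ccont_cst].
have cfp (g : C -> C) s : Hol g -> - d < s < 1 + d -> continuous (fun t => g (p s t)).
  by move=> hg sd t; exact: (continuous_comp (cp s t) (Hol_continuous hg (dp s t sd))).
have dps t s : cderiv (p^~ t) s (r%:C * (E t - z)).
  by apply: cderivZ; apply: cderivD_cst; exact: cderiv_lin.
have dpt s t : cderiv (p s) t (r%:C * (s%:C * ('i * E t))).
  apply: cderivZ; apply: cderivD_cst; apply: cderivZ.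
  apply: (@eq_cderiv (fun t => - z + E t)) (cderivD_cst _ (@cderiv_E R t)) => //.
  by move=> s'; rewrite addrC.
pose u s t := f (p s t) * k t.
pose u' s t := derive1 f (p s t) * (r%:C * E t).
have cu' s : - d < s < 1 + d -> continuous (u' s).
  move=> sd; apply: ccontM; first exact: cfp.
  by apply: ccontM; [exact: ccont_cst|exact: continuous_E].
(* the factor E t - z of the derivative of p_s cancels the denominator in k *)
have u01 : cmean (u 0) = cmean (u 1).
  apply: (@cmean_const_deriv u u' (- d) (1 + d) (B * r)).
  - by rewrite oppr_lt0.
  - by rewrite ltrDl.
  - move=> s t sd.
    have h := cderivZ (k t) (cderiv_comp (dps t s) (hf _ (dp s t sd))).
    apply: eq_cderiv h; first by move=> s'; rewrite mulrC.
    by rewrite /u' -{2}(kE t); ring.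
  - move=> s sd; apply: ccontM; [exact: cfp|exact: ck].
  - move=> s t sd; rewrite /u' !cabsM cabs_E mulr1 cabsR ger0_norm ?(ltW r0)//.
    by apply: ler_wpM2r; [exact: ltW|apply: hB; exact: pb].
  - move=> s sd; have [s0|s0] := eqVneq s 0.
      rewrite s0 (_ : u' 0 = fun t => (derive1 f (r%:C * z) * r%:C) * E t ^+ 1).
        have cE1 : continuous (fun t => E t ^+ 1 : C) by exact: continuous_E.
        by rewrite (cmeanZ _ cE1) cmean_En mulr0.
      by apply/funext => t; rewrite /u' /p mul0r addr0 expr1 mulrA.
    have h : cmean (fun t => s%:C * 'i * u' s t) = 0.
      apply: (@cmean_closed (fun t => f (p s t))).
      - by apply: ccontM; [exact: ccont_cst|exact: cu'].
      - move=> t; apply: eq_cderiv (cderiv_comp (dpt s t) (hf _ (dp s t sd))) => //.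
        by rewrite /u'; ring.
      - by rewrite /p E_2pi E0.
    move: h; rewrite (cmeanZ _ (cu' s sd)) => /eqP; rewrite !mulf_eq0.
    have i0 : ('i : C) != 0 by rewrite eq_complex/= oner_eq0 andbF.
    have sC0 : (s%:C : C) != 0 by rewrite (inj_eq (@complexI R) _ 0).
    by rewrite (negbTE i0) (negbTE sC0) /= => /eqP.
have dd0 : - d < 0 < 1 + d by rewrite oppr_lt0 d0 addr_gt0.
have u0E : cmean (u 0) = f (r%:C * z).
  have -> : u 0 = fun t => f (r%:C * z) * k t.
    by apply/funext => t; rewrite /u /p mul0r addr0.
  rewrite (cmeanZ _ ck).
  have ck1 : cmean k = cmean (fun t => 1 * k t).
    by apply: eq_cmean => t _; rewrite mul1r.
  have [hk _] := cmean_ps (@ccont_cst R 1) cV V1 a1 dz.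
  rewrite ck1 hk.
  have -> : (fun n => cmean (fun t => 1 * EV t ^+ n) * 1) = fun n => (n == 0)%:R :> C.
    apply/funext => n; rewrite mulr1 -EV_delta; apply: eq_cmean => t _.
    by rewrite mul1r.
  by rewrite (ps_delta 0 dz) expr0 mulr1.
have cfr : continuous (fun t => f (circ r t)).
  move=> t; have dr : disc (circ r t).
    by apply/discE; rewrite cabs_circ// ltW.
  exact: (continuous_comp (@continuous_circ R r t) (Hol_continuous hf dr)).
have [hk _] := cmean_ps cfr cV V1 a1 dz.
rewrite -u0E u01.
have -> : cmean (u 1) = cmean (fun t => f (circ r t) * ps (fun=> 1) (z * EV t)).
  apply: eq_cmean => t _; rewrite /u /p rmorph1 mul1r addrCA subrr addr0.
  by rewrite circ_E.
rewrite hk; congr (ps _ z); apply/funext => n.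
by rewrite mulr1.
Qed.

(** Cauchy's formula for the coefficients, from the orthogonality of the characters. *)
Lemma ps_coef_mean x r n : adm x -> 0 < r < 1 ->
  cmean (fun t => EV t ^+ n * ps x (circ r t)) = x n * r%:C ^+ n.
Proof.
move=> ax /andP[r0 r1]; have [cV V1 EVE] := EV_props.
have dr : disc (r%:C : C) by apply/discE; rewrite cabsR ger0_norm// ltW.
have cVn : continuous (fun t => EV t ^+ n : C).
  elim: n => [|n IH].
    rewrite (_ : (fun t => _) = fun=> 1); first exact: ccont_cst.
    by apply/funext => t; rewrite expr0.
  rewrite (_ : (fun t => _) = fun t => EV t * EV t ^+ n).
    exact: ccontM cV IH.
  by apply/funext => t; rewrite exprS.
have [h _] := cmean_ps cVn (@continuous_E R) (@cabs_E R) ax dr.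
have -> : cmean (fun t => EV t ^+ n * ps x (circ r t)) =
   cmean (fun t => EV t ^+ n * ps x (r%:C * E t)).
  by apply: eq_cmean => t _; rewrite circ_E.
rewrite h.
have -> : (fun j => cmean (fun t => EV t ^+ n * E t ^+ j) * x j) =
    fun j => x n * (j == n)%:R.
  apply/funext => j; rewrite -EE_delta.
  have -> : cmean (fun t => EV t ^+ n * E t ^+ j) = cmean (fun t => E t ^+ j * EV t ^+ n).
    by apply: eq_cmean => t _; rewrite mulrC.
  by rewrite EE_delta; case: eqP => [->|_]; rewrite ?mulr1 ?mul1r ?mulr0 ?mul0r.
have ad : adm (fun i => (i == n)%:R : C).
  by apply: (@adm_bounded _ 1) => i; case: eqP; rewrite ?cabs1 ?cabs0.
by rewrite (psZ _ ad dr) (ps_delta n dr).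
Qed.

Lemma ps_coef_le x r n : adm x -> 0 < r < 1 ->
  cabs (x n) * r ^+ n <= rmean (fun t => cabs (ps x (circ r t))).
Proof.
move=> ax r01; have [cV V1 EVE] := EV_props.
have /andP[r0 r1] := r01.
have cVn : continuous (fun t => EV t ^+ n : C).
  elim: n => [|n IH].
    rewrite (_ : (fun t => _) = fun=> 1); first exact: ccont_cst.
    by apply/funext => t; rewrite expr0.
  rewrite (_ : (fun t => _) = fun t => EV t * EV t ^+ n).
    exact: ccontM cV IH.
  by apply/funext => t; rewrite exprS.
have cpr : continuous (fun t => ps x (circ r t)).
  move=> t; apply: (continuous_comp (@continuous_circ R r t)).
  by apply: Hol_continuous; [exact: Hol_ps|exact: disc_circ01].
have := cabs_cmean (ccontM cVn cpr).
rewrite (ps_coef_mean n ax r01) cabsM cabsX cabsR ger0_norm ?(ltW r0)//.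
rewrite (_ : (fun t => cabs (EV t ^+ n * _)) = fun t => cabs (ps x (circ r t)))//.
by apply/funext => t; rewrite cabsM cabsX V1 expr1n mul1r.
Qed.

(** The expansions of f(r z) for the various r < 1 are compatible by uniqueness of
    coefficients, so they all come from one sequence x with c_r(n) = r^n x_n; the radius
    1/2 serves to define x. *)
Lemma Hol_expansion f : Hol f -> Hol (derive1 f) ->
  adm (taylor f) /\ forall z, disc z -> f z = ps (taylor f) z.
Proof.
move=> hf hF; have [cV V1 EVE] := EV_props.
pose c r n : C := cmean (fun t => f (circ r t) * EV t ^+ n).
have cE r z : 0 < r < 1 -> disc z -> f (r%:C * z) = ps (c r) z.
  by move=> r01 dz; exact: Hol_scaled_expansion.
have ac r : 0 < r < 1 -> adm (c r).
  move=> r01; have a1 : adm (fun=> 1 : C).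
    by apply: (@adm_bounded _ 1) => j; rewrite cabs1.
  have cfr : continuous (fun t => f (circ r t)).
    move=> t; exact: (continuous_comp (@continuous_circ R r t)
      (Hol_continuous hf (disc_circ01 t r01))).
  have [_ h] := cmean_ps cfr cV V1 a1 (@disc0 R).
  exact: adm_bounded h.
have cc r s : 0 < r < 1 -> 0 < s < 1 -> r <= s ->
    c r = fun n => (r / s)%:C ^+ n * c s n.
  move=> r01 s01 rs; have /andP[r0 r1] := r01; have /andP[s0 s1] := s01.
  have rs1 : 0 <= r / s <= 1.
    by rewrite divr_ge0 ?(ltW r0) ?(ltW s0)//= ler_pdivrMr// mul1r.
  have rsc n : cabs ((r / s)%:C ^+ n : C) <= 1.
    by case/andP: rs1 => h0 h1; rewrite cabsX cabsR ger0_norm// exprn_ile1.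
  apply: ps_inj; [exact: ac|exact: (adm_mult rsc (ac s s01))|].
  move=> z dz; rewrite ps_dilate -(cE r z r01 dz) -cE//; last first.
    apply/discE; rewrite cabsM cabsR; case/andP: rs1 => h0 h1.
    rewrite ger0_norm//; move/discE : dz => dz.
    by apply: le_lt_trans dz; rewrite ler_piMl// cabs_ge0.
  by rewrite mulrA -rmorphM/= [s * _]mulrC divfK// gt_eqF.
pose x n : C := (2^-1)%:C ^- n * c 2^-1 n.
have h01 : 0 < (2^-1 : R) < 1 by rewrite invr_gt0 ltr0n invf_lt1// ltr1n.
have xE r n : 0 < r < 1 -> c r n = r%:C ^+ n * x n.
  move=> r01; have /andP[r0 r1] := r01; rewrite /x.
  have hn0 : ((2^-1)%:C : C) != 0 by rewrite (inj_eq (@complexI R) _ 0).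
  have rn0 : (r%:C : C) != 0 by rewrite (inj_eq (@complexI R) _ 0) gt_eqF.
  have [rh|/ltW rh] := leP r 2^-1.
    rewrite (cc _ _ r01 h01 rh) rmorphM fmorphV/= exprMn exprVn.
    by rewrite mulrA.
  rewrite (cc _ _ h01 r01 rh).
  have -> : ((2^-1 / r)%:C : C) = (2^-1)%:C / r%:C.
    by rewrite rmorphM (fmorphV (real_complex R) r).
  have G (a b d : C) : a != 0 -> b != 0 -> d = a * (b^-1 * (b / a * d)).
    by move=> a0 b0; field; rewrite a0 b0.
  by rewrite expr_div_n; apply: G; rewrite expf_neq0.
have ax : adm x.
  move=> r r01; have /andP[r0 r1] := r01.
  have [M hM] : exists M : R, forall n, cabs (c r n) <= M.
    have a1 : adm (fun=> 1 : C).
      by apply: (@adm_bounded _ 1) => j; rewrite cabs1.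
    have cfr : continuous (fun t => f (circ r t)).
      move=> t; exact: (continuous_comp (@continuous_circ R r t)
        (Hol_continuous hf (disc_circ01 t r01))).
    have [_ h] := cmean_ps cfr cV V1 a1 (@disc0 R).
    by exists (rmean (fun t => cabs (f (circ r t)))).
  exists M => n; apply: le_trans (hM n).
  rewrite (xE r n r01) [cabs (r%:C ^+ n * x n)]cabsM cabsX cabsR.
  by rewrite ger0_norm ?(ltW r0)// mulrC.
have fx z : disc z -> f z = ps x z.
  move=> /discE dz.
  have [r [zr r1]] : exists r : R, cabs z < r /\ r < 1.
    by exists ((1 + cabs z) / 2); split; lra.
  have r0 : 0 < r := le_lt_trans (cabs_ge0 z) zr.
  have rn0 : (r%:C : C) != 0 by rewrite (inj_eq (@complexI R) _ 0) gt_eqF.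
  have r01 : 0 < r < 1 by rewrite r0.
  have dzr : disc (r%:C^-1 * z).
    by apply/discE; rewrite cabsM cabsV cabsR ger0_norm ?(ltW r0)// mulrC ltr_pdivrMr// mul1r.
  have -> : z = r%:C * (r%:C^-1 * z) by rewrite mulVKf.
  rewrite (cE r _ r01 dzr) -ps_dilate; congr (ps _ _); apply/funext => n.
  exact: xE.
by rewrite (taylor_ps ax fx); split.
Qed.

End CauchyExpansion.

(** * Uniform convexity of q-th powers *)

Section UniformConvexity.
Context {R : realType}.
Local Notation C := (R[i]^o).
Implicit Types (x y : nat -> C) (f : C -> C) (q r s t : R).

(** Write 1 + t as (1 + u)(1 + v) with u = t/2 and v = u/(1 + u), and multiply the two
    Bernoulli inequalities: the product of the linear terms is the quadratic gain. *)
Lemma powR_bernoulli2 q t : 1 <= q -> 0 <= t <= 1 ->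
  1 + q * t + q * (q - 1) * t ^+ 2 / 6 <= (1 + t) `^ q.
Proof.
move=> q1 /andP[t0 t1].
have h0 : 0 <= 1 + t / 2 by lra.
have g0 : 0 <= 1 + t / 2 / (1 + t / 2) by rewrite addr_ge0// divr_ge0//; lra.
have h1 : 0 < 1 + t / 2 by lra.
have -> : 1 + t = (1 + t / 2) * (1 + t / 2 / (1 + t / 2)).
  by field; rewrite gt_eqF//; lra.
rewrite powRM//.
have A := powR_bernoulli q1 h0; have B := powR_bernoulli q1 g0.
rewrite addrAC subrr add0r in A; rewrite addrAC subrr add0r in B.
have A0 : 0 <= 1 + q * (t / 2) by rewrite addr_ge0// mulr_ge0 ?divr_ge0// (le_trans ler01).
have B0 : 0 <= 1 + q * (t / 2 / (1 + t / 2)).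
  by rewrite addr_ge0// mulr_ge0 ?divr_ge0// (le_trans ler01).
apply: le_trans (ler_pM A0 B0 A B).
have -> : (1 + q * (t / 2)) * (1 + q * (t / 2 / (1 + t / 2))) =
   1 + q * t + q * (q - 1) * t ^+ 2 / (4 * (1 + t / 2)).
  by field; rewrite ?gt_eqF//; lra.
rewrite lerD2l ler_wpM2l//.
  by rewrite mulr_ge0 ?sqr_ge0// mulr_ge0 ?subr_ge0// (le_trans ler01).
by rewrite lef_pV2 ?posrE//; lra.
Qed.

Lemma powR_midpoint q (h e : R) : 1 <= q -> 0 < h -> 0 <= e <= 2 * h ->
  h `^ q * (1 + q * (q - 1) * e ^+ 2 / (48 * h ^+ 2)) <=
  ((h + e / 2) `^ q + (h - e / 2) `^ q) / 2.
Proof.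
move=> q1 h0 /andP[e0 e2]; pose t := e / (2 * h).
have t01 : 0 <= t <= 1.
  by rewrite /t divr_ge0 ?mulr_ge0 ?(ltW h0)//= ler_pdivrMr ?mulr_gt0// mul1r.
have hne : h != 0 by rewrite gt_eqF.
have -> : h + e / 2 = h * (1 + t) by rewrite /t; field.
have -> : h - e / 2 = h * (1 - t) by rewrite /t; field.
have t1 : 0 <= 1 - t by case/andP: t01 => _; rewrite subr_ge0.
have t2 : 0 <= 1 + t by case/andP: t01 => h1 _; rewrite addr_ge0.
rewrite (powRM q (ltW h0) t1) (powRM q (ltW h0) t2) -mulrDr -(mulrA (h `^ q)).
apply: ler_wpM2l; first exact: powR_ge0.
have A := powR_bernoulli2 q1 t01; have B := powR_bernoulli q1 t1.
have -> : q * (q - 1) * e ^+ 2 / (48 * h ^+ 2) = q * (q - 1) * t ^+ 2 / 12.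
  by rewrite /t; field.
by lra.
Qed.

(** Here x and y are the moduli of two complex numbers, m that of their midpoint and d that
    of their difference.  If x and y differ by a definite part of d the gain comes from the
    strict convexity of the power; otherwise the parallelogram law makes m definitely
    smaller than h. *)
Lemma convexity_defect q (x y m d : R) : 1 <= q -> 0 <= x -> 0 <= y -> 0 <= m ->
  0 < x + y -> m ^+ 2 = (x ^+ 2 + y ^+ 2) / 2 - d ^+ 2 / 4 -> `|x - y| <= d ->
  let h := (x + y) / 2 in
  h `^ q * Num.min (1 / 16) (q * (q - 1) / 96) * (d / h) ^+ 2 <=
  (x `^ q + y `^ q) / 2 - m `^ q.
Proof.
move=> q1 x0 y0 m0 xy0 mE ed; pose e := `|x - y|; set h := (x + y) / 2 => /=.
have h0 : 0 < h by rewrite divr_gt0.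
have e0 : 0 <= e by exact: normr_ge0.
have e2h : e <= 2 * h.
  by rewrite /e /h ler_norml; apply/andP; split; lra.
have xyE : x `^ q + y `^ q = (h + e / 2) `^ q + (h - e / 2) `^ q.
  rewrite /e; have [xy|xy] := ger0P (x - y).
    have -> : h + (x - y) / 2 = x by rewrite /h; field.
    by have -> : h - (x - y) / 2 = y by rewrite /h; field.
  have -> : h + - (x - y) / 2 = y by rewrite /h; field.
  by rewrite addrC; have -> : h - - (x - y) / 2 = x by rewrite /h; field.
have e2 : e ^+ 2 = (x - y) ^+ 2 by rewrite real_normK ?num_real.
have mh : m ^+ 2 = h ^+ 2 + e ^+ 2 / 4 - d ^+ 2 / 4 by rewrite mE e2 /h; field.
have d0 : 0 <= d by exact: le_trans ed.
have ed2 : e ^+ 2 <= d ^+ 2 by rewrite ler_pXn2r ?nnegrE.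
have M : h `^ q * (1 + q * (q - 1) * e ^+ 2 / (48 * h ^+ 2)) <= (x `^ q + y `^ q) / 2.
  by rewrite xyE; apply: powR_midpoint => //; rewrite e0.
have hq0 : 0 <= h `^ q by exact: powR_ge0.
have h2 : 0 < h ^+ 2 by rewrite exprn_gt0.
have q0 : 0 <= q by exact: le_trans q1.
have qq0 : 0 <= q * (q - 1) by rewrite mulr_ge0// subr_ge0.
have hne : h != 0 by rewrite gt_eqF.
have mleh : m <= h.
  by rewrite -(@ler_pXn2r _ 2)// ?nnegrE ?(ltW h0)//; lra.
(* e is the difference of the moduli: radial case if d^2 <= 2 e^2, angular case otherwise *)
have [A|B] := leP (d ^+ 2) (2 * e ^+ 2).
  have mq : m `^ q <= h `^ q by apply: ge0_ler_powR; rewrite ?nnegrE ?(ltW h0).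
  apply: (@le_trans _ _ (h `^ q * (q * (q - 1) * e ^+ 2 / (48 * h ^+ 2)))); last first.
    by move: M; rewrite mulrDr mulr1; lra.
  rewrite -mulrA; apply: ler_wpM2l => //.
  apply: (@le_trans _ _ (q * (q - 1) / 96 * (d / h) ^+ 2)).
    by rewrite ler_wpM2r ?sqr_ge0// ge_min lexx orbT.
  have -> : q * (q - 1) / 96 * (d / h) ^+ 2 = (q * (q - 1) / (48 * h ^+ 2)) * (d ^+ 2 / 2).
    by field.
  have -> : q * (q - 1) * e ^+ 2 / (48 * h ^+ 2) = (q * (q - 1) / (48 * h ^+ 2)) * e ^+ 2.
    by field.
  apply: ler_wpM2l; last by lra.
  by rewrite divr_ge0// mulr_ge0// ltW.
have mu1 : 0 <= m / h <= 1 by rewrite divr_ge0 ?(ltW h0)//= ler_pdivrMr// mul1r.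
have mqE : m `^ q = h `^ q * (m / h) `^ q.
  by case/andP: mu1 => mu0 _; rewrite -(powRM q (ltW h0) mu0) mulrC divfK.
have mq : (m / h) `^ q <= 1 - (d / h) ^+ 2 / 16.
  apply: (@le_trans _ _ (m / h)).
    have [->|mun0] := eqVneq (m / h) 0; first by rewrite powR0// gt_eqF// (lt_le_trans ltr01).
    have mup : 0 < m / h <= 1.
      by case/andP: mu1 => h1 ->; rewrite lt_neqAle eq_sym mun0 h1.
    by apply: ge1r_powR.
  have : (m / h) ^+ 2 <= 1 - (d / h) ^+ 2 / 8.
    rewrite (expr_div_n m) ler_pdivrMr//.
    have -> : (1 - (d / h) ^+ 2 / 8) * h ^+ 2 = h ^+ 2 - d ^+ 2 / 8 by field.
    by lra.
  have : 0 <= (m / h - 1) ^+ 2 by exact: sqr_ge0.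
  by nra.
have M' : h `^ q <= (x `^ q + y `^ q) / 2.
  apply: le_trans M; rewrite ler_peMr// lerDl.
  by apply: divr_ge0; apply: mulr_ge0; rewrite ?sqr_ge0.
rewrite mqE; apply: (@le_trans _ _ (h `^ q * ((d / h) ^+ 2 / 16))).
  rewrite -mulrA; apply: ler_wpM2l => //.
  rewrite [leRHS]mulrC ler_wpM2r ?sqr_ge0// ge_min mul1r lexx//.
have := ler_wpM2l hq0 mq; rewrite mulrBr mulr1; lra.
Qed.

Lemma parallelogram (a b : C) :
  cabs ((2^-1)%:C * (a + b)) ^+ 2 =
  (cabs a ^+ 2 + cabs b ^+ 2) / 2 - cabs (a - b) ^+ 2 / 4.
Proof.
have sq (c : C) : cabs c ^+ 2 = complex.Re c ^+ 2 + complex.Im c ^+ 2.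
  by case: c => u v; rewrite /cabs normc_def/= sqr_sqrtr// addr_ge0 ?sqr_ge0.
rewrite cabsM exprMn cabsR ger0_norm ?invr_ge0// !sq.
by case: a => a1 a2; case: b => b1 b2 /=; field.
Qed.

(** If d is small compared with the size h of a and b, the first term dominates; otherwise
    the defect of [convexity_defect] is at least a fixed multiple of h^q. *)
Lemma uniform_convexity q (e : R) : 1 < q -> 0 < e -> exists2 K : R, 0 < K &
  forall a b : C, cabs (a - b) `^ q <= e * (cabs a `^ q + cabs b `^ q) +
    K * ((cabs a `^ q + cabs b `^ q) / 2 - cabs ((2^-1)%:C * (a + b)) `^ q).
Proof.
move=> q1 e0; have q0 : 0 < q by exact: lt_trans q1.
pose c := Num.min (1 / 16) (q * (q - 1) / 96).
have c0 : 0 < c.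
  by rewrite /c lt_min !divr_gt0// mulr_gt0// subr_gt0.
pose e1 := e `^ q^-1.
have e10 : 0 < e1 by exact: powR_gt0.
have e1q : e1 `^ q = e by rewrite -powRrM mulVf ?powRr1 ?(ltW e0)// gt_eqF.
have K0 : 0 < 2 `^ q / (c * e1 ^+ 2).
  by rewrite divr_gt0 ?powR_gt0// mulr_gt0// exprn_gt0.
exists (2 `^ q / (c * e1 ^+ 2)) => // a b.
set x := cabs a; set y := cabs b; set d := cabs (a - b); set m := cabs (_ * (a + b)).
have x0 : 0 <= x := cabs_ge0 _; have y0 : 0 <= y := cabs_ge0 _.
have d0 : 0 <= d := cabs_ge0 _; have m0 : 0 <= m := cabs_ge0 _.
have dxy : d <= x + y by rewrite /d (le_trans (cabsD _ _))// cabsN.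
have ed : `|x - y| <= d := cabsB_le _ _.
have mE : m ^+ 2 = (x ^+ 2 + y ^+ 2) / 2 - d ^+ 2 / 4 := parallelogram a b.
have [xy0|xyn0] := eqVneq (x + y) 0.
  have x00 : x = 0 by lra.
  have y00 : y = 0 by lra.
  have d00 : d = 0 by lra.
  have m00 : m = 0.
    by apply/eqP; rewrite -sqrf_eq0 mE x00 y00 d00 expr0n /= !mul0r addr0 mul0r subr0.
  by rewrite x00 y00 d00 m00 powR0 ?gt_eqF// addr0 mul0r subr0 !mulr0 addr0.
have xy0 : 0 < x + y by rewrite lt_neqAle eq_sym xyn0 addr_ge0.
have D := convexity_defect (ltW q1) x0 y0 m0 xy0 mE ed.
have [h hE] : exists h : R, h = (x + y) / 2 by exists ((x + y) / 2).
rewrite -/c /= -hE in D.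
have h0 : 0 < h by rewrite hE divr_gt0.
have hq : h `^ q <= (x `^ q + y `^ q) / 2.
  have e2 : 0 <= `|x - y| <= 2 * h.
    rewrite normr_ge0 hE; apply: (le_trans ed); apply: (le_trans dxy).
    by rewrite mulrC divfK.
  have xyE : x `^ q + y `^ q = (h + `|x - y| / 2) `^ q + (h - `|x - y| / 2) `^ q.
    have [xy|xy] := ger0P (x - y).
      have -> : h + (x - y) / 2 = x by rewrite hE; field.
      by have -> : h - (x - y) / 2 = y by rewrite hE; field.
    have -> : h + - (x - y) / 2 = y by rewrite hE; field.
    by rewrite addrC; have -> : h - - (x - y) / 2 = x by rewrite hE; field.
  rewrite xyE; apply: le_trans (powR_midpoint (ltW q1) h0 e2).
  have qq : 0 <= q * (q - 1) by rewrite ltW// mulr_gt0// subr_gt0.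
  rewrite ler_peMr ?powR_ge0// lerDl.
  by apply: divr_ge0; apply: mulr_ge0; rewrite ?sqr_ge0.
set V := (x `^ q + y `^ q) / 2 - m `^ q in D *.
have V0 : 0 <= V.
  apply: le_trans D; rewrite mulr_ge0 ?sqr_ge0// mulr_ge0 ?powR_ge0//.
  exact: ltW.
have xq : 0 <= x `^ q by exact: powR_ge0.
have yq : 0 <= y `^ q by exact: powR_ge0.
have [dh|dh] := leP d (e1 * h).
  apply: (@le_trans _ _ (e * h `^ q)).
    have -> : e * h `^ q = (e1 * h) `^ q by rewrite (powRM q (ltW e10) (ltW h0)) e1q.
    apply: (@ge0_ler_powR R q (ltW q0)); rewrite ?nnegrE//.
    by rewrite mulr_ge0// ltW.
  have : e * h `^ q <= e * (x `^ q + y `^ q).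
    by rewrite ler_wpM2l ?(ltW e0)//; lra.
  by move/le_trans; apply; rewrite lerDl mulr_ge0// ltW.
apply: (@le_trans _ _ (2 `^ q * h `^ q)).
  rewrite -(powRM q _ (ltW h0))//.
  apply: (@ge0_ler_powR R q (ltW q0)); rewrite ?nnegrE//.
    by rewrite mulr_ge0// ltW.
  by rewrite hE mulrC divfK.
have hV : h `^ q * (c * e1 ^+ 2) <= V.
  apply: le_trans D; rewrite -mulrA; apply: ler_wpM2l; first exact: powR_ge0.
  apply: ler_wpM2l; first exact: ltW.
  rewrite ler_pXn2r ?nnegrE ?(ltW e10) ?divr_ge0 ?(ltW h0)//.
  by rewrite ler_pdivlMr// ltW.
have : 2 `^ q * h `^ q <= 2 `^ q / (c * e1 ^+ 2) * V.
  rewrite -mulrA; apply: ler_wpM2l; first exact: powR_ge0.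
  have ce0 : 0 < c * e1 ^+ 2 by rewrite mulr_gt0// exprn_gt0.
  by rewrite [leRHS]mulrC (ler_pdivlMr _ _ ce0).
move/le_trans; apply; rewrite lerDr mulr_ge0 ?(ltW e0)//.
exact: addr_ge0.
Qed.

End UniformConvexity.

(** * Norm convergence of dilations *)

Lemma sub_double_le (R : realType) (a b c L d : R) :
  a <= b + c -> c <= d -> L - d < a -> L - 2 * d <= b.
Proof. by move=> *; lra. Qed.

Lemma tangent_lower_bound (R : realType) (l b q v L d : R) :
  q * b * (- (2 * d)) <= q * b * (v - L) -> l - 2 * d * q * b <= l + q * b * (v - L).
Proof. by move=> *; lra. Qed.

Lemma weight_half_add (R : realType) (ee e1 l : R) :
  e1 * (4 * (1 + l)) = ee -> 0 <= e1 -> e1 * (l + l) <= ee / 2.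
Proof. by move=> <- e0; lra. Qed.

Lemma weight_half_mul (R : realType) (ee d l : R) :
  d * (4 * (1 + l)) = ee -> 0 <= d -> 2 * d * l <= ee / 2.
Proof. by move=> <- e0; lra. Qed.

Lemma defect_combine (R : realType) (a1 a2 a3 v l e1 K ee w : R) :
  a1 <= (e1 + K / 2) * (a2 + a3) + - K * v ->
  (e1 + K / 2) * (a2 + a3) <= (e1 + K / 2) * (l + l) ->
  K * (l - w) <= K * v ->
  e1 * (l + l) <= ee / 2 -> K * w <= ee / 2 -> a1 <= ee.
Proof. by move=> *; lra. Qed.

Lemma defect_regroup (R : realType) (D e1 K A S V : R) :
  D <= e1 * (A + S) + K * ((A + S) / 2 - V) ->
  D <= (e1 + K / 2) * (A + S) + - K * V.
Proof. by move=> *; lra. Qed.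

Lemma eq_ler (R : numDomainType) (a b : R) : a = b -> a <= b.
Proof. by move=> ->. Qed.

Section Dilations.
Context {R : realType}.
Local Notation C := (R[i]^o).
Implicit Types (x y : nat -> C) (f : C -> C) (q r s t : R).

Lemma onem_exprn_le s n : 0 <= s <= 1 -> 0 <= 1 - s ^+ n <= n%:R * (1 - s).
Proof.
move=> /andP[s0 s1]; elim: n => [|n /andP[h1 h2]].
  by rewrite expr0 subrr mul0r lexx.
have sn0 : 0 <= s ^+ n by rewrite exprn_ge0.
have sn1 : s ^+ n <= 1 by rewrite exprn_ile1.
rewrite exprS -[n.+1]addn1 natrD mulrDl mul1r; apply/andP; split.
  by rewrite subr_ge0 mulr_ile1.
have -> : 1 - s * s ^+ n = (1 - s ^+ n) + s ^+ n * (1 - s) by ring.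
apply: lerD => //.
by rewrite ler_piMl// subr_ge0.
Qed.

(** Locally uniform convergence of dilations on a fixed smaller disc; the factor 1/2 is the
    one of the decomposition y = (y + y_s)/2 + (y - y_s)/2. *)
Lemma coef_dilation_small y r (e : R) : adm y -> 0 <= r < 1 -> 0 < e ->
  exists s, 0 < s < 1 /\ forall z, cabs z <= r ->
    cabs (ps (fun n => ((1 - s ^+ n) / 2)%:C * y n) z) <= e.
Proof.
move=> ay r01 e0; have [N [d [d0 hd]]] := coef_small ay r01 ler01 e0.
pose k : R := Num.min (2^-1) (d / N.+1%:R).
have k0 : 0 < k by rewrite lt_min invr_gt0 ltr0n /= divr_gt0.
have k1 : k <= 2^-1 by rewrite ge_min lexx.
have s01 : 0 < 1 - k < 1.
  have : (2^-1 : R) < 1 by rewrite invf_lt1// ltr1n.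
  by move=> h; apply/andP; split; lra.
exists (1 - k); split=> // z zr.
have s01' : 0 <= 1 - k <= 1 by case/andP: s01 => h1 h2; rewrite !ltW.
have h n : 0 <= (1 - (1 - k) ^+ n) / 2 <= 1.
  have /andP[h1 _] := onem_exprn_le n s01'.
  have : 0 <= (1 - k) ^+ n by rewrite exprn_ge0//; case/andP: s01'.
  by move=> h2; apply/andP; split; lra.
apply: (hd (fun n => ((1 - (1 - k) ^+ n) / 2)%:C)) => [n|n nN|]; last exact: zr.
  by case/andP: (h n) => h1 h2; rewrite cabsR ger0_norm.
case/andP: (h n) => h1 h2; rewrite cabsR ger0_norm//.
have /andP[g1 g2] := onem_exprn_le n s01'.
have kd : k * N.+1%:R <= d by rewrite -ler_pdivlMr// ge_min lexx orbT.
have nk : n%:R * k <= N.+1%:R * k.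
  by rewrite ler_wpM2r ?(ltW k0)// ler_nat ltnW// ltnW.
have e2 : 1 - (1 - k) = k by lra.
by rewrite e2 in g2; lra.
Qed.

(** Let L be the supremum of the means of y, nearly attained at r0.  For s near 1, on
    the circle r0, hence by monotonicity on all larger ones, the average
    (y + y_s)/2 has mean at least L - 2 d, while y and y_s have means at most L.
    Integrating [uniform_convexity] then forces y - y_s to be small. *)
Lemma dilation_cvg q y (A e : R) : 1 < q -> adm y ->
  (forall r, 0 < r < 1 -> Mq q r (ps y) <= A) -> 0 < e ->
  exists s, 0 < s < 1 /\ forall r, 0 < r < 1 ->
    Mq q r (ps (fun n => (1 - s ^+ n)%:C * y n)) <= e.
Proof.
move=> q1 ay yA e0; have q0 : 0 < q by exact: lt_trans q1.
have q1' := ltW q1.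
have h01 : 0 < (2^-1 : R) < 1 by rewrite invr_gt0 ltr0n invf_lt1// ltr1n.
pose S : set R := [set Mq q r (ps y) | r in [set r | 0 < r < 1]].
have S0 : S !=set0 by exists (Mq q 2^-1 (ps y)), 2^-1.
have supS : has_sup S.
  by split => //; exists A => _ [r r01 <-]; exact: yA.
pose L := sup S.
have yL r : 0 < r < 1 -> Mq q r (ps y) <= L.
  by move=> r01; apply: sup_upper_bound => //; exists r.
have L0 : 0 <= L by apply: le_trans (yL _ h01); exact: Mq_ge0.
have Lq0 : 0 <= L `^ q by exact: powR_ge0.
have Lq1 : 0 <= L `^ (q - 1) by exact: powR_ge0.
have eq0 : 0 < e `^ q by exact: powR_gt0.
pose e1 := e `^ q / (4 * (1 + L `^ q)).
have e10 : 0 < e1 by rewrite /e1 divr_gt0// mulr_gt0// ltr_pwDl.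
have [K K0 uc] := @uniform_convexity R q e1 q1 e10.
pose d := e `^ q / (4 * (1 + K * q * L `^ (q - 1))).
have KqL0 : 0 <= K * q * L `^ (q - 1) by rewrite mulr_ge0// mulr_ge0// ltW.
have d0 : 0 < d by rewrite /d divr_gt0// mulr_gt0// ltr_pwDl.
(* e1 and d are chosen so that each of the two error terms is at most half of e^q *)
have [r0 r001 yr0] : exists2 r, 0 < r < 1 & L - d < Mq q r (ps y).
  have [_ [r r01 <-] h] := sup_adherent d0 supS.
  by exists r.
have r00 : 0 <= r0 < 1 by case/andP: r001 => h1 ->; rewrite ltW.
have [s [s01 hs]] := coef_dilation_small ay r00 d0.
have /andP[s0 s1] := s01.
exists s; split=> //.
have h n : 0 <= 1 - s ^+ n <= 1.
  have s01' : 0 <= s <= 1 by rewrite !ltW.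
  have /andP[h1 _] := onem_exprn_le n s01'.
  by rewrite h1 lerBlDr lerDl exprn_ge0// ltW.
have aR (g : nat -> R) : (forall n, 0 <= g n <= 1) -> adm (fun n => (g n)%:C * y n).
  move=> g01; apply: (adm_mult (W := 1)) ay => n.
  by case/andP: (g01 n) => g0 g1; rewrite cabsR ger0_norm.
have aD := aR _ h.
have aS : adm (fun n => s%:C ^+ n * y n).
  apply: (adm_mult (W := 1)) ay => n.
  by rewrite cabsX cabsR ger0_norm ?(ltW s0)// exprn_ile1// ltW.
have aV : adm (fun n => ((1 + s ^+ n) / 2)%:C * y n).
  apply: aR => n; case/andP: (h n) => h1 h2.
  have : 0 <= s ^+ n by rewrite exprn_ge0// ltW.
  by move=> h3; apply/andP; split; lra.
have aW : adm (fun n => ((1 - s ^+ n) / 2)%:C * y n).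
  by apply: aR => n; case/andP: (h n) => h1 h2; apply/andP; split; lra.
have DE z : disc z -> ps (fun n => (1 - s ^+ n)%:C * y n) z =
    ps y z - ps (fun n => s%:C ^+ n * y n) z.
  move=> dz; rewrite -(psB ay aS dz); congr (ps _ z); apply/funext => n.
  by rewrite rmorphB rmorph1 rmorphXn/= mulrBl mul1r.
have VE z : disc z -> ps (fun n => ((1 + s ^+ n) / 2)%:C * y n) z =
    (2^-1)%:C * (ps y z + ps (fun n => s%:C ^+ n * y n) z).
  move=> dz; rewrite -(psD ay aS dz) -(psZ _ (admD ay aS) dz).
  congr (ps _ z); apply/funext => n.
  have -> : (1 + s ^+ n) / 2 = 2^-1 * (1 + s ^+ n) by rewrite mulrC.
  by rewrite rmorphM rmorphD rmorph1 rmorphXn/= -mulrA mulrDl mul1r.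
have yVW z : disc z -> ps y z = ps (fun n => ((1 + s ^+ n) / 2)%:C * y n) z +
    ps (fun n => ((1 - s ^+ n) / 2)%:C * y n) z.
  move=> dz; rewrite -(psD aV aW dz); congr (ps _ z); apply/funext => n.
  rewrite -mulrDl -rmorphD/= (_ : (1 + s ^+ n) / 2 + (1 - s ^+ n) / 2 = 1).
    by rewrite rmorph1 mul1r.
  by field.
have SL r : 0 < r < 1 -> Mq q r (ps (fun n => s%:C ^+ n * y n)) <= L.
  move=> r01; have s01' : 0 <= s < 1 by rewrite (ltW s0).
  have [_ hm] := multiplier_poisson q1' s01'.
  by have := hm y r ay r01; rewrite mul1r => /le_trans; apply; exact: yL.
(* circles beyond r0; the smaller ones follow by monotonicity of the means *)
have main r : 0 < r < 1 -> r0 <= r ->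
    Mq q r (ps (fun n => (1 - s ^+ n)%:C * y n)) <= e.
  move=> r01 r0r; have /andP[rp r1] := r01.
  have V0 : L - 2 * d <= Mq q r (ps (fun n => ((1 + s ^+ n) / 2)%:C * y n)).
    have r0r' : 0 < r0 <= r by rewrite r0r andbT; case/andP: r001.
    apply: le_trans (Mq_monotone q1' aV r0r' r1).
    have hD := MqD q1' (Hol_ps aV) (Hol_ps aW) r001.
    have hE := Mq_eq q r001 yVW.
    have {hE}hD := le_trans (eq_ler hE) hD.
    have hW : Mq q r0 (ps (fun n => ((1 - s ^+ n) / 2)%:C * y n)) <= d.
      apply: (Mq_sup q0 (Hol_ps aW) r001 (ltW d0)) => t; apply: hs.
      by rewrite cabs_circ//; case/andP: r00.
    exact: (sub_double_le hD hW yr0).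
  set V := Mq q r (ps (fun n => ((1 + s ^+ n) / 2)%:C * y n)) in V0.
  have VLq : L `^ q - 2 * d * q * L `^ (q - 1) <= V `^ q.
    have V00 : 0 <= V by exact: Mq_ge0.
    apply: le_trans (powR_tangent q1' L0 V00).
    have qL : 0 <= q * L `^ (q - 1) by rewrite mulr_ge0// ltW.
    have VL : - (2 * d) <= V - L by rewrite lerBrDl.
    have := ler_wpM2l qL VL.
    exact: tangent_lower_bound.
  have cD := rcont_circ q0 (Hol_ps aD) r01.
  have cY := rcont_circ q0 (Hol_ps ay) r01.
  have cS := rcont_circ q0 (Hol_ps aS) r01.
  have cV := rcont_circ q0 (Hol_ps aV) r01.
  have dr t : disc (circ r t) := disc_circ01 t r01.
  set a1 := fun t => cabs (ps (fun n => (1 - s ^+ n)%:C * y n) (circ r t)) `^ q in cD.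
  set a2 := fun t => cabs (ps y (circ r t)) `^ q in cY.
  set a3 := fun t => cabs (ps (fun n => s%:C ^+ n * y n) (circ r t)) `^ q in cS.
  set a4 := fun t => cabs (ps (fun n => ((1 + s ^+ n) / 2)%:C * y n) (circ r t)) `^ q in cV.
  have pt t : a1 t <= (e1 + K / 2) * (a2 t + a3 t) + - K * a4 t.
    have := uc (ps y (circ r t)) (ps (fun n => s%:C ^+ n * y n) (circ r t)).
    rewrite -(DE _ (dr t)) -(VE _ (dr t)).
    exact: defect_regroup.
  have c23 := rcontD cY cS.
  have I1 : rmean a1 <= (e1 + K / 2) * (rmean a2 + rmean a3) + - K * rmean a4.
    rewrite -(rmeanD cY cS) -(rmeanZ _ c23) -(rmeanZ _ cV) -rmeanD; last 2 first.
    - exact: rcontM (@rcont_cst R _) c23.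
    - exact: rcontM (@rcont_cst R _) cV.
    apply: le_rmean cD _ pt.
    exact: rcontD (rcontM (@rcont_cst R _) c23) (rcontM (@rcont_cst R _) cV).
  have p1 : rmean a1 = Mq q r (ps (fun n => (1 - s ^+ n)%:C * y n)) `^ q.
    exact: (esym (Mq_powR r _ q0)).
  have p2 : rmean a2 <= L `^ q.
    apply: (le_trans (y := Mq q r (ps y) `^ q)).
      by rewrite (Mq_powR r _ q0) lexx.
    apply: (@ge0_ler_powR R q (ltW q0) _ _ _ _ (yL r r01)).
      by rewrite nnegrE Mq_ge0.
    by rewrite nnegrE.
  have p3 : rmean a3 <= L `^ q.
    apply: (le_trans (y := Mq q r (ps (fun n => s%:C ^+ n * y n)) `^ q)).
      by rewrite (Mq_powR r _ q0) lexx.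
    apply: (@ge0_ler_powR R q (ltW q0) _ _ _ _ (SL r r01)).
      by rewrite nnegrE Mq_ge0.
    by rewrite nnegrE.
  have p4 : rmean a4 = V `^ q by exact: (esym (Mq_powR r _ q0)).
  have E1 : e1 * (L `^ q + L `^ q) <= e `^ q / 2.
    apply: weight_half_add (ltW e10); rewrite /e1 divfK// gt_eqF//.
    by rewrite mulr_gt0// ltr_pwDl.
  have E2 : K * (2 * d * q * L `^ (q - 1)) <= e `^ q / 2.
    have r4 (k d' q' b : R) : k * (2 * d' * q' * b) = 2 * d' * (k * q' * b) by ring.
    rewrite r4.
    apply: weight_half_mul (ltW d0); rewrite /d divfK// gt_eqF//.
    by rewrite mulr_gt0// ltr_pwDl.
  have F : Mq q r (ps (fun n => (1 - s ^+ n)%:C * y n)) `^ q <= e `^ q.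
    apply: (le_trans (eq_ler (esym p1))).
    have ek : 0 <= e1 + K / 2.
      by apply: addr_ge0; [exact: ltW|apply: divr_ge0 => //; exact: ltW].
    have h1 := ler_wpM2l ek (lerD p2 p3).
    have h2 := ler_wpM2l (ltW K0) (le_trans VLq (eq_ler (esym p4))).
    exact: (defect_combine I1 h1 h2 E1 E2).
  rewrite leNgt; apply/negP => he; move: F; rewrite leNgt => /negP; apply.
  have en : e \is Num.nneg by rewrite nnegrE ltW.
  have Mn : Mq q r (ps (fun n => (1 - s ^+ n)%:C * y n)) \is Num.nneg.
    by rewrite nnegrE; exact: Mq_ge0.
  exact: (@gt0_ltr_powR R q q0 _ _ en Mn he).
move=> r r01; have [r0r|/ltW rr0] := leP r0 r; first exact: main.
apply: le_trans (main r0 r001 (lexx _)).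
have /andP[rp r1] := r01; have /andP[r0p r0l] := r001.
have rr : 0 < r <= r0 by rewrite rp.
exact: (Mq_monotone q1' aD rr r0l).
Qed.

End Dilations.

(** * Hardy norms and coefficients *)

Lemma bernoulli_rearrange (R : realType) (X n k : R) :
  1 - X <= n * (1 - (1 - k)) -> 1 - n * k <= X.
Proof. by move=> h; lra. Qed.

Section HardySpace.
Context {R : realType}.
Local Notation C := (R[i]^o).
Implicit Types (x y l m : nat -> C) (f h : C -> C) (q p r s t : R) (z : C).

Lemma le_rmean_itv (u v : R -> R) : continuous u -> continuous v ->
  (forall t, 0 <= t <= 2 * pi -> u t <= v t) -> rmean u <= rmean v.
Proof.
move=> cu cv uv; rewrite ler_wpM2l ?invr_ge0 ?(ltW twopi_gt0)//.
have iu := integrable_I cu; have iv := integrable_I cv.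
by apply: le_Rintegral => // t /=; rewrite in_itv/=; exact: uv.
Qed.

Lemma hardy_norm_le q f (A : R) : 0 < q -> Hol f ->
  (forall r, 0 < r < 1 -> Mq q r f <= A) -> (hardy_norm q f <= A%:E)%E.
Proof.
move=> q0 hf hA; apply: ge_ereal_sup => _ [r r01 <-].
have r01' : 0 < r < 1 by rewrite -itv01.
by rewrite (circ_mean_Mq q0 hf r01') lee_fin hA.
Qed.

Lemma Mq_hardy q f r : 0 < q -> Hol f -> (hardy_norm q f < +oo)%E -> 0 < r < 1 ->
  Mq q r f <= fine (hardy_norm q f).
Proof.
move=> q0 hf fin r01.
have fn : hardy_norm q f \is a fin_num by rewrite ge0_fin_numE// hardy_norm_ge0.
rewrite -lee_fin (fineK fn) -(circ_mean_Mq q0 hf r01).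
by apply: ereal_sup_ubound; exists r => //; rewrite /= itv01.
Qed.

(** Division by z costs a factor 2 on circles of radius at least 1/2, and the means
    increase with the radius. *)
Lemma Mq_divz q x (A : R) : 1 <= q -> adm x ->
  (forall r, 0 < r < 1 -> Mq q r (fun z => z * ps x z) <= A) ->
  forall r, 0 < r < 1 -> Mq q r (ps x) <= 2 * A.
Proof.
move=> q1 ax hA r /andP[r0 r1]; have q0 : 0 < q by exact: lt_le_trans q1.
pose s := Num.max r 2^-1.
have s0 : 0 < s by rewrite lt_max r0.
have s1 : s < 1 by rewrite gt_max r1 invf_lt1// ltr1n.
have sh : 2^-1 <= s by rewrite le_max lexx orbT.
have rs : 0 < r <= s by rewrite r0 le_max lexx.
have s01 : 0 < s < 1 by rewrite s0.
apply: (le_trans (Mq_monotone q1 ax rs s1)).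
have hx := Hol_ps ax.
have hzx : Hol (fun z => z * ps x z).
  by move=> z dz; apply: derivableM; [exact: derivable_id|exact: hx].
have h2 : Hol (fun z => (2^-1)%:C * ps x z).
  by move=> z dz; apply: derivableM; [exact: derivable_cst|exact: hx].
have hle : Mq q s (fun z => (2^-1)%:C * ps x z) <= Mq q s (fun z => z * ps x z).
  apply: (Mq_le q0 h2 hzx s01) => t; rewrite !cabsM cabsR (cabs_circ _ (ltW s0)).
  by apply: ler_wpM2r; [exact: cabs_ge0|rewrite ger0_norm].
have h3 := le_trans hle (hA s s01).
have h4 := MqZ (2^-1)%:C q1 hx s01.
have h5 : 2^-1 * Mq q s (ps x) <= A.
  have -> : 2^-1 = cabs ((2^-1)%:C : C) by rewrite cabsR ger0_norm.
  by apply: le_trans h3; rewrite h4 lexx.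
by rewrite mulrC -ler_pdivrMr// mulrC.
Qed.

Lemma Mq_mulz q x r (A : R) : 1 <= q -> adm x -> 0 < r < 1 ->
  Mq q r (ps x) <= A -> Mq q r (fun z => z * ps x z) <= A.
Proof.
move=> q1 ax r01; have q0 : 0 < q by exact: lt_le_trans q1.
have hx := Hol_ps ax; have /andP[r0 r1] := r01.
have hzx : Hol (fun z => z * ps x z).
  by move=> z dz; apply: derivableM; [exact: derivable_id|exact: hx].
apply: le_trans; apply: (Mq_le q0 hzx hx r01) => t.
by rewrite cabsM (cabs_circ _ (ltW r0)) ler_piMl ?cabs_ge0// ltW.
Qed.

(** Coefficients of z times the derivative; the index is not shifted, so multipliers act
    on it directly. *)
Definition ncoef x n : C := n%:R * x n.

Lemma ps_ncoef x z : adm x -> disc z -> ps (ncoef x) z = z * ps (dcoef x) z.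
Proof.
move=> ax dz; rewrite (ps_recl (adm_nat ax) dz) /ncoef mul0r add0r.
by [].
Qed.

Lemma rmean_le_Mq p r f : 1 <= p -> Hol f -> 0 < r < 1 ->
  rmean (fun t => cabs (f (circ r t))) <= Mq p r f.
Proof.
move=> p1 hf r01; have p0 : 0 < p by exact: lt_le_trans p1.
have c1 : continuous ((fun=> 1) : R -> R) by exact: rcont_cst.
have r01' : r \in `]0, 1[%R by rewrite itv01.
have cf := continuous_on_circ hf r01'.
have f0 t : 0 <= cabs (f (circ r t)) by exact: cabs_ge0.
have m1 : rmean ((fun=> 1) : R -> R) <= 1 by rewrite rmean_cst.
have := @rmean_jensen R p 1 _ _ p1 ltr01 c1 cf (fun=> ler01) f0 m1.
rewrite powR1 mul1r.
rewrite (_ : (fun t => 1 * _) = fun t => cabs (f (circ r t))); last first.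
  by apply/funext => t; rewrite mul1r.
rewrite (_ : (fun t => 1 * _) = fun t => cabs (f (circ r t)) `^ p); last first.
  by apply/funext => t; rewrite mul1r.
set a := rmean _; set b := rmean _ => h.
have a0 : 0 <= a by exact: rmean_ge0.
have -> : a = (a `^ p) `^ p^-1 by rewrite -powRrM divff ?powRr1// gt_eqF.
apply: (@ge0_ler_powR R p^-1 _ _ _ _ _ h).
- by rewrite invr_ge0 ltW.
- by rewrite nnegrE powR_ge0.
- by rewrite nnegrE; apply: rmean_ge0 => t; exact: powR_ge0.
Qed.

(** From the bound B / r^n for the n-th coefficient by letting r tend to 1. *)
Lemma coef_le p x (B : R) n : 1 <= p -> adm x ->
  (forall r, 0 < r < 1 -> Mq p r (ps x) <= B) -> cabs (x n) <= B.
Proof.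
move=> p1 ax hB; apply/ler_addgt0Pr => e e0.
have c0 : 0 <= n%:R * cabs (x n) by rewrite mulr_ge0// cabs_ge0.
pose k : R := Num.min (2^-1) (e / (1 + n%:R * cabs (x n))).
have k0 : 0 < k by rewrite lt_min invr_gt0 ltr0n /= divr_gt0// ltr_pwDl.
have k1 : k <= 2^-1 by rewrite ge_min lexx.
have h2 : (2^-1 : R) < 1 by rewrite invf_lt1// ltr1n.
have kk : k < 1 by exact: le_lt_trans h2.
have s01 : 0 < 1 - k < 1 by rewrite subr_gt0 kk ltrBlDr ltrDl k0.
have s01' : 0 <= 1 - k <= 1 by case/andP: s01 => a b; rewrite !ltW.
have h := le_trans (ps_coef_le n ax s01) (le_trans (rmean_le_Mq p1 (Hol_ps ax) s01) (hB _ s01)).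
have /andP[_ g2] := onem_exprn_le n s01'.
have {}g2 : 1 - n%:R * k <= (1 - k) ^+ n.
  exact: bernoulli_rearrange g2.
have g3 := le_trans (ler_wpM2l (cabs_ge0 (x n)) g2) h.
have g4 : k * (n%:R * cabs (x n)) <= e.
  apply: (@le_trans _ _ (k * (1 + n%:R * cabs (x n)))).
    by rewrite ler_wpM2l ?(ltW k0)// lerDr.
  by rewrite -ler_pdivlMr ?ltr_pwDl// ge_min lexx orbT.
move: g3; rewrite mulrBr mulr1 lerBlDr => /le_trans; apply; rewrite lerD2l.
by rewrite mulrC -mulrA mulrCA.
Qed.

(** Both are Fourier sequences of the sawtooth, once multiplied by a character; their
    L^1 norm is at most pi. *)
Lemma multiplier_harmonic q : 1 <= q ->
  multiplier q pi (fun n => (n.+1%:R)^-1 : C) /\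
  multiplier q pi (fun n => if n == 0 then 0 else n%:R^-1 : C).
Proof.
move=> q1.
have cs := @continuous_saw R.
have cE1 : continuous (fun t => E t : C) by exact: continuous_E.
have csE := ccontM cs cE1.
have sawn n : (0 < n)%N -> cmean (fun t => saw t * E t ^+ n) = (n%:R)^-1 :> C.
  move=> n0; have -> : (fun t => saw t * E t ^+ n : C) = fun t => saw t * E (n%:R * t).
    by apply/funext => t; rewrite E_exp.
  rewrite cmean_saw ?E_n2pi ?pnatr_eq0 -?lt0n//.
  by rewrite fmorphV/= rmorph_nat.
have le_pi (w : R -> C) : continuous w -> (forall t, cabs (w t) = cabs (saw t)) ->
    rmean (fun t => cabs (w t)) <= pi.
  move=> cw ws; rewrite -[leRHS](@rmean_cst R).
  apply: le_rmean_itv; [exact: ccont_cabs|exact: rcont_cst|].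
  by move=> t tI; rewrite ws; exact: cabs_saw.
split.
  rewrite (_ : (fun n => _) = fcoef (fun t => saw t * E t)); last first.
    apply/funext => n; rewrite -sawn//; apply: eq_cmean => t _.
    by rewrite exprS mulrA.
  apply: (multiplier_fcoef q1 (pi_gt0 R) csE); apply: le_pi => // t.
  by rewrite cabsM cabs_E mulr1.
rewrite (_ : (fun n => _) = fcoef saw); last first.
  apply/funext => n; case: n => [|n] /=.
    rewrite -[LHS](@cmean_saw0 R); apply: eq_cmean => t _.
    by rewrite expr0 mulr1.
  by rewrite -sawn.
by apply: (multiplier_fcoef q1 (pi_gt0 R) cs); exact: le_pi.
Qed.

End HardySpace.

(** * Moment sequences as multipliers *)

(** Abel summation is uniform over the sequences with a common summable majorant: one s
    serves for all of them. *)
Lemma near_one_abel (R : realType) (b : nat -> R) (e : R) :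
  (forall n, 0 <= b n) -> cvgn (series b) -> 0 < e ->
  exists s, 0 < s < 1 /\ forall c : nat -> R[i]^o, (forall n, cabs (c n) <= b n) ->
    cabs (csum (fun n => (1 - s ^+ n)%:C * c n)) <= e.
Proof.
move=> b0 cb e0; have e2 : 0 < e / 2 by rewrite divr_gt0.
have [N hN] : exists N, tail b N <= e / 2.
  have /cvgrPdist_lt/(_ _ e2) h := cvg_tail cb.
  have /filter_ex[N hN] := h; exists N.
  by rewrite ltW// (le_lt_trans (ler_norm _))// -normrN -sub0r.
pose Q := \sum_(0 <= n < N) n%:R * b n.
have Q0 : 0 <= Q by apply: sumr_ge0 => n _; rewrite mulr_ge0.
pose k : R := Num.min (2^-1) (e / 2 / (1 + Q)).
have Q1 : 0 < 1 + Q by rewrite ltr_pwDl.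
have k0 : 0 < k by rewrite lt_min invr_gt0 ltr0n /= divr_gt0.
have k1 : k <= 2^-1 by rewrite ge_min lexx.
have h2 : (2^-1 : R) < 1 by rewrite invf_lt1// ltr1n.
have kk : k < 1 by exact: le_lt_trans h2.
have s01 : 0 < 1 - k < 1 by rewrite subr_gt0 kk ltrBlDr ltrDl k0.
have s01' : 0 <= 1 - k <= 1 by case/andP: s01 => a1 a2; rewrite !ltW.
exists (1 - k); split=> // c hc.
have hs n : 0 <= 1 - (1 - k) ^+ n <= 1.
  have /andP[h _] := onem_exprn_le n s01'.
  by rewrite h lerBlDr lerDl exprn_ge0//; case/andP: s01'.
have hcs n : cabs ((1 - (1 - k) ^+ n)%:C * c n) <= b n.
  case/andP: (hs n) => g0 g1; rewrite cabsM cabsR ger0_norm//.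
  by apply: le_trans (hc n); rewrite ler_piMl// cabs_ge0.
have t1 := csum_tail N hcs cb.
set S := series _ N in t1.
have t2 : cabs S <= e / 2.
  apply: (le_trans (cabs_sum _ _ _)).
  apply: (@le_trans _ _ (\sum_(0 <= n < N) k * (n%:R * b n))).
    apply: ler_sum => n _; have /andP[g0 g1] := onem_exprn_le n s01'.
    rewrite cabsM cabsR ger0_norm//.
    have kE : 1 - (1 - k) = k by rewrite opprB addrCA subrr addr0.
    rewrite kE in g1.
    apply: (le_trans (ler_pM g0 (cabs_ge0 _) g1 (hc n))).
    by rewrite mulrAC mulrC lexx.
  rewrite -mulr_sumr -/Q; apply: (@le_trans _ _ (k * (1 + Q))).
    by rewrite ler_wpM2l ?(ltW k0)// lerDr.
  by rewrite -ler_pdivlMr// ge_min lexx orbT.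
have -> : e = e / 2 + e / 2 by field.
rewrite -(subrK S (csum _)); apply: (le_trans (cabsD _ _)).
exact: lerD (le_trans t1 hN) t2.
Qed.

Section MomentMultiplier.
Context {R : realType}.
Local Notation C := (R[i]^o).
Implicit Types (a b x y l m : nat -> C) (f h : C -> C) (q p r s t : R) (z : C).

Lemma cvg_telescope (D : R) : 0 <= D ->
  cvgn (series (fun j : nat => D * (j.+1%:R^-1 - j.+2%:R^-1))).
Proof.
move=> D0; apply: is_cvg_rseriesZ.
apply: nondecreasing_is_cvgn.
  apply: nondecreasing_series => j _ _.
  by rewrite subr_ge0 lef_pV2 ?posrE// ler_nat.
exists 1 => _ [N _ <-].
suff -> : series (fun j : nat => j.+1%:R^-1 - j.+2%:R^-1 : R) N = 1 - N.+1%:R^-1.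
  by rewrite gerBl invr_ge0.
elim: N => [|N IH]; first by rewrite seriesEnat/= big_geq// invr1 subrr.
by rewrite seriesSr IH addrA subrK.
Qed.

(** For f with Taylor coefficients a, the number (n + 1) times the integral of t^n f(t)
    over [0, 1]; the factor makes the moments of the constant 1 equal to 1. *)
Definition moment a n : C := n.+1%:R * csum (fun k => a k / (n + k + 1)%:R).

(** The kernel that expresses the moments through the derivative. *)
Definition mker (n j : nat) : C := n.+1%:R / (j.+1%:R * (n + j).+2%:R).

Lemma mkerE n j : mker n j = j.+1%:R^-1 - (n + j).+2%:R^-1.
Proof.
rewrite /mker; have h1 : (j.+1%:R : C) != 0 by rewrite pnatr_eq0.
have h2 : ((n + j).+2%:R : C) != 0 by rewrite pnatr_eq0.
have -> : (n.+1%:R : C) = (n + j).+2%:R - j.+1%:R.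
  by rewrite -natrB ?ltnS ?leqW ?leq_addl// subSS -addSn addnK.
move: (j.+1%:R : C) ((n + j).+2%:R : C) h1 h2 => u v h1 h2.
by field; rewrite h1 h2.
Qed.

Lemma cabs_mker n j : cabs (mker n j) <= n.+1%:R * (j.+1%:R^-1 - j.+2%:R^-1).
Proof.
rewrite /mker cabsM cabsV cabsM !cabs_nat; apply: ler_wpM2l => //.
have -> : (j.+1%:R^-1 - j.+2%:R^-1 : R) = (j.+1%:R * j.+2%:R)^-1.
  have h1 : (j.+1%:R : R) != 0 by rewrite pnatr_eq0.
  have h2 : (j.+2%:R : R) != 0 by rewrite pnatr_eq0.
  have h3 : (j.+2%:R : R) = j.+1%:R + 1 by rewrite natr1.
  rewrite h3 in h2 *; move: (j.+1%:R : R) h1 h2 => u h1 h2.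
  by field; rewrite h1 h2.
by rewrite lef_pV2 ?posrE ?mulr_gt0// ler_wpM2l// ler_nat !ltnS leq_addl.
Qed.

Lemma moment_dom (B : R) a n j : (forall j, cabs (dcoef a j) <= B) ->
  cabs (dcoef a j * mker n j) <= B * n.+1%:R * (j.+1%:R^-1 - j.+2%:R^-1).
Proof.
by move=> hB; rewrite cabsM -mulrA; apply: ler_pM; rewrite ?cabs_ge0//; exact: cabs_mker.
Qed.

(** Integration by parts replaces the coefficients of f by those of f', which are bounded,
    and the kernel is summable; this also proves that the series of the moment
    converges. *)
Lemma moment_series (B : R) a n : (forall j, cabs (dcoef a j) <= B) ->
  series (fun k => a k / (n + k + 1)%:R) @ \oo -->
    (n.+1%:R)^-1 * (a 0%N + csum (fun j => dcoef a j * mker n j)).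
Proof.
move=> hB; have B0 : 0 <= B by apply: le_trans (hB 0%N); exact: cabs_ge0.
have Bn : 0 <= B * n.+1%:R by rewrite mulr_ge0.
have h := csum_cvg (fun j => moment_dom n j hB) (cvg_telescope Bn).
have h' := cvg_csumZ (a := (n.+1%:R)^-1) h.
rewrite mulrDr [_^-1 * a 0%N]mulrC.
have := @cvg_series_recl _ (fun k => a k / (n + k + 1)%:R)
  ((n.+1%:R)^-1 * csum (fun j => dcoef a j * mker n j)).
rewrite addn0 addn1; apply.
rewrite (_ : (fun k => a k.+1 / (n + k.+1 + 1)%:R) =
   fun j => (n.+1%:R)^-1 * (dcoef a j * mker n j)); first exact: h'.
apply/funext => j; rewrite /dcoef /mker.
have h1 : (n.+1%:R : C) != 0 by rewrite pnatr_eq0.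
have h2 : (j.+1%:R : C) != 0 by rewrite pnatr_eq0.
have -> : (n + j.+1 + 1)%N = (n + j).+2 by rewrite addn1 addnS.
have h3 : ((n + j).+2%:R : C) != 0 by rewrite pnatr_eq0.
move: (n.+1%:R : C) (j.+1%:R : C) ((n + j).+2%:R : C) h1 h2 h3 => u v w h1 h2 h3.
by field; rewrite h1 h2 h3.
Qed.

Lemma momentE (B : R) a n : (forall j, cabs (dcoef a j) <= B) ->
  moment a n = a 0%N + csum (fun j => dcoef a j * mker n j).
Proof.
by move=> hB; rewrite /moment (cvg_csum (@moment_series B a n hB)) mulrA divff ?mul1r//.
Qed.

(** By [momentE] and [mkerE] the moments are a constant plus the Fourier coefficients of
    the sawtooth times f', as sum_j b_j / (j+1) and sum_j b_j / (n+j+2) are means of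
    f' against the sawtooth.  On the circle of radius s < 1 this is an exact identity
    with b_j s^j for b_j, and the limit s -> 1 is taken in [multiplier_closed]. *)
Lemma moment_multiplier q p a (B : R) : 1 <= q -> 1 <= p -> adm a -> 0 <= B ->
  (forall r, 0 < r < 1 -> Mq p r (ps (dcoef a)) <= B) ->
  multiplier q (cabs (a 0%N) + 2 * (pi * B + 1)) (moment a).
Proof.
move=> q1 p1 aa B0 hB; have ad := adm_dcoef aa.
have bB j : cabs (dcoef a j) <= B by exact: coef_le p1 ad hB.
(* one more than the L^1 bound pi * B, to have a positive constant *)
have [W WE] : exists W, W = pi * B + 1 by exists (pi * B + 1).
rewrite -WE; have W0 : 0 < W by rewrite WE ltr_wpDl// mulr_ge0// pi_ge0.
have cs := @continuous_saw R; have cE := @continuous_E R.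
have csE := ccontM cs cE; have csEE := ccontM csE cE.
have cps s : 0 < s < 1 -> continuous (fun t => ps (dcoef a) (circ s t)).
  move=> s01 t; exact: (continuous_comp (@continuous_circ R s t)
    (Hol_continuous (Hol_ps ad) (disc_circ01 t s01))).
have wW s (w : R -> C) : 0 < s < 1 -> continuous w ->
    (forall t, cabs (w t) = cabs (saw t)) ->
    rmean (fun t => cabs (w t * ps (dcoef a) (circ s t))) <= W.
  move=> s01 cw hw.
  have cps' := cps s s01; have cap := ccont_cabs cps'.
  apply: (@le_trans _ _ (pi * rmean (fun t => cabs (ps (dcoef a) (circ s t))))).
    rewrite -(rmeanZ _ cap); apply: le_rmean_itv.
    - exact: (ccont_cabs (ccontM cw cps')).
    - exact: rcontM (@rcont_cst R _) cap.
    move=> t tI; rewrite cabsM hw; apply: ler_wpM2r; first exact: cabs_ge0.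
    exact: cabs_saw.
  apply: (@le_trans _ _ (pi * B)); last by rewrite WE lerDl.
  apply: ler_wpM2l; first exact: pi_ge0.
  exact: le_trans (rmean_le_Mq p1 (Hol_ps ad) s01) (hB s s01).
apply: multiplier_closed => // N d d0.
pose b j : R := B * N.+1%:R * (j.+1%:R^-1 - j.+2%:R^-1).
have b0 j : 0 <= b j.
  by rewrite /b mulr_ge0 ?mulr_ge0// subr_ge0 lef_pV2 ?posrE// ler_nat.
have cb : cvgn (series b) by apply: cvg_telescope; rewrite mulr_ge0.
have [s [s01 hs]] := near_one_abel b0 cb d0.
have /andP[s0 s1] := s01.
have ds : disc (s%:C : C) by apply/discE; rewrite cabsR ger0_norm ?(ltW s0).
pose w1 t : C := saw t * E t * ps (dcoef a) (circ s t).
pose w2 t : C := saw t * E t * E t * ps (dcoef a) (circ s t).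
have cw1 : continuous w1 := ccontM csE (cps s s01).
have cw2 : continuous w2 := ccontM csEE (cps s s01).
have hw1 : rmean (fun t => cabs (w1 t)) <= W.
  by apply: wW s01 csE _ => t; rewrite cabsM cabs_E mulr1.
have hw2 : rmean (fun t => cabs (w2 t)) <= W.
  by apply: wW s01 csEE _ => t; rewrite !cabsM cabs_E !mulr1.
have m2 := multiplier_fcoef q1 W0 cw2 hw2.
have m1 : multiplier q (cabs (a 0%N + cmean w1)) (fun=> a 0%N + cmean w1).
  exact: multiplier_cst.
have m := multiplierD q1 m1 (multiplierZ (-1) q1 m2).
exists (fun n => a 0%N + cmean w1 + -1 * fcoef w2 n).
  apply: multiplier_le m.
  have -> : 2 * W = W + W by rewrite mulr_natl mulr2n.
  rewrite cabsN cabs1 mul1r addrA; apply: lerD => //.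
  apply: (le_trans (cabsD _ _)); apply: lerD => //.
  exact: le_trans (cabs_cmean cw1) hw1.
move=> n nN.
have sawn k : (0 < k)%N -> cmean (fun t => saw t * E t ^+ k) = (k%:R)^-1 :> C.
  move=> k0; have -> : (fun t => saw t * E t ^+ k : C) = fun t => saw t * E (k%:R * t).
    by apply/funext => t; rewrite E_exp.
  rewrite cmean_saw ?E_n2pi ?pnatr_eq0 -?lt0n//.
  by rewrite fmorphV/= rmorph_nat.
have cEn k : continuous (fun t => E t ^+ k : C).
  rewrite (_ : (fun t => _) = fun t => E (k%:R * t)); first exact: continuous_Ec.
  by apply/funext => t; rewrite E_exp.
have cpsE k : cmean (fun t => saw t * E t ^+ k.+1 * ps (dcoef a) (circ s t)) =
    csum (fun j => ((k + j).+1%:R)^-1 * dcoef a j * s%:C ^+ j).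
  have [h _] := cmean_ps (ccontM cs (cEn k.+1)) cE (@cabs_E R) ad ds.
  have e1 : cmean (fun t => saw t * E t ^+ k.+1 * ps (dcoef a) (circ s t)) =
      cmean (fun t => saw t * E t ^+ k.+1 * ps (dcoef a) (s%:C * E t)).
    by apply: eq_cmean => t _; rewrite circ_E.
  apply: (etrans e1); apply: (etrans h); congr csum; apply/funext => j.
  have e2 : cmean (fun t => saw t * E t ^+ k.+1 * E t ^+ j) = ((k + j).+1%:R)^-1 :> C.
    apply: etrans (sawn (k + j).+1 isT); apply: eq_cmean => t _.
    by rewrite -mulrA -exprD addSn.
  by rewrite e2.
have w1E : cmean w1 = csum (fun j => (j.+1%:R)^-1 * dcoef a j * s%:C ^+ j).
  by rewrite -(cpsE 0); apply: eq_cmean => t _; rewrite expr1.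
have w2E : fcoef w2 n = csum (fun j => ((n.+1 + j).+1%:R)^-1 * dcoef a j * s%:C ^+ j).
  rewrite -(cpsE n.+1); apply: eq_cmean => t _.
  by rewrite /w2 !exprS; ring.
have cv k : cvgn (series (fun j => ((k + j).+1%:R)^-1 * dcoef a j * s%:C ^+ j)).
  have al : adm (fun j => ((k + j).+1%:R)^-1 * dcoef a j).
    apply: (@adm_mult _ 1 (fun j => ((k + j).+1%:R)^-1)) ad => j.
    by rewrite cabsV cabs_nat invf_le1// ler1n.
  exact: (cvgP _ (ps_cvg al ds)).
have c3 := is_cvg_csumZ (a := -1) (cv n.+1).
have cv0 := cv 0%N.
have e12 : cmean w1 + -1 * fcoef w2 n =
    csum (fun j => (s ^+ j)%:C * (dcoef a j * mker n j)).
  rewrite w1E w2E -(csumZ _ (cv n.+1)) -(csumD cv0 c3); congr csum.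
  apply/funext => j; rewrite mkerE rmorphXn/= addSn.
  by move: (_^-1) (_^-1) (dcoef a j) (s%:C ^+ j) => u v x y; ring.
have bn j : cabs (dcoef a j * mker n j) <= b j.
  apply: (le_trans (moment_dom n j bB)); rewrite /b.
  have h0 : 0 <= j.+1%:R^-1 - j.+2%:R^-1 :> R.
    by rewrite subr_ge0 lef_pV2 ?posrE// ler_nat.
  apply: ler_wpM2r => //; apply: ler_wpM2l => //.
  by rewrite ler_nat ltnW// ltnS.
have sn0 j : 0 <= s ^+ j <= 1.
  by rewrite exprn_ge0 ?(ltW s0)// exprn_ile1 ?(ltW s0)// ltW.
have bs j : cabs (-1 * ((s ^+ j)%:C * (dcoef a j * mker n j))) <= b j.
  apply: le_trans (bn j); case/andP: (sn0 j) => g0 g1.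
  rewrite mulN1r cabsN [cabs ((s ^+ j)%:C * _)]cabsM cabsR ger0_norm//.
  by rewrite ler_piMl// cabs_ge0.
have cc1 := csum_cvg bn cb; have cc2 := csum_cvg bs cb.
have bs' j : cabs ((s ^+ j)%:C * (dcoef a j * mker n j)) <= b j.
  by have := bs j; rewrite mulN1r cabsN.
have cc3 := csum_cvg bs' cb.
have -> : moment a n - (a 0%N + cmean w1 + -1 * fcoef w2 n) =
    csum (fun j => (1 - s ^+ j)%:C * (dcoef a j * mker n j)).
  rewrite (momentE n bB) -(addrA (a 0%N) (cmean w1)) e12 opprD addrACA subrr add0r.
  rewrite -mulN1r -(csumZ _ cc3) -(csumD cc1 cc2); congr csum.
  by apply/funext => j; rewrite rmorphB rmorph1 mulrBl mul1r mulN1r.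
exact: hs bn.
Qed.

End MomentMultiplier.

(** * Realising power series in S *)

Section Realisation.
Context {R : realType}.
Local Notation C := (R[i]^o).
Implicit Types (a b x y l m : nat -> C) (f h : C -> C) (q p r s t : R) (z : C).

(** Convergence at r makes the terms bounded: beyond N two consecutive partial sums are
    within 1 of the limit, whence the constant 2. *)
Lemma adm_cvg x (G : C -> C) : (forall z, disc z ->
  series (fun n => x n * z ^+ n) @ \oo --> G z) -> adm x.
Proof.
move=> hx r /andP[r0 r1].
have dr : disc (r%:C : C) by apply/discE; rewrite cabsR ger0_norm// ltW.
have /cvgCP/(_ _ ltr01) [N _ hN] := hx _ dr.
have s0 : 0 <= \sum_(0 <= n < N) cabs (x n) * r ^+ n.
  by apply: sumr_ge0 => n _; rewrite mulr_ge0 ?cabs_ge0// exprn_ge0// ltW.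
exists (2 + \sum_(0 <= n < N) cabs (x n) * r ^+ n) => n.
have xE : cabs (x n) * r ^+ n = cabs (x n * r%:C ^+ n).
  by rewrite cabsM cabsX cabsR ger0_norm// ltW.
have [nN|Nn] := ltnP n N.
  apply: (@le_trans _ _ (\sum_(0 <= n < N) cabs (x n) * r ^+ n)); last by rewrite lerDr.
  rewrite (bigD1_seq n) ?mem_index_iota ?iota_uniq//= lerDl.
  by apply: sumr_ge0 => k _; rewrite mulr_ge0 ?cabs_ge0// exprn_ge0// ltW.
rewrite xE; apply: (@le_trans _ _ 2); last by rewrite lerDl.
have h1 := hN n Nn; have h2 := hN n.+1 (leqW Nn).
set u := series _ in h1 h2.
have -> : x n * r%:C ^+ n = (u n.+1 - G r%:C) + (G r%:C - u n).
  by rewrite addrA subrK /u seriesSr addrAC subrr add0r.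
apply: (le_trans (cabsD _ _)); rewrite [cabs (_ - u n)]cabsBC.
by apply: ltW; rewrite -[2]/(1 + 1); exact: ltrD.
Qed.

Lemma S_expansion p (hp : 1 <= p) (F : Sspace hp) :
  adm (taylor F) /\ forall z, disc z -> F z = ps (taylor F) z.
Proof. by have [[hF [hF' _]] _] := SspaceP F; exact: Hol_expansion. Qed.

Lemma derive1_ps f x : adm x -> (forall z, disc z -> f z = ps x z) ->
  forall z, disc z -> derive1 f z = ps (dcoef x) z.
Proof.
by move=> ax fx z dz; rewrite (derive1_eq fx dz); have [] := ps_derive ax dz.
Qed.

Lemma S_Mq p (hp : 1 <= p) (F : Sspace hp) r : 0 < r < 1 ->
  Mq p r (ps (dcoef (taylor F))) <= fine (hardy_norm p (derive1 F)).
Proof.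
move=> r01; have [aF FE] := S_expansion F.
have [[hF [hF' nF]] _] := SspaceP F; have p0 : 0 < p := lt_le_trans ltr01 hp.
have h := Mq_hardy p0 hF' nF r01.
by apply: le_trans h; apply: eq_ler; apply: (Mq_eq _ r01) => z dz;
  rewrite (derive1_ps aF FE dz).
Qed.

Lemma S_ext q (hq : 1 <= q) (F G : Sspace hq) :
  (forall z, disc z -> F z = G z) -> F = G.
Proof.
move=> FG; apply/val_inj/funext => z /=.
have [_ F0] := SspaceP F; have [_ G0] := SspaceP G.
have [dz|dz] := pselect (disc z); first exact: FG.
by rewrite F0// G0.
Qed.

Lemma hardy_dcoef q x (A : R) : 1 <= q -> adm x ->
  (forall r, 0 < r < 1 -> Mq q r (ps (ncoef x)) <= A) ->
  (hardy_norm q (ps (dcoef x)) <= (2 * A)%:E)%E.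
Proof.
move=> q1 ax hA; have q0 : 0 < q by exact: lt_le_trans q1.
have ad := adm_dcoef ax.
apply: (hardy_norm_le q0 (Hol_ps ad)); apply: (Mq_divz q1 ad) => r r01.
apply: le_trans (hA r r01); apply: eq_ler; apply: (Mq_eq _ r01) => z dz.
by rewrite (ps_ncoef ax dz).
Qed.

(** The series is cut off outside the disc, as elements of the space vanish there. *)
Lemma S_exists q (hq : 1 <= q) x (A : R) : adm x ->
  (forall r, 0 < r < 1 -> Mq q r (ps (ncoef x)) <= A) ->
  exists F : Sspace hq, forall z, disc z -> F z = ps x z.
Proof.
move=> ax hA.
pose F : C -> C := fun z => if pselect (disc z) then ps x z else 0.
have FE z : disc z -> ps x z = F z.
  by move=> dz; rewrite /F; case: pselect.
have FE' z : disc z -> F z = ps x z by move=> /FE ->.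
have dFE z : disc z -> ps (dcoef x) z = derive1 F z.
  by move=> dz; rewrite (derive1_ps ax FE' dz).
have SF : F \in S_pred hq.
  apply/S_predP; split; last by move=> z dz; rewrite /F; case: pselect.
  split; first exact: Hol_eq FE (Hol_ps ax).
  split; first exact: Hol_eq dFE (Hol_ps (adm_dcoef ax)).
  rewrite -(hardy_norm_eq q dFE); apply: (le_lt_trans (hardy_dcoef hq ax hA)).
  exact: ltry.
exists (MkS SF); exact: FE'.
Qed.

Lemma S_norm_le q (hq : 1 <= q) (F : Sspace hq) x (A : R) : adm x ->
  (forall z, disc z -> F z = ps x z) ->
  (forall r, 0 < r < 1 -> Mq q r (ps (ncoef x)) <= A) ->
  S_norm q F <= cabs (x 0%N) + 2 * A.
Proof.
move=> ax FE hA; rewrite /S_norm (FE 0 (@disc0 R)) ps0; apply: lerD => //.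
have dFE z : disc z -> ps (dcoef x) z = derive1 F z.
  by move=> dz; rewrite (derive1_ps ax FE dz).
have h := hardy_dcoef hq ax hA; rewrite (hardy_norm_eq q dFE) in h.
have fn := hardy_norm_fin F.
by rewrite -lee_fin fineK.
Qed.

End Realisation.

(** * The symbol and its multiplier transforms *)

Section Symbol.
Context {R : realType} (q : R) (hq : 1 < q).
Local Notation C := (R[i]^o).
Variables (g : C -> C) (eta : nat -> C).
Hypothesis heta : forall z : C, disc z ->
  series (fun n : nat => eta n * z ^+ n : C) @ \oo --> g z.

Let aeta : adm eta. Proof. exact: adm_cvg heta. Qed.

Let gE z : disc z -> g z = ps eta z.
Proof. by move=> dz; have h := cvg_csum (heta dz); exact: (esym h). Qed.

(** Coefficients of z h', for h = (g - g(0))/z. *)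
Definition ycoef (eta : nat -> C) n : C := n%:R * eta n.+1.

Lemma adm_ycoef : adm (ycoef eta).
Proof. exact: adm_nat (adm_shift aeta). Qed.

(** The coefficients of g' are those of z h' multiplied by 1 + 1/n, and conversely
    the latter are those of g' multiplied by 1 - 1/(n+1); both sequences are
    multipliers by [multiplier_harmonic].  The first one misses the constant
    coefficient, which is corrected separately. *)
Lemma symbol_S_iff : inS q g <->
  exists A, forall r, 0 < r < 1 -> Mq q r (ps (ycoef eta)) <= A.
Proof.
have q1 := ltW hq; have q0 : 0 < q by exact: lt_le_trans q1.
have ad := adm_dcoef aeta; have ay := adm_ycoef.
have dgE z : disc z -> derive1 g z = ps (dcoef eta) z.
  by move=> dz; exact: (derive1_ps aeta (fun w dw => gE dw) dz).
have dgE' z : disc z -> ps (dcoef eta) z = derive1 g z by move=> /dgE ->.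
have [mh1 mh2] := @multiplier_harmonic R q q1.
have m1 := @multiplier_cst R q 1 q1.
split=> [[hg [hg' ng]]|[A hA]].
  have m := multiplierD q1 m1 (multiplierZ (-1) q1 mh1).
  exists ((cabs 1 + cabs (-1) * pi) * fine (hardy_norm q (derive1 g))) => r r01.
  have [mb mm] := m.
  have -> : ycoef eta = fun n => (1 + -1 * n.+1%:R^-1) * dcoef eta n.
    apply/funext => n; rewrite /ycoef /dcoef mulrA; congr (_ * _).
    rewrite mulrDl mul1r mulN1r mulNr mulVf ?pnatr_eq0//.
    by rewrite -[in RHS]natr1 addrK.
  apply: (le_trans (mm _ r ad r01)); apply: ler_wpM2l.
    by apply: le_trans (mb 0%N); exact: cabs_ge0.
  apply: le_trans (Mq_hardy q0 hg' ng r01); apply: eq_ler.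
  exact: (Mq_eq q r01 dgE').
have hgg : Hol g by apply: (Hol_eq _ (Hol_ps aeta)) => z /gE ->.
split; first exact: hgg.
split; first exact: Hol_eq dgE' (Hol_ps ad).
rewrite -(hardy_norm_eq q dgE').
pose l n : C := 1 + (if n == 0 then 0 else n%:R^-1).
have m : multiplier q (cabs (1 : C) + pi) l := multiplierD q1 m1 mh2.
have [mb mm] := m.
have al := adm_mult mb ay.
have l0 : 0 <= cabs (1 : C) + pi by rewrite addr_ge0 ?cabs_ge0 ?pi_ge0.
have E z : disc z -> ps (dcoef eta) z = ps (fun n => l n * ycoef eta n) z + eta 1%N.
  move=> dz; rewrite (ps_recl ad dz) (ps_recl al dz) /ycoef mul0r mulr0 add0r.
  rewrite addrC /dcoef mul1r; congr (_ + _); congr (_ * ps _ z).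
  apply/funext => n; rewrite /l /= -(natr1 n.+1).
  have u0 : (n.+1%:R : C) != 0 by rewrite pnatr_eq0.
  by move: (n.+1%:R : C) (eta n.+2) u0 => u v u0; field.
have : (hardy_norm q (ps (dcoef eta)) <= ((cabs (1 : C) + pi) * A + cabs (eta 1%N))%:E)%E.
  apply: (hardy_norm_le q0 (Hol_ps ad)) => r r01.
  have hD := MqD q1 (Hol_ps al) (@Hol_cst R (eta 1%N)) r01.
  apply: (le_trans (eq_ler (Mq_eq q r01 E))); apply: (le_trans hD).
  rewrite (Mq_cst r _ q0) lerD2r; apply: (le_trans (mm _ r ay r01)).
  by apply: ler_wpM2l l0 _ _ (hA r r01).
by move/le_lt_trans; apply; exact: ltry.
Qed.

Section Synthesis.
Variable A : R.
Hypothesis hA : forall r, 0 < r < 1 -> Mq q r (ps (ycoef eta)) <= A.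

Let A0 : 0 <= A.
Proof.
have h : 0 < (2^-1 : R) < 1 by rewrite invr_gt0 ltr0n invf_lt1// ltr1n.
exact: le_trans (Mq_ge0 _ _ _) (hA h).
Qed.

Lemma ncoef_symbol (l : nat -> C) :
  ncoef (fun n => l n * eta n.+1) = fun n => l n * ycoef eta n.
Proof. by apply/funext => n; rewrite /ncoef /ycoef mulrCA. Qed.

Lemma synthesis_exists (W : R) (l : nat -> C) : multiplier q W l ->
  exists F : Sspace (ltW hq), forall z, disc z ->
    F z = ps (fun n => l n * eta n.+1) z.
Proof.
move=> [lW hl].
apply: (@S_exists R q (ltW hq) (fun n => l n * eta n.+1) (W * A)).
  exact: adm_mult lW (adm_shift aeta).
move=> r r01; rewrite ncoef_symbol; apply: (le_trans (hl _ r adm_ycoef r01)).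
apply: ler_wpM2l; last exact: hA.
by apply: le_trans (lW 0%N); exact: cabs_ge0.
Qed.

(** The element of S^q with coefficients l_n eta_(n+1), chosen by description; it is 0
    if there is none. *)
Definition synthesis (l : nat -> C) : Sspace (ltW hq) :=
  if pselect (exists F : Sspace (ltW hq), forall z, disc z ->
    F z = ps (fun n => l n * eta n.+1) z) is left h then sval (cid h) else 0.

Lemma synthesisE (W : R) (l : nat -> C) z : multiplier q W l -> disc z ->
  synthesis l z = ps (fun n => l n * eta n.+1) z.
Proof.
move=> /synthesis_exists hl dz; rewrite /synthesis; case: pselect => // h.
by case: (cid h) => F /= ->.
Qed.

Lemma synthesis_bound (W : R) (l : nat -> C) : multiplier q W l ->
  S_norm q (synthesis l) <= W * cabs (eta 1%N) + 2 * (W * A).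
Proof.
move=> hl; have [lW hm] := hl.
have W0 : 0 <= W by apply: le_trans (lW 0%N); exact: cabs_ge0.
have ax := adm_mult lW (adm_shift aeta).
apply: (le_trans (@S_norm_le R q (ltW hq) (synthesis l) _ (W * A) ax _ _)).
- by move=> z dz; exact: (synthesisE hl dz).
- move=> r r01; rewrite ncoef_symbol; apply: (le_trans (hm _ r adm_ycoef r01)).
  by apply: ler_wpM2l => //; exact: hA.
by rewrite lerD2r cabsM; apply: ler_wpM2r; [exact: cabs_ge0|exact: lW].
Qed.

(** Split Y into Y - Y_s and Y_s.  On the first part the difference of the multipliers
    acts with norm at most 2 W and Y - Y_s is small by [dilation_cvg].  On the second,
    the series is evaluated in the disc of radius s only, where [coef_small] applies. *)
Lemma synthesis_continuous (W e : R) : 0 < e ->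
  exists (N : nat) (d : R), 0 < d /\ forall l m : nat -> C,
    multiplier q W l -> multiplier q W m ->
    (forall n, (n < N)%N -> cabs (l n - m n) <= d) ->
    S_norm q (synthesis l - synthesis m) <= e.
Proof.
move=> e0.
have [W0|W0] := ltP W 0.
  exists 0%N, 1; split=> // l m [lW _] _ _.
  by have := le_lt_trans (lW 0%N) W0; rewrite ltNge cabs_ge0.
have q1 := ltW hq; have q0 : 0 < q by exact: lt_le_trans q1.
have ay := adm_ycoef.
have W1 : 0 < W + 1 by rewrite ltr_wpDl.
(* small enough for 2 W times it to be at most e / 8 *)
have e1 : 0 < e / (16 * (W + 1)) by rewrite divr_gt0// mulr_gt0.
have [s [s01 hs]] := dilation_cvg hq ay hA e1.
have /andP[s0 s1] := s01.
have s01' : 0 <= s < 1 by rewrite (ltW s0).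
have e8 : 0 < e / 8 by rewrite divr_gt0.
have W2 : 0 <= W + W by rewrite addr_ge0.
have [N [d [d0 hd]]] := coef_small ay s01' W2 e8.
have t1 : 0 < cabs (eta 1%N) + 1 by rewrite ltr_wpDl// cabs_ge0.
have d1 : 0 < e / (4 * (cabs (eta 1%N) + 1)) by rewrite divr_gt0// mulr_gt0.
exists N.+1, (Num.min d (e / (4 * (cabs (eta 1%N) + 1)))); split.
  by rewrite lt_min d0.
move=> l m hl hm lm; have [lW ml] := hl; have [mW mm] := hm.
pose D n := l n - m n.
have hD : multiplier q (W + cabs (-1 : C) * W) (fun n => l n + -1 * m n).
  exact: (multiplierD q1 hl (multiplierZ (-1) q1 hm)).
have DE : D = fun n => l n + -1 * m n.
  by apply/funext => n; rewrite mulN1r.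
rewrite -DE cabsN cabs1 mul1r in hD; have [DW mD] := hD.
have aD := adm_mult DW (adm_shift aeta).
have FE z : disc z -> (synthesis l - synthesis m) z = ps (fun n => D n * eta n.+1) z.
  move=> dz; rewrite -[LHS]/(synthesis l z - synthesis m z).
  rewrite (synthesisE hl dz) (synthesisE hm dz).
  rewrite -(psB (adm_mult lW (adm_shift aeta)) (adm_mult mW (adm_shift aeta)) dz).
  by congr (ps _ z); apply/funext => n; rewrite -mulrBl.
have lmd n : (n < N.+1)%N -> cabs (D n) <= d.
  by move=> nN; apply: (le_trans (lm n nN)); rewrite ge_min lexx.
have D0 : cabs (D 0%N * eta 1%N) <= e / 4.
  rewrite cabsM; have h0 := lm 0%N isT.
  have {}h0 : cabs (D 0%N) <= e / (4 * (cabs (eta 1%N) + 1)).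
    by apply: (le_trans h0); rewrite ge_min lexx orbT.
  apply: (@le_trans _ _ (e / (4 * (cabs (eta 1%N) + 1)) * (cabs (eta 1%N) + 1))).
    apply: ler_pM; rewrite ?cabs_ge0//.
    by rewrite lerDl.
  rewrite le_eqVlt; apply/orP; left; apply/eqP.
  by move: (cabs (eta 1%N) + 1) t1 => u u0; field; rewrite gt_eqF.
have a1 : adm (fun n => (1 - s ^+ n)%:C * ycoef eta n).
  apply: (@adm_mult _ 1 (fun n => (1 - s ^+ n)%:C)) ay => n.
  have s01'' : 0 <= s <= 1 by rewrite !ltW.
  have /andP[h1 _] := onem_exprn_le n s01''.
  by rewrite cabsR ger0_norm// gerBl exprn_ge0// ltW.
have sb n : cabs ((s%:C : C) ^+ n) <= 1.
  by rewrite cabsX cabsR ger0_norm ?(ltW s0)// exprn_ile1 ?(ltW s0)// ltW.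
have a2 := adm_mult DW a1; have ay' := adm_mult DW ay.
have a3 := adm_mult sb ay'.
(* e / 8 from each part of the splitting *)
have bound r : 0 < r < 1 -> Mq q r (ps (ncoef (fun n => D n * eta n.+1))) <= e / 4.
  move=> r01; rewrite ncoef_symbol.
  have E z : disc z -> ps (fun n => D n * ycoef eta n) z =
      ps (fun n => D n * ((1 - s ^+ n)%:C * ycoef eta n)) z +
      ps (fun n => s%:C ^+ n * (D n * ycoef eta n)) z.
    move=> dz; rewrite -(psD a2 a3 dz); congr (ps _ z); apply/funext => n.
    rewrite rmorphB rmorph1 rmorphXn/=.
    by move: (s%:C ^+ n) (D n) (ycoef eta n) => u v w; ring.
  have hE := eq_ler (Mq_eq q r01 E).
  apply: (le_trans hE); apply: (le_trans (MqD q1 (Hol_ps a2) (Hol_ps a3) r01)).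
  have -> : e / 4 = e / 8 + e / 8 by field.
  apply: lerD.
    apply: (le_trans (mD _ r a1 r01)).
    apply: (le_trans (ler_wpM2l W2 (hs r r01))).
    apply: (@le_trans _ _ ((2 * (W + 1)) * (e / (16 * (W + 1))))).
      apply: ler_wpM2r; first exact: ltW.
      by rewrite mulr_natl mulr2n lerD// lerDl.
    rewrite le_eqVlt; apply/orP; left; apply/eqP.
    by move: (W + 1) W1 => u u0; field; rewrite gt_eqF.
  apply: (Mq_sup q0 (Hol_ps a3) r01 (ltW e8)) => t; rewrite ps_dilate.
  apply: (hd D DW) => [n nN|]; first by apply: lmd; exact: ltnW.
  have /andP[r0 r1] := r01.
  rewrite cabsM cabsR (ger0_norm (ltW s0)) (cabs_circ t (ltW r0)).
  by rewrite ler_piMr ?(ltW s0)// ltW.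
apply: (le_trans (S_norm_le aD FE bound)).
apply: (@le_trans _ _ (e / 4 + 2 * (e / 4))); first by rewrite lerD2r.
have -> : e / 4 + 2 * (e / 4) = 3 / 4 * e by field.
by rewrite ler_piMl ?(ltW e0)// ler_pdivrMr// mul1r ler_nat.
Qed.

End Synthesis.
End Symbol.

(** * Compactness of the set of multipliers *)

Section Compactness.
Context {R : realType} (q : R) (hq : 1 < q).
Local Notation C := (R[i]^o).
Variables (g : C -> C) (eta : nat -> C).
Hypothesis heta : forall z : C, disc z ->
  series (fun n : nat => eta n * z ^+ n : C) @ \oo --> g z.
Variable A : R.
Hypothesis hA : forall r, 0 < r < 1 -> Mq q r (ps (ycoef eta)) <= A.

Lemma compact_square (W : R) :
  compact [set z : C | `|complex.Re z| <= W /\ `|complex.Im z| <= W].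
Proof.
pose J : set R := [set` `[- W, W]%R].
have cJ : compact (J `*` J) by apply: compact_setX; exact: segment_compact.
pose F (z : R * R) : C := z.1 +i* z.2.
have cF : continuous F.
  move=> z; apply/cvgCP => e e0.
  have e2 : 0 < e / 2 by rewrite divr_gt0.
  have h1 : \forall w \near z, `|z.1 - w.1| < e / 2.
    have c1 : fst @ z --> z.1 by exact: cvg_fst.
    by move/cvgrPdist_lt : c1; apply.
  have h2 : \forall w \near z, `|z.2 - w.2| < e / 2.
    have c2 : snd @ z --> z.2 by exact: cvg_snd.
    by move/cvgrPdist_lt : c2; apply.
  apply: filterS2 h1 h2 => w g1 g2.
  have -> : F w - F z = (w.1 - z.1) +i* (w.2 - z.2) by [].
  rewrite [_ +i* _]complexE (le_lt_trans (cabsD _ _))// cabsM !cabsR.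
  have -> : cabs ('i : C) = 1 by rewrite /cabs normc_def/= expr0n expr1n add0r sqrtr1.
  rewrite mul1r (distrC w.1) (distrC w.2) (_ : e = e / 2 + e / 2); last by field.
  exact: ltrD.
have := continuous_compact (continuous_subspaceT cF) cJ.
congr compact; apply/seteqP; split.
  move=> _ [[a b] [/= ha hb] <-] /=; split.
    by move: ha; rewrite /J/= in_itv/= -ler_norml.
  by move: hb; rewrite /J/= in_itv/= -ler_norml.
move=> [a b] /= [ha hb]; exists (a, b); last by [].
by split; rewrite /J/= in_itv/= -ler_norml.
Qed.

(* sequences with the topology of coordinatewise convergence *)
Local Notation X := (prod_topology (fun _ : nat => (C : topologicalType))).

(** Basic neighbourhoods of the product topology control finitely many coordinates. *)
Lemma near_coords (l : X) (N : nat) (d : R) : 0 < d ->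
  \forall m \near l, forall n, (n < N)%N -> cabs (l n - m n) <= d.
Proof.
move=> d0; elim: N => [|N IH].
  apply: (@filterE _ _ (nbhs_filter l)).
  move=> m n.
  by rewrite ltn0.
have pc : (fun m : X => m N : C) @ nbhs l --> (l N : C).
  exact: (@proj_continuous nat (fun _ : nat => (C : topologicalType)) N l).
have h := (@cvgCP R X (nbhs l) (nbhs_filter l) (fun m : X => m N : C) (l N)).1 pc.
have {}h := h d d0.
apply: (@filterS2 _ _ (nbhs_filter l) _ _ _ _ IH h).
move=> m hm {}h n; rewrite ltnS leq_eqVlt => /predU1P[->|]; last exact: hm.
by rewrite cabsBC ltW.
Qed.

(** The coordinates stay in a fixed square, and being a multiplier of norm at most W is a
    closed condition. *)
Lemma compact_multipliers (W : R) : compact [set l : X | multiplier q W l].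
Proof.
pose S : set C := [set z : C | `|complex.Re z| <= W /\ `|complex.Im z| <= W].
have cS : compact [set l : X | forall n, S (l n)].
  exact (@tychonoff nat (fun _ : nat => (C : topologicalType)) (fun=> S) (fun=> @compact_square W)).
apply: (subclosed_compact _ cS); last first.
  move=> l [lW _] n; split.
    exact: le_trans (cabs_Re _) (lW n).
  exact: le_trans (cabs_Im _) (lW n).
move=> l hl; apply: (multiplier_closed (ltW hq)) => N d d0.
have [m [hm lm]] := hl _ (near_coords l N d0).
by exists m.
Qed.

Lemma synthesis_within (W : R) :
  {within [set l : X | multiplier q W l], continuous (synthesis hq eta : X -> Sspace (ltW hq))}.
Proof.
apply/subspace_continuousP => l hl; apply/cvgrPdist_le => e /pos_cplx[e0 ->].
have [N [d [d0 hd]]] := synthesis_continuous hq heta hA W e0.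
have := near_coords l N d0; rewrite near_withinE => h.
apply: (@filterS _ _ (nbhs_filter l) _ _ _ h) => m hm hWm.
have := hd l m hl hWm hm.
by rewrite -lecR.
Qed.

Lemma compact_synthesis (W : R) :
  compact [set synthesis hq eta l | l in [set l : X | multiplier q W l]].
Proof. exact (@continuous_compact _ _ _ _ (@synthesis_within W) (@compact_multipliers W)). Qed.

End Compactness.

(** * The generalized Hilbert operator *)

Section Operator.
Context {R : realType} (p q : R) (hp : 1 <= p) (hq : 1 < q).
Local Notation C := (R[i]^o).
Variables (g : C -> C) (eta : nat -> C).
Hypothesis heta : forall z : C, disc z ->
  series (fun n : nat => eta n * z ^+ n : C) @ \oo --> g z.

Lemma hilbert_op_moment (f : C -> C) z :
  hilbert_op eta f z = ps (fun n => moment (taylor f) n * eta n.+1) z.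
Proof.
rewrite /hilbert_op /ps /csum; congr (limn (series _)); apply/funext => n.
by congr (_ * _); exact: mulrAC.
Qed.

(** A bound affine in the norm of F is enough: continuity and compactness only look at
    the unit ball. *)
Lemma S_moment_multiplier (F : Sspace hp) :
  multiplier q (2 * pi * S_norm p F + 2 + S_norm p F) (moment (taylor F)).
Proof.
have [aF FE] := S_expansion F.
have B0 : 0 <= fine (hardy_norm p (derive1 F)) by rewrite fine_ge0// hardy_norm_ge0.
have := moment_multiplier (ltW hq) hp aF B0 (S_Mq F).
apply: multiplier_le.
have F0 : taylor F 0%N = F 0 by rewrite (FE 0 (@disc0 R)) ps0.
rewrite F0 /S_norm; set B := fine _ in B0 *.
have c0 := cabs_ge0 (F 0); have p0 := pi_ge0 R.
have h : 0 <= pi * cabs (F 0) by rewrite mulr_ge0.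
move: (cabs (F 0)) (pi : R) B c0 p0 h B0 => c P B c0 p0 h B0; nra.
Qed.

Lemma taylor_lin (a : C) (F G : Sspace hp) n :
  taylor (a *: F + G : Sspace hp) n = a * taylor F n + taylor G n.
Proof.
have [aF FE] := S_expansion F; have [aG GE] := S_expansion G.
rewrite (@taylor_ps R (a *: F + G : Sspace hp) (fun n => a * taylor F n + taylor G n))//.
  exact: admD (admZ a aF) aG.
move=> z dz; rewrite (psD (admZ a aF) aG dz) (psZ a aF dz) -FE// -GE//.
Qed.

(** The moments are limits of series, so linearity rests on their convergence,
    [moment_series]. *)
Lemma moment_lin (a : C) (F G : Sspace hp) n :
  moment (taylor (a *: F + G : Sspace hp)) n =
  a * moment (taylor F) n + moment (taylor G) n.
Proof.
have hB (H : Sspace hp) j : cabs (dcoef (taylor H) j) <= fine (hardy_norm p (derive1 H)).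
  have [aH _] := S_expansion H.
  exact: coef_le hp (adm_dcoef aH) (S_Mq H).
have sF := @moment_series R _ _ n (hB F).
have sG := @moment_series R _ _ n (hB G).
rewrite /moment mulrCA -mulrDr; congr (_ * _).
rewrite (cvg_csum sF) (cvg_csum sG).
rewrite -(cvg_csum (cvg_csumD (cvg_csumZ (a := a) sF) sG)).
by congr csum; apply/funext => k; rewrite taylor_lin mulrDl mulrA.
Qed.

(** The operator sends the constant 1 to (g - g(0))/z. *)
Lemma symbol_of_operator (T : Sspace hp -> Sspace (ltW hq)) :
  agree_on_disc (hilbert_op eta) T -> inS q g.
Proof.
move=> HT.
pose d0 : nat -> C := fun n => (n == 0)%:R.
have ad0 : adm d0.
  by apply: (@adm_bounded R 1) => j; rewrite /d0; case: eqP; rewrite ?cabs1 ?cabs0.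
have nd0 : ncoef d0 = fun=> 0.
  by apply/funext => n; rewrite /ncoef /d0; case: eqP => [->|]; rewrite ?mul0r ?mulr0.
have h0 r : 0 < r < 1 -> Mq p r (ps (ncoef d0)) <= 0.
  move=> r01; have p0 : 0 < p := lt_le_trans ltr01 hp.
  have e0 z : disc z -> ps (ncoef d0) z = (fun=> 0 : C) z.
    by move=> _; rewrite nd0 ps_zero.
  apply: (le_trans (eq_ler (Mq_eq p r01 e0))).
  by rewrite (Mq_cst r _ p0) cabs0.
have [F FE] := S_exists hp ad0 h0.
have tF : taylor F = d0 by exact: taylor_ps ad0 FE.
have mF n : moment (taylor F) n = 1.
  rewrite tF /moment.
  have h : series (fun k => d0 k / (n + k + 1)%:R) @ \oo --> ((n.+1%:R)^-1 + 0 : C).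
    have := @cvg_series_recl R (fun k => d0 k / (n + k + 1)%:R) 0.
    rewrite /d0 /= mul1r addn0 addn1; apply.
    rewrite (_ : series _ = fun=> 0); first exact: cvg_cst.
    by apply/funext => N; rewrite /series/= big1// => i _; rewrite mul0r.
  by rewrite (cvg_csum h) addr0 divff// pnatr_eq0.
have TE z : disc z -> T F z = ps (fun n => eta n.+1) z.
  move=> dz; rewrite HT// hilbert_op_moment; congr (ps _ z); apply/funext => n.
  by rewrite mF mul1r.
have aeta := adm_cvg heta; have ae := adm_shift aeta.
have q1 := ltW hq; have q0 : 0 < q by exact: lt_le_trans q1.
apply/(symbol_S_iff hq heta).
exists (fine (hardy_norm q (derive1 (T F)))) => r r01.
have tTF : taylor (T F) = fun n => eta n.+1 by exact: taylor_ps ae TE.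
have h := S_Mq (T F) r01; rewrite tTF in h.
have := Mq_mulz q1 (adm_dcoef ae) r01 h.
apply: le_trans; apply: eq_ler; apply: (Mq_eq q r01) => z dz.
exact: (ps_ncoef ae dz).
Qed.

(** A linear map that sends the unit ball into a compact set is bounded as well; here the
    bound on the ball is also explicit. *)
Lemma operator_of_symbol : inS q g -> exists T : {linear Sspace hp -> Sspace (ltW hq)},
  [/\ agree_on_disc (hilbert_op eta) T, continuous T &
      compact (closure (T @` ball (0 : Sspace hp) 1))].
Proof.
move=> /(symbol_S_iff hq heta) [A hA].
pose T (F : Sspace hp) : Sspace (ltW hq) := synthesis hq eta (moment (taylor F)).
have TE (F : Sspace hp) z : disc z -> T F z = ps (fun n => moment (taylor F) n * eta n.+1) z.
  exact: synthesisE heta A hA _ _ _ (S_moment_multiplier F).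
have aeta := adm_cvg heta; have ae := adm_shift aeta.
have am (F : Sspace hp) : adm (fun n => moment (taylor F) n * eta n.+1).
  by have [lW _] := S_moment_multiplier F; exact: adm_mult lW ae.
have linT : linear T.
  move=> a F G; apply: S_ext => z dz.
  apply: (etrans (TE _ z dz)).
  apply: (etrans _ (esym (f_equal2 (fun u v : C => a * u + v) (TE F z dz) (TE G z dz)))).
  apply: (etrans _ (etrans (psD (admZ a (am F)) (am G) dz)
    (congr1 (fun u : C => u + _) (psZ a (am F) dz)))).
  by congr (ps _ z); apply/funext => n; rewrite moment_lin mulrDl mulrA.
pose TLm := GRing.isLinear.Build _ _ _ _ T linT.
pose TL : {linear Sspace hp -> Sspace (ltW hq)} := HB.pack T TLm.
pose W : R := 2 * pi + 3.
have inK (F : Sspace hp) : ball (0 : Sspace hp) 1 F -> multiplier q W (moment (taylor F)).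
  rewrite -ball_normE /= sub0r normrN => F1.
  have {}F1 : S_norm p F < 1 by rewrite -ltcR.
  apply: multiplier_le (S_moment_multiplier F).
  have p0 := pi_ge0 R.
  have : pi * S_norm p F <= pi * 1 by rewrite ler_wpM2l// ltW.
  rewrite /W; move: (S_norm p F) (pi : R) F1 p0 => c P F1 p0; lra.
exists TL; split.
- by move=> F z dz; rewrite hilbert_op_moment -TE.
- apply: bounded_linear_continuous.
  pose M := W * cabs (eta 1%N) + 2 * (W * A).
  exists (M%:C); split; first by apply/complex_realP; exists M.
  move=> K MK; near=> F.
  apply: le_trans (ltW MK).
  have F1 : ball (0 : Sspace hp) 1 F by near: F; exact: nbhsx_ballx.
  have := synthesis_bound hq heta hA (inK F F1).
  by rewrite -lecR.
have cK := @compact_synthesis _ _ hq _ _ heta _ hA W.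
apply: (subclosed_compact _ cK); first exact: closed_closure.
have clK := compact_closed (@norm_hausdorff _ _) cK.
rewrite closureE; apply: smallest_sub; first exact: clK.
by move=> _ [F F1 <-]; exists (moment (taylor F)); [exact: inK|].
Unshelve. all: by end_near. Qed.

End Operator.

Theorem theorem5 (R : realType) (p q : R) (hp : 1 <= p) (hq : 1 < q)
    (g : R[i]^o -> R[i]^o) (eta : nat -> R[i]^o)
    (hg : Hol g)
    (heta : forall z : R[i]^o, disc z ->
      series (fun n : nat => eta n * z ^+ n : R[i]^o) @ \oo --> g z) :
  (bounded_op hp (ltW hq) (hilbert_op eta) <->
   compact_op hp (ltW hq) (hilbert_op eta)) /\
  (compact_op hp (ltW hq) (hilbert_op eta) <-> inS q g).
Proof.
have toS (T : Sspace hp -> Sspace (ltW hq)) : agree_on_disc (hilbert_op eta) T -> inS q g.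
  exact: symbol_of_operator heta T.
have fromS := operator_of_symbol hp hq heta.
split; split.
- by move=> [T [/toS/fromS[T' [aT' _ cT']] _]]; exists T'; split.
- by move=> [T [/toS/fromS[T' [aT' cT' _]] _]]; exists T'; split.
- by move=> [T [/toS]].
- by move=> /fromS[T' [aT' _ cT']]; exists T'; split.
Qed.
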